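(* Let $\xi<\omega_1$ and let $(f_n)$ be a normalized weakly null sequence in $C(\omega^{\omega^\xi})$. Then there exist an infinite set $M\subset\mathbb{N}$ such that $(f_n)_{n\in M}$ is a Schauder basic sequence, an ordinal $\alpha\le\xi$, and a block basis of $\alpha$-averages of $(f_n)$ supported by $M$ which is equivalent to the unit vector basis of $c_0$.
   Context: For an ordinal $\alpha$, $C(\alpha)$ denotes the Banach space of scalar valued continuous functions on the ordinal interval $[1,\alpha]$ with the order topology, under the sup norm. $[M]$ denotes the set of infinite subsets of $M\subset\mathbb{N}$. Associated sequences: to every countable ordinal $\alpha\ge 1$ a sequence of successor ordinals $(\alpha_n+1)_{n}$ is associated once and for all: if $\alpha$ is a successor, $\alpha_n=\alpha-1$ for all $n$; if $\alpha$ is a limit ordinal, $(\alpha_n+1)$ is a (fixed) strictly increasing sequence of ordinals tending to $\alpha$. Let $(e_n)$ be a normalized sequence and $M\in[\mathbb{N}]$ be such that $(e_n)_{n\in M}$ is a basic sequence. A block of $(e_n)_{n\in M}$ is a nonzero finite linear combination $u=\sum_{n\in M} a_ne_n$, with $\mathrm{supp}\,u=\{n\in M:a_n\neq0\}$; $u<v$ means $\max\mathrm{supp}\,u<\min\mathrm{supp}\,v$; a block basis is an infinite sequence of blocks $u_1<u_2<\cdots$. Transfinite averages: for $\alpha<\omega_1$ and $L\in[M]$, normalized blocks $\alpha_1^L<\alpha_2^L<\cdots$ with $\bigcup_n\mathrm{supp}\,\alpha_n^L=L$ are defined by transfinite recursion on $\alpha$. If $\alpha=0$ and $L=\{l_1<l_2<\cdots\}$,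 then $\alpha_n^L=e_{l_n}$. If $\alpha=\beta+1$, then $\alpha_1^L=\big(\sum_{i=1}^{k}\beta_i^L\big)/\big\|\sum_{i=1}^{k}\beta_i^L\big\|$, where $k$ is the unique integer such that $\{\min\mathrm{supp}\,\beta_i^L: i\le k\}$ is a maximal (under inclusion) member of $S_1=\{F\subset\mathbb{N}: F \text{ finite}, |F|\le\min F\}\cup\{\emptyset\}$ (i.e. $k=\min L$). If $\alpha$ is a limit ordinal with associated sequence $(\alpha_n+1)$ and $l=\min L$, then $\alpha_1^L=e_1$ if $l=1$, and $\alpha_1^L=u/\|u\|$ with $u=\frac1l e_l+[\alpha_l]_1^{L\setminus\{l\}}$ if $l>1$. In the successor and limit cases, $\alpha_{n+1}^L=\alpha_1^{L_{n+1}}$, where $L_{n+1}=\{l\in L: l>\max\mathrm{supp}\,\alpha_n^L\}$. An $\alpha$-average of $(e_n)$ supported by $M$ is any vector $\alpha_1^L$ with $L\in[M]$. A block basis of $\alpha$-averages supported by $M$ is a block basis $u_1<u_2<\cdots$ all of whose terms are $\alpha$-averages supported by $M$. *)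

(* Defs.v *)
From HB Require Import structures.
From mathcomp Require Import all_boot all_order all_algebra finmap.
From mathcomp Require Import wochoice.
From mathcomp Require Import all_classical all_reals all_analysis complex.
Set Implicit Arguments.
Unset Strict Implicit.
Unset Printing Implicit Defensive.
Import Order.TTheory GRing.Theory Num.Theory.
Import numFieldNormedType.Exports.
Local Open Scope classical_set_scope.
Local Open Scope ring_scope.

Definition wo_rel : rel (set nat) := sval (well_ordering_principle (set nat)).

Lemma wo_relP (A : set (set nat)) : A !=set0 ->
  exists z, A z /\ forall y, A y -> wo_rel z y.
Proof.
move=> [x Ax].
have /(_ (mem A)) := svalP (well_ordering_principle (set nat)).
case=> [|z [[Az zA] _]]; first by exists x; apply/mem_set.
exists z; split; first exact/set_mem.
by move=> y Ay; apply: zA; apply/mem_set.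
Qed.

Lemma wo_rel_anti : antisymmetric wo_rel.
Proof.
have := @wo_chain_antisymmetric _ wo_rel predT.
have wc : wo_chain wo_rel predT.
  by apply: withinW; exact: svalP (well_ordering_principle _).
by move=> /(_ wc) h x y; exact: h.
Qed.

Lemma wo_rel_total : total wo_rel.
Proof.
have := @wo_chainW _ wo_rel predT.
have wc : wo_chain wo_rel predT.
  by apply: withinW; exact: svalP (well_ordering_principle _).
by move=> /(_ wc) h x y; exact: h.
Qed.

Lemma wo_rel_trans : transitive wo_rel.
Proof.
move=> y x z xy yz.
have [|w [wE wm]] := @wo_relP [set x; y; z]; first by exists x; do 2 left.
have refl u : wo_rel u u by have /orP[] := wo_rel_total u u.
case: wE wm => [[|]|] -> wm.
- by apply: wm; right.
- have e : x = y by apply: wo_rel_anti; rewrite xy wm//; do 2 left.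
  by rewrite e.
- have e : z = y by apply: wo_rel_anti; rewrite yz wm//; left; right.
  by rewrite e.
Qed.

(* The countable ordinals, i.e. the ordinals below omega_1: the points of the
   uncountable set [set nat] having only countably many predecessors in a
   well-ordering of that set. *)
Definition omega1 : Type :=
  {x : set nat | `[< countable [set y | wo_rel y x] >]}.

HB.instance Definition _ := Choice.on omega1.

Fact omega1_display : Order.disp_t. Proof. exact: Order.Disp tt tt. Qed.

Definition omega1_le (a b : omega1) : bool := wo_rel (sval a) (sval b).

Lemma omega1_le_refl : reflexive omega1_le.
Proof. by move=> x; rewrite /omega1_le; have /orP[] := wo_rel_total (sval x) (sval x). Qed.

Lemma omega1_le_anti : antisymmetric omega1_le.
Proof. by move=> x y /wo_rel_anti; exact: val_inj. Qed.

Lemma omega1_le_trans : transitive omega1_le.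
Proof. by move=> y x z; exact: wo_rel_trans. Qed.

HB.instance Definition _ := Order.Le_isPOrder.Build omega1_display omega1
  omega1_le_refl omega1_le_anti omega1_le_trans.

Lemma omega1_total : total (<=%O : rel omega1).
Proof. by move=> x y; exact: wo_rel_total. Qed.

HB.instance Definition _ :=
  Order.POrder_isTotal.Build omega1_display omega1 omega1_total.

Lemma omega1_min (A : set omega1) : A !=set0 ->
  exists2 z, A z & forall y, A y -> (z <= y)%O.
Proof.
move=> [x Ax].
have [|_ [[z Az <-] h]] := @wo_relP (sval @` A); first by exists (sval x), x.
by exists z => // y Ay; apply: h; exists y.
Qed.

Lemma omega1_wf : well_founded (fun a b : omega1 => (a < b)%O).
Proof.
move=> x; apply: contrapT => nx.
have [|z nz zm] := @omega1_min [set x | ~ Acc (fun a b : omega1 => (a < b)%O) x].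
  by exists x.
apply: nz; constructor => y yz; apply: contrapT => /zm.
by rewrite leNgt yz.
Qed.

Lemma countable_below (a : omega1) : countable [set b : omega1 | (b <= a)%O].
Proof.
have /asboolP ca := svalP a.
apply/countable_injP; have /countable_injP[f fi] := ca.
exists (f \o sval) => x y; rewrite !inE => xa ya /= e.
by apply: val_inj; apply: fi => //; rewrite inE.
Qed.

Lemma uncountable_omega1 : ~ countable [set: omega1].
Proof.
move=> co.
have cs : countable [set x | countable [set y | wo_rel y x]].
  have /countable_injP[f fi] := co.
  apply/countable_injP.
  exists (fun x => if pselect (countable [set y | wo_rel y x]) is left h
     then f (exist _ x (asboolT h)) else 0%N) => x y; rewrite !inE => hx hy.
  case: pselect => // hx'; case: pselect => // hy' /fi.
  by rewrite !inE => /(_ I I) [].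
have nT : ~ countable [set: set nat].
  move=> /countable_injP[f fi].
  have [D DE] : exists D : set nat,
      forall n, D n <-> exists A : set nat, f A = n /\ ~ A n.
    by exists [set n | exists A : set nat, f A = n /\ ~ A n].
  have [DD|nDD] := pselect (D (f D)).
    have /DE[A [fA nA]] := DD.
    have e : A = D by apply: fi; rewrite ?inE.
    by apply: nA; rewrite e.
  by apply: (nDD); apply/DE; exists D.
have [x nx] : (~` [set x | countable [set y | wo_rel y x]]) !=set0.
  apply/set0P/negP => /eqP h; apply: nT; move: cs.
  by rewrite -[X in countable X]setCK h setC0.
have [|z [nz zm]] := @wo_relP (~` [set x | countable [set y | wo_rel y x]]).
  by exists x.
apply: nz => /=.
apply: (@sub_countable _ _ _ ([set z] `|` [set x | countable [set y | wo_rel y x]])).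
  apply: subset_card_le => y yz; have [->|yz'] := eqVneq y z; first by left.
  right; apply: contrapT => /zm zy; move/eqP: yz'; apply.
  by apply: wo_rel_anti; rewrite yz.
rewrite -bigcup2E; apply: bigcup_countable => //.
move=> [|[|i]] _ /=; [exact: countable1|exact: cs|exact: countable0].
Qed.

(* Every countable set of countable ordinals is bounded, hence has a
   supremum; all the suprema taken below are of countable sets. *)
Lemma omega1_bounded (A : set omega1) : countable A -> supremums A !=set0.
Proof.
move=> cA.
have [b Ab] : (ubound A) !=set0.
  apply: contrapT => /set0P/negP/negPn/eqP uA; apply: uncountable_omega1.
  have -> : [set: omega1] = \bigcup_(a in A) [set b | (b <= a)%O].
    apply/seteqP; split => // b _; apply: contrapT => nb.
    suff : ubound A b by rewrite uA.
    move=> a Aa; rewrite leNgt; apply/negP => ba; apply: nb.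
    by exists a => //=; exact: ltW.
  by apply: bigcup_countable => // a _; exact: countable_below.
have [|z uz zm] := @omega1_min (ubound A); first by exists b.
by exists z; split.
Qed.

Lemma ozero_exists : {o : omega1 | forall a : omega1, (o <= a)%O}.
Proof.
apply: cid.
have [|z _ zm] := @omega1_min setT; last by exists z => a; exact: zm.
by apply/set0P/negP => /eqP h; apply: uncountable_omega1; rewrite h.
Qed.

Definition ozero : omega1 := sval ozero_exists.

Definition osup (A : set omega1) : omega1 := supremum ozero A.

Definition osucc (a : omega1) : omega1 :=
  infimum ozero [set b : omega1 | (a < b)%O].

Definition oone : omega1 := osucc ozero.

Definition oomega : omega1 := osup (range (fun n => iter n osucc ozero)).

Definition is_limit (a : omega1) : Prop :=
  a <> ozero /\ forall b, a <> osucc b.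

(* [orec z s b] iterates [s] transfinitely, [b] times, from [z]:
   orec z s b = sup ({z} U {s (orec z s c) : c < b}); for the nondecreasing
   functions used here this is the usual recursion with clauses for 0, for
   successors and for limits. *)
Definition orec (z : omega1) (s : omega1 -> omega1) : omega1 -> omega1 :=
  Fix omega1_wf (fun _ => omega1) (fun b rec =>
    osup [set y | y = z \/ exists c (h : (c < b)%O), y = s (rec c h)]).

Lemma orecE z s b :
  orec z s b = osup (z |` [set s (orec z s c) | c in [set c | (c < b)%O]]).
Proof.
rewrite /orec Fix_eq -/(orec z s); last first.
  move=> x f g fg; congr osup; apply/seteqP; split => y [->|[c [h ->]]];
    by [left|right; exists c, h; rewrite fg].
congr osup; apply/seteqP; split => y.
  by move=> [->|[c [h ->]]]; [left|right; exists c].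
by move=> [->|[c h <-]]; [left|right; exists c, h].
Qed.

Lemma countable_lt (a : omega1) : countable [set c : omega1 | (c < a)%O].
Proof.
apply: (sub_countable _ (countable_below a)).
by apply: subset_card_le => c /= /ltW.
Qed.

Lemma osup_supremums (A : set omega1) : countable A -> A !=set0 ->
  supremums A (osup A).
Proof.
move=> cA /set0P A0; rewrite /osup /supremum (negbTE A0).
by have [x Ax] := omega1_bounded cA; case: xgetP => [y -> //|/(_ x)].
Qed.

Lemma osup_ub (A : set omega1) a : countable A -> A a -> (a <= osup A)%O.
Proof.
by move=> cA Aa; have [|u _] := @osup_supremums A cA; [exists a|exact: u].
Qed.

Lemma osup_le (A : set omega1) b : countable A -> ubound A b -> (osup A <= b)%O.
Proof.
move=> cA Ab; have [->|/set0P A0] := eqVneq A set0.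
  by rewrite /osup supremum0; exact: (svalP ozero_exists).
by have [_ l] := osup_supremums cA A0; exact: l.
Qed.

Lemma ltosucc (a b : omega1) : (b < osucc a)%O = (b <= a)%O.
Proof.
have [c ac] : exists c : omega1, (a < c)%O.
  apply: contrapT => h; apply: uncountable_omega1.
  apply: (sub_countable _ (countable_below a)); apply: subset_card_le => c _ /=.
  by rewrite leNgt; apply/negP => ac; apply: h; exists c.
have [|z az zm] := @omega1_min [set c | (a < c)%O]; first by exists c.
have -> : osucc a = z.
  rewrite /osucc /infimum; case: ifPn => [/eqP e|_].
    by have : [set b | (a < b)%O] z by []; rewrite e.
  have iz : infimums [set b | (a < b)%O] z.
    by split => [y /zm//|y]; apply.
  by case: xgetP => [y _ /(is_subset1_infimums iz)|/(_ _ iz)].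
apply/idP/idP => [bz|ba]; last exact: le_lt_trans az.
by rewrite leNgt; apply/negP => /zm; rewrite leNgt bz.
Qed.

Section orec_theory.
Variables (z : omega1) (s : omega1 -> omega1).
Hypothesis s_infl : forall x, (x <= s x)%O.
Hypothesis s_homo : {homo s : x y / (x <= y)%O}.

Let orec_set b := z |` [set s (orec z s c) | c in [set c | (c < b)%O]].

Let orec_countable b : countable (orec_set b).
Proof.
rewrite /orec_set -bigcup2E; apply: bigcup_countable => // -[|[|i]] _ /=.
- exact: countable1.
- exact: (sub_countable (card_image_le _ _) (countable_lt b)).
- exact: countable0.
Qed.

Lemma orec_homo : {homo orec z s : b c / (b <= c)%O}.
Proof.
move=> b c bc; rewrite (orecE z s b); apply: osup_le; first exact: orec_countable.
move=> x bx; rewrite orecE; apply: osup_ub; first exact: orec_countable.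
case: bx => [->|[d db <-]]; [by left|right; exists d => //=].
exact: lt_le_trans bc.
Qed.

Lemma orec0 : orec z s ozero = z.
Proof.
rewrite orecE (_ : _ `|` _ = [set z]); first by rewrite /osup supremum1.
apply/seteqP; split => [x [//|[c /= + _]]|x ->]; last by left.
by rewrite ltNge (svalP ozero_exists).
Qed.

Lemma orecS b : orec z s (osucc b) = s (orec z s b).
Proof.
apply/eqP; rewrite eq_le; apply/andP; split.
  rewrite orecE; apply: osup_le => [|x [->|[c /= cb <-]]].
  - exact: orec_countable.
  - apply: le_trans (s_infl _); rewrite -{1}orec0; apply: orec_homo.
    exact: (svalP ozero_exists).
  - by apply/s_homo/orec_homo; rewrite -ltosucc.
rewrite (orecE z s (osucc b)); apply: osup_ub; first exact: orec_countable.
by right; exists b => //=; rewrite ltosucc.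
Qed.

Lemma orec_limit a : is_limit a ->
  orec z s a = osup [set orec z s c | c in [set c | (c < a)%O]].
Proof.
move=> [a0 aS].
have cA : countable [set orec z s c | c in [set c | (c < a)%O]].
  exact: (sub_countable (card_image_le _ _) (countable_lt a)).
apply/eqP; rewrite eq_le; apply/andP; split; last first.
  by apply: osup_le => // _ [c /= ca <-]; apply/orec_homo/ltW.
rewrite orecE; apply: osup_le => [|x [->|[c /= ca <-]]].
- exact: orec_countable.
- rewrite -{1}orec0; apply: osup_ub => //; exists ozero => //=.
  by rewrite lt_neqAle (svalP ozero_exists) andbT; apply/eqP => /esym.
- rewrite -orecS; apply: osup_ub => //; exists (osucc c) => //=.
  rewrite lt_neqAle; apply/andP; split; first by apply/eqP => /esym; exact: aS.
  by rewrite leNgt ltosucc -ltNge.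
Qed.

End orec_theory.

Definition oadd (a b : omega1) : omega1 := orec a osucc b.

Definition omul (a b : omega1) : omega1 := orec ozero (oadd^~ a) b.

Definition oexp (a b : omega1) : omega1 := orec oone (omul^~ a) b.

Definition ointerval (a : omega1) : Type := {b : omega1 | (oone <= b <= a)%O}.

HB.instance Definition _ (a : omega1) := SubChoice.on (ointerval a).
HB.instance Definition _ (a : omega1) :=
  [SubChoice_isSubOrder of ointerval a by <: with omega1_display].

Lemma ointerval_compact (a : omega1) : compact [set: order_topology (ointerval a)].
Proof.
move=> F FF _.
pose P (x : omega1) := forall A, F A -> exists2 z : ointerval a, A z & (sval z <= x)%O.
have Pa : P a.
  move=> A FA; have [z Az] := filter_ex FA; exists z => //.
  by case: (z) => /= y /andP[].
have [|x Px xm] := @omega1_min P; first by exists a.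
have x1 : (oone <= x <= a)%O.
  rewrite xm// andbT.
  have [z _ zx] := Px _ filterT; apply: le_trans zx.
  by case: (z) => /= y /andP[].
pose xx : ointerval a := exist _ x x1.
exists xx; split => // A B FA.
rewrite (@itv_nbhsE _ (order_topology (ointerval a))) => -[[l r] [oi xi] iB].
have [z [Az zi]] : exists z : ointerval a, A z /\ z \in Interval l r; last first.
  by exists z; split => //; exact: iB.
suff [z Az /andP[zx zi]] : exists2 z : ointerval a, A z &
    (sval z <= x)%O && (l <= BLeft z)%O.
  exists z; split => //; rewrite itv_boundlr zi /=.
  move: xi; rewrite itv_boundlr => /andP[_]; apply: le_trans.
  by rewrite bnd_simp.
case: l oi xi iB => [b y|b] oi xi iB /=.
- have yx : (y < xx)%O.
    have := itv_open_ends_lside oi => e; rewrite e in xi.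
    by move: xi; rewrite itv_boundlr => /andP[].
  have : ~ P (sval y) by move/xm; rewrite leNgt => /negP; apply; exact: yx.
  move=> /existsNP[C /not_implyP[FC nC]].
  have [z [Az Cz] zx] := Px _ (filterI FA FC).
  exists z => //; rewrite zx /= (itv_open_ends_lside oi) bnd_simp /=.
  by rewrite ltNge; apply/negP => zy; apply: nC; exists z.
- have [z Az zx] := Px _ FA; exists z => //; rewrite zx /=.
  by rewrite (itv_open_ends_linfty oi).
Qed.

Definition supnorm (K : numFieldType) (T : Type) (f : T -> K) : K :=
  supremum 0 (range (fun x => `|f x|)).

Section supnorm_theory.
Variables (K : numFieldType) (T : Type).
Implicit Types f g : T -> K.

Definition attains_sup f := exists x, forall y, `|f y| <= `|f x|.

Lemma supnormE f x : (forall y, `|f y| <= `|f x|) -> supnorm f = `|f x|.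
Proof.
move=> fx; rewrite /supnorm /supremum; case: ifPn => [/eqP e|_].
  suff : [set `|f y| | y in [set: T]] `|f x| by rewrite e.
  by exists x.
have sx : supremums [set `|f y| | y in [set: T]] `|f x|.
  by split=> [_ [y _ <-]|z]; [exact: fx|apply; exists x].
by case: xgetP => [y _ /(is_subset1_supremums sx)|/(_ _ sx)].
Qed.

Lemma le_supnorm f x : attains_sup f -> `|f x| <= supnorm f.
Proof. by move=> [y fy]; rewrite (supnormE fy). Qed.

Lemma supnorm_le f c : attains_sup f -> (forall x, `|f x| <= c) ->
  supnorm f <= c.
Proof. by move=> [y fy] fc; rewrite (supnormE fy). Qed.

Lemma supnorm_empty f : (T -> False) -> supnorm f = 0.
Proof.
move=> T0; rewrite /supnorm (_ : [set `|f x| | x in [set: T]] = set0) ?supremum0//.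
by apply/seteqP; split => [y [x]|y []]; have := T0 x.
Qed.

Definition sup_attained f := attains_sup f \/ (T -> False).

Lemma supnormD f g : sup_attained f -> sup_attained g -> sup_attained (f + g) ->
  supnorm (f + g) <= supnorm f + supnorm g.
Proof.
have [T0 _ _ _|nT] := pselect (T -> False); first by rewrite !supnorm_empty ?addr0.
move=> [fs|//] [gs|//] [fgs|//]; apply: supnorm_le => // x.
by rewrite (le_trans (ler_normD _ _))// lerD// le_supnorm.
Qed.

Lemma supnormZ a f : sup_attained f -> supnorm (a *: f) = `|a| * supnorm f.
Proof.
move=> [|T0]; last by rewrite !supnorm_empty ?mulr0.
move=> [x fx]; rewrite (supnormE fx) (@supnormE _ x).
  by rewrite -normrM.
by move=> y; rewrite !normrM ler_wpM2l.
Qed.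

Lemma supnorm_eq0 f : sup_attained f -> supnorm f = 0 -> f = 0.
Proof.
move=> [fs f0|T0 _]; last by apply/funext => x; have := T0 x.
apply/funext => x; apply/eqP; rewrite -normr_le0 -f0; exact: le_supnorm.
Qed.

End supnorm_theory.

Lemma continuous_attains (K : numFieldType) (T : topologicalType) (f : T -> K) :
  compact [set: T] -> continuous f -> sup_attained f.
Proof.
move=> cT cf; have [T0|nT] := pselect (T -> False); first by right.
left; have [t0 _] : [set: T] !=set0.
  by apply: contrapT => h; apply: nT => x; apply: h; exists x.
pose F := filter_from [set: T] (fun x => [set z | `|f x| <= `|f z|]).
have FF : ProperFilter F.
  apply: filter_from_proper; last by move=> x _; exists x => /=.
  apply: filter_from_filter; first by exists t0.
  move=> x y _ _; have /orP[xy|yx] := real_leVge (normr_real (f x)) (normr_real (f y)).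
    by exists y => // z /= yz; split => //; exact: le_trans yz.
  by exists x => // z /= xz; split => //; exact: le_trans xz.
have [y [_ Fy]] := cT _ FF filterT.
exists y => x.
have [//|yx] := real_leP (normr_real (f x)) (normr_real (f y)).
have [||z [/= xz]] := Fy [set z | `|f x| <= `|f z|] [set z | `|f z| < `|f x|].
- by exists x.
- have d0 : 0 < `|f x| - `|f y| by rewrite subr_gt0.
  have : \forall z \near y, `|f y - f z| < `|f x| - `|f y|.
    by move/cvgrPdist_lt : (cf y); apply.
  apply: filterS => z /=; rewrite ltrBrDr; apply: le_lt_trans.
  rewrite -lerBlDr distrC; exact: lerB_dist.
- by move=> /(le_lt_trans xz); rewrite ltxx.
Qed.

Lemma null_attains (K : numFieldType) (a : nat -> K) :
  a @ \oo --> (0 : K) -> sup_attained a.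
Proof.
move=> a0; left.
have [[m am]|a00] := pselect (exists m, a m != 0); last first.
  exists 0%N => y; have -> : a y = 0; last by rewrite normr0.
  by apply/eqP; apply: contrapT => /negP ay; apply: a00; exists y.
have : \forall n \near \oo, `|a n| < `|a m|.
  have am0 : 0 < `|a m| by rewrite normr_gt0.
  move/cvgrPdist_lt : a0 => /(_ _ am0); apply: filterS => n.
  by rewrite sub0r normrN.
move=> [N _ hN].
have [k hk] : exists k, forall n, (n < N.+1)%N -> `|a n| <= `|a k|.
  elim: N.+1 => [|M [k hk]]; first by exists 0%N.
  have /orP[kM|Mk] := real_leVge (normr_real (a k)) (normr_real (a M)).
    exists M => n; rewrite ltnS leq_eqVlt => /predU1P[->//|/hk h].
    exact: le_trans kM.
  by exists k => n; rewrite ltnS leq_eqVlt => /predU1P[->//|/hk].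
have mN : (m < N)%N.
  by rewrite ltnNge; apply/negP => /hN /=; rewrite ltxx.
exists k => n; have [nN|Nn] := ltnP n N; first by apply: hk; exact: ltnW.
by apply: le_trans (ltW (hN _ Nn)) (hk _ _); exact: ltnW.
Qed.

Lemma continuous_lin (K : numFieldType) (T : topologicalType) (c : K)
    (f g : T -> K) :
  continuous f -> continuous g -> continuous (fun x => c * f x + g x).
Proof.
move=> cf cg x; apply: (@continuousD K K T (c \*o f) g x); last exact: cg.
by apply: (@continuousM K T (cst c) f x); [exact: cst_continuous|exact: cf].
Qed.

Definition Cspace (K : numFieldType) (a : omega1) : Type :=
  continuousType (order_topology (ointerval a)) K.

Section Cspace_instances.
Variables (K : numFieldType) (a : omega1).
Local Notation T := (order_topology (ointerval a)).

Definition continuousb (f : T -> K) : bool := `[< continuous f >].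

Definition Cspace_fun (f : Cspace K a) : T -> K := f.

Definition Cspace_Sub (f : T -> K) (fP : continuousb f) : Cspace K a :=
  HB.pack f (isContinuous.Build _ _ f (asboolW fP)).

Lemma Cspace_rect (P : Cspace K a -> Type) :
  (forall f fP, P (@Cspace_Sub f fP)) -> forall f, P f.
Proof.
move=> h f; have fP : continuousb f by apply/asboolP; exact: cts_fun.
suff -> : f = @Cspace_Sub f fP by [].
exact/continuousEP.
Qed.

Lemma Cspace_SubK f fP : Cspace_fun (@Cspace_Sub f fP) = f.
Proof. by []. Qed.

HB.instance Definition _ := Choice.on (Cspace K a).
HB.instance Definition _ :=
  isSub.Build (T -> K) continuousb (Cspace K a) Cspace_rect Cspace_SubK.
Lemma continuousb_submod : submod_closed continuousb.
Proof.
split=> [|c f g /asboolP cf /asboolP cg]; first exact/asboolP/cst_continuous.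
apply/asboolP; exact: continuous_lin cf cg.
Qed.
HB.instance Definition _ :=
  GRing.isSubmodClosed.Build K (T -> K) continuousb continuousb_submod.
HB.instance Definition _ := [SubChoice_isSubLmodule of Cspace K a by <:].

Lemma Cspace_good (f : Cspace K a) : sup_attained (f : T -> K).
Proof.
by apply: continuous_attains; [exact: ointerval_compact|exact: cts_fun].
Qed.

Definition Cspace_norm (f : Cspace K a) : K := supnorm (f : T -> K).

Lemma Cspace_normD (f g : Cspace K a) :
  Cspace_norm (f + g) <= Cspace_norm f + Cspace_norm g.
Proof. by apply: supnormD; [..|exact: (Cspace_good (f + g))]; exact: Cspace_good. Qed.

Lemma Cspace_normZ (c : K) (f : Cspace K a) :
  Cspace_norm (c *: f) = `|c| * Cspace_norm f.
Proof. by apply: supnormZ; exact: Cspace_good. Qed.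

Lemma Cspace_norm_eq0 (f : Cspace K a) : Cspace_norm f = 0 -> f = 0.
Proof. by move=> f0; apply/val_inj/(supnorm_eq0 (Cspace_good f) f0). Qed.

HB.instance Definition _ := Lmodule_isNormed.Build K (Cspace K a)
  Cspace_normD Cspace_normZ Cspace_norm_eq0.

End Cspace_instances.

Definition c0_seq (K : numFieldType) (u : nat -> K) : bool :=
  `[< u @ \oo --> (0 : K) >].

Definition c0 (K : numFieldType) : Type := {u : nat -> K | c0_seq u}.

Section c0_instances.
Variable K : numFieldType.

HB.instance Definition _ := SubChoice.on (c0 K).

Lemma c0_submod : submod_closed (@c0_seq K).
Proof.
split=> [|c u v /asboolP u0 /asboolP v0].
  by apply/asboolP; exact: (@cvg_cst _ (0 : K)).
apply/asboolP; rewrite (_ : 0 = c * 0 + 0); last by rewrite mulr0 addr0.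
by apply: (@cvgD _ K); [apply: (@cvgM K); [exact: cvg_cst|exact: u0]|exact: v0].
Qed.
HB.instance Definition _ :=
  GRing.isSubmodClosed.Build K (nat -> K) (@c0_seq K) c0_submod.
HB.instance Definition _ := [SubChoice_isSubLmodule of c0 K by <:].

Lemma c0_good (u : c0 K) : sup_attained (val u).
Proof. by apply: null_attains; apply/asboolP; exact: (valP u). Qed.

Definition c0_norm (u : c0 K) : K := supnorm (val u).

Lemma c0_normD (u v : c0 K) : c0_norm (u + v) <= c0_norm u + c0_norm v.
Proof. by apply: supnormD; [..|exact: (c0_good (u + v))]; exact: c0_good. Qed.

Lemma c0_normZ (c : K) (u : c0 K) : c0_norm (c *: u) = `|c| * c0_norm u.
Proof. by apply: supnormZ; exact: c0_good. Qed.

Lemma c0_norm_eq0 (u : c0 K) : c0_norm u = 0 -> u = 0.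
Proof. by move=> u0; apply/val_inj/(supnorm_eq0 (c0_good u) u0). Qed.

HB.instance Definition _ :=
  Lmodule_isNormed.Build K (c0 K) c0_normD c0_normZ c0_norm_eq0.

End c0_instances.

Definition unit_seq (K : numFieldType) (i : nat) : nat -> K := fun n => (n == i)%:R.

Lemma unit_seq_c0 (K : numFieldType) (i : nat) : c0_seq (unit_seq K i).
Proof.
apply/asboolP/cvgrPdist_lt => e e0; exists i.+1 => // n /= ni.
by rewrite /unit_seq gtn_eqF// subrr normr0.
Qed.

Definition c0_basis (K : numFieldType) (i : nat) : c0 K :=
  exist _ (unit_seq K i) (unit_seq_c0 K i).

Definition minset (L : set nat) : nat := infimum 0%N L.
Definition maxset (L : set nat) : nat := supremum 0%N L.

(* The increasing enumeration, from 0, of an infinite set of naturals. *)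
Fixpoint elt (L : set nat) (n : nat) : nat :=
  match n with
  | 0 => minset L
  | n'.+1 => minset (L `&` [set l | (elt L n' < l)%N])
  end.

(* The index set N = {1, 2, ...}; a sequence (e_n) over N is a function on [nat]
   whose value at 0 is irrelevant. *)
Definition posnats : set nat := [set n | (0 < n)%N].

Section banach.
Variable K : numFieldType.

Definition weakly_null (V : normedModType K) (x : nat -> V) : Prop :=
  forall phi : {linear V -> K^o}, continuous phi -> phi \o x @ \oo --> (0 : K^o).

Definition lspan (V : normedModType K) (x : nat -> V) : set V :=
  [set v | exists (n : nat) (a : nat -> K), v = \sum_(i < n) a i *: x i].

(* [x] is a Schauder basis of its closed linear span. *)
Definition basic_sequence (V : normedModType K) (x : nat -> V) : Prop :=
  forall v, closure (lspan x) v ->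
    exists! a : nat -> K, series (fun n => a n *: x n) @ \oo --> v.

(* The correspondence x_i <-> y_i extends to an isomorphism between the closed
   linear spans. *)
Definition equivalent (V W : normedModType K) (x : nat -> V) (y : nat -> W) :=
  exists c C : K, [/\ 0 < c, 0 < C & forall (n : nat) (a : nat -> K),
    c * `|\sum_(i < n) a i *: y i| <= `|\sum_(i < n) a i *: x i| <=
    C * `|\sum_(i < n) a i *: y i| ].

(* A finite linear combination of (e_n) is represented by its coefficients,
   which are unique when the sequence is basic. *)
Definition supp (u : nat -> K) : set nat := [set n | u n != 0].

Definition lincomb (V : normedModType K) (e : nat -> V) (u : nat -> K) : V :=
  \sum_(n \in supp u) u n *: e n.

Definition block (M : set nat) (u : nat -> K) : Prop :=
  [/\ finite_set (supp u), supp u !=set0 & supp u `<=` M].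

Definition block_basis (M : set nat) (u : nat -> nat -> K) : Prop :=
  (forall n, block M (u n)) /\
  (forall n, (maxset (supp (u n)) < minset (supp (u n.+1)))%N).

Definition normalize (V : normedModType K) (e : nat -> V) (u : nat -> K) :
  nat -> K := `|lincomb e u|^-1 *: u.

End banach.

(* [s a n], for n >= 1, is the ordinal a_n of the sequence (a_n + 1) associated
   to a; s a 0 is irrelevant. *)
Definition associated_sequences (s : omega1 -> nat -> omega1) : Prop :=
  (forall b n, (0 < n)%N -> s (osucc b) n = b) /\
  (forall a, is_limit a ->
    (forall m n, (0 < m < n)%N -> (osucc (s a m) < osucc (s a n))%O) /\
    ((fun n => osucc (s a n) : order_topology omega1) @ \oo -->
       (a : order_topology omega1))).

Definition schreier1 (F : {fset nat}) : Prop :=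
  F = fset0 \/ (#|` F| <= minset [set` F])%N.

Definition maximal_schreier1 (F : {fset nat}) : Prop :=
  schreier1 F /\ forall G, schreier1 G -> (F `<=` G)%fset -> G = F.

(* [average e s a L n u]: u is the coefficient sequence of the average
   a^L_{n+1} of (e_n), relative to the associated sequences s. *)
Inductive average (K : numFieldType) (V : normedModType K) (e : nat -> V)
    (s : omega1 -> nat -> omega1) :
    omega1 -> set nat -> nat -> (nat -> K) -> Prop :=
| average_zero L n : average e s ozero L n (unit_seq K (elt L n))
| average_succ b L k (u : nat -> nat -> K) :
    (forall i, (i < k)%N -> average e s b L i (u i)) ->
    maximal_schreier1 [fset minset (supp (u i)) | i in iota 0 k]%fset ->
    average e s (osucc b) L 0 (normalize e (\sum_(i < k) u i))
| average_limit1 a L : is_limit a -> minset L = 1%N ->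
    average e s a L 0 (unit_seq K 1)
| average_limit a L u : is_limit a -> (1 < minset L)%N ->
    average e s (s a (minset L)) (L `\ minset L) 0 u ->
    average e s a L 0 (normalize e
      ((minset L)%:R^-1 *: unit_seq K (minset L) + u))
| average_next a L n u v : a <> ozero ->
    average e s a L n u ->
    average e s a (L `&` [set l | (maxset (supp u) < l)%N]) 0 v ->
    average e s a L n.+1 v.

Definition is_average (K : numFieldType) (V : normedModType K) (e : nat -> V)
    (s : omega1 -> nat -> omega1) (a : omega1) (M : set nat) (u : nat -> K) :=
  exists L : set nat, [/\ infinite_set L, L `<=` M &
    average e s a L 0 u].

(* Main.v *)
(* Points of the interval ]0, w^(w^xi)] have Cantor-Bendixson ranks at most
   w^xi, and a closed set of points of ranks in an interval of length w^g is
   said to be of class g. Let al <= xi be the largest ordinal such that some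
   al-averages, arbitrarily far out, are arbitrarily small on any given finite
   union of sets of class al; it exists because this property passes to
   suprema. Choose successive al-averages w_0 < w_1 < ... with |w_i| < 2^-i
   eventually on each of countably many sets to which all the sets of class al
   reduce. By a Ramsey argument, on a subsequence the averages of higher order
   built from (w_i) have almost constant coefficients. By induction on classes,
   for each set of class b > al there are g < b and p such that, for all its
   points t, every initial segment of {i : |w_i(t)| >= 2^-i} is covered by at
   most p successive averages of order g; for arbitrary t, two averages of
   order xi suffice. As averages have norm one, a lower bound on their
   coefficients then bounds sum_i |w_i(t)| on such sets. If the coefficients of
   the averages of order xi could be made small, then for the least such order
   b > al, the bounds at the orders below b would make b-averages small on
   finite unions of sets of class b, contradicting the choice of al. Hence they
   cannot, and sum_i |w_i(t)| is bounded on the whole interval. *)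
From HB Require Import structures.
Require Import Defs.
From mathcomp Require Import finmap.
From mathcomp Require Import all_boot all_order all_algebra.
From mathcomp Require Import all_classical all_reals all_analysis complex.
From mathcomp Require Import zify ring lra.
Set Implicit Arguments.
Unset Strict Implicit.
Unset Printing Implicit Defensive.
Import Order.TTheory GRing.Theory Num.Theory.
Import numFieldNormedType.Exports.
Local Open Scope classical_set_scope.
Local Open Scope ring_scope.

(** * Ordinals *)

Section ordinals.
Local Open Scope order_scope.
Implicit Types a b c x y z : omega1.

(** A class is given by an interval of ranks, not by a bound, because the successor step cuts an
    interval of length [w^(g+1)], up to the largest rank attained, into finitely many intervals of
    length [w^g]; the closed set of points of highest rank is covered before the others. The
    obstacle is that averages of higher order are not built from the base [w_i] alone: each limit
    step adds a basis vector with coefficient [1/l]. This vector is placed at the minimum [d i] of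
    the support of a base vector that is skipped, and [4^i <= d i] makes the total weight of such
    vectors negligible and the normalizing factor of a limit step close to 1. The factors of
    successor steps admit no such estimate, and it is these that the Ramsey argument stabilizes.
    Constants come from a basic subsequence with projections of norm at most 2: interval projections
    then have norm at most 4, sums of successive averages have norm at least 1/4, and normalizing
    factors are at most 4. The thresholds [2^-i] are summable, so that values below them contribute
    a bounded amount to every sum. *)

Lemma ozero_le a : ozero <= a.
Proof. exact: (svalP ozero_exists). Qed.

Lemma lt_ozero a : a < ozero = false.
Proof. by apply/negbTE; rewrite -leNgt ozero_le. Qed.

Lemma osucc_gt a : a < osucc a.
Proof. by rewrite ltosucc. Qed.

Lemma osucc_le a b : (osucc a <= b) = (a < b).
Proof. by rewrite !leNgt ltosucc -ltNge. Qed.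

Lemma osucc_infl a : a <= osucc a.
Proof. exact/ltW/osucc_gt. Qed.

Lemma osucc_homo : {homo osucc : x y / x <= y}.
Proof. by move=> x y xy; rewrite osucc_le ltosucc. Qed.

Lemma osucc_inj : injective osucc.
Proof.
move=> a b e; apply/eqP; rewrite eq_le -(ltosucc b a) -(ltosucc a b) e osucc_gt.
by rewrite -e osucc_gt.
Qed.

Lemma osucc_gt0 a : ozero < osucc a.
Proof. exact: le_lt_trans (ozero_le a) (osucc_gt a). Qed.

Lemma ordinal_cases a : [\/ a = ozero, exists b, a = osucc b | is_limit a].
Proof.
have [->|/eqP a0] := eqVneq a ozero; first by constructor 1.
have [[b ab]|nS] := pselect (exists b, a = osucc b); first by constructor 2; exists b.
by constructor 3; split => // b ab; apply: nS; exists b.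
Qed.

Lemma is_limit_osucc a : ~ is_limit (osucc a).
Proof. by move=> [_ /(_ a)]. Qed.

Lemma is_limit_gt0 a : is_limit a -> ozero < a.
Proof. by move=> [a0 _]; rewrite lt_neqAle ozero_le andbT eq_sym; apply/eqP. Qed.

(** If no element of [A] exceeds [x], then [A] lies below [x], hence is countable, and its supremum
    is a genuine one. *)
Lemma lt_osup (A : set omega1) x : x < osup A -> exists2 a, A a & x < a.
Proof.
move=> xA; apply: contrapT => nA; move: xA; rewrite ltNge => /negP; apply.
have [->|/set0P A0] := eqVneq A set0.
  by rewrite /osup supremum0 ozero_le.
have uA : ubound A x.
  by move=> a Aa; rewrite leNgt; apply/negP => xa; apply: nA; exists a.
have cA : countable A.
  apply: (sub_countable _ (countable_below x)).
  by apply: subset_card_le => a /uA.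
exact: osup_le.
Qed.

Lemma omega1_ind (P : omega1 -> Prop) :
  (forall a, (forall b, b < a -> P b) -> P a) -> forall a, P a.
Proof. by move=> h a; elim/(well_founded_ind omega1_wf) : a. Qed.

Lemma lt_orec z (s : omega1 -> omega1) b x :
  x < orec z s b -> x < z \/ exists2 c : omega1, c < b & x < s (orec z s c).
Proof.
rewrite orecE => /lt_osup[y [->|[c /= cb <-]] xy]; first by left.
by right; exists c.
Qed.

Lemma countable_orec_set z (s : omega1 -> omega1) b :
  countable (z |` [set s (orec z s c) | c in [set c | c < b]]).
Proof.
rewrite -bigcup2E; apply: bigcup_countable => // -[|[|i]] _ /=.
- exact: countable1.
- exact: (sub_countable (card_image_le _ _) (countable_lt b)).
- exact: countable0.
Qed.

Lemma orec_ge z (s : omega1 -> omega1) b : z <= orec z s b.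
Proof. by rewrite orecE; apply: osup_ub; [exact: countable_orec_set|left]. Qed.

Lemma orec_gt z (s : omega1 -> omega1) b c : c < b -> s (orec z s c) <= orec z s b.
Proof.
move=> cb; rewrite (orecE z s b).
by apply: osup_ub; [exact: countable_orec_set|right; exists c].
Qed.

Lemma orec_le z z' (s s' : omega1 -> omega1) b : z <= z' ->
  (forall x y, x <= y -> s x <= s' y) -> orec z s b <= orec z' s' b.
Proof.
move=> zz' ss'; elim/omega1_ind : b => b IH; rewrite (orecE z s b).
apply: osup_le; first exact: countable_orec_set.
move=> _ [->|[c /= cb <-]]; first exact: le_trans (orec_ge _ _ _).
exact: le_trans (ss' _ _ (IH _ cb)) (orec_gt _ _ cb).
Qed.

Lemma oaddr0 x : oadd x ozero = x.
Proof. exact: orec0. Qed.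

Lemma oaddrS x y : oadd x (osucc y) = osucc (oadd x y).
Proof. by rewrite /oadd orecS//; [exact: osucc_infl|exact: osucc_homo]. Qed.

Lemma oadd_lt x y z : y < z -> oadd x y < oadd x z.
Proof. by move=> yz; rewrite -osucc_le; exact: orec_gt. Qed.

Lemma oadd_homo x : {homo oadd x : y z / y <= z}.
Proof. exact: (orec_homo x osucc). Qed.

Lemma oadd_homol y : {homo oadd^~ y : x z / x <= z}.
Proof. by move=> x z xz; apply: orec_le => // ? ?; exact: osucc_homo. Qed.

Lemma oadd_ge x y : x <= oadd x y.
Proof. exact: orec_ge. Qed.

Lemma lt_oadd x y z : z < oadd x y -> z < x \/ exists2 c : omega1, c < y & z <= oadd x c.
Proof.
by move=> /lt_orec[|[c cy]]; [left|rewrite ltosucc; right; exists c].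
Qed.

Lemma oadd0r x : oadd ozero x = x.
Proof.
elim/omega1_ind : x => x IH; apply/eqP; rewrite eq_le; apply/andP; split.
  rewrite leNgt; apply/negP => /lt_oadd[|[c cx]]; first by rewrite lt_ozero.
  by rewrite IH// leNgt cx.
rewrite leNgt; apply/negP => h; have := oadd_lt ozero h.
by rewrite (IH _ h) ltxx.
Qed.

Lemma oaddA x y z : oadd x (oadd y z) = oadd (oadd x y) z.
Proof.
elim/omega1_ind : z => z IH; apply/eqP; rewrite eq_le; apply/andP; split.
  rewrite leNgt; apply/negP => /lt_oadd[|[c]].
    apply/negP; rewrite -leNgt.
    exact: le_trans (oadd_ge _ _) (oadd_ge _ _).
  move=> /lt_oadd[cy|[d dz cd]] h.
    have : oadd (oadd x y) z < oadd x y by apply: le_lt_trans h (oadd_lt _ cy).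
    by rewrite ltNge oadd_ge.
  have : oadd (oadd x y) z <= oadd (oadd x y) d.
    by rewrite -(IH _ dz); apply: le_trans h _; exact: oadd_homo.
  by rewrite leNgt oadd_lt.
rewrite leNgt; apply/negP => /lt_oadd[|[d dz]].
  by apply/negP; rewrite -leNgt; apply: oadd_homo; exact: oadd_ge.
by rewrite -(IH _ dz); apply/negP; rewrite -ltNge; apply: oadd_lt; exact: oadd_lt.
Qed.

Lemma iter_osucc_lt n : iter n osucc ozero < oomega.
Proof.
apply: (@lt_le_trans _ _ (iter n.+1 osucc ozero)); first exact: osucc_gt.
apply: osup_ub; last by exists n.+1.
exact: (sub_countable (card_image_le _ _)).
Qed.

Lemma omul0 x : omul x ozero = ozero.
Proof. exact: orec0. Qed.

Lemma omulS x y : omul x (osucc y) = oadd (omul x y) x.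
Proof.
by rewrite /omul orecS//; [move=> z; exact: oadd_ge|exact: oadd_homol].
Qed.

Lemma omul_iter x n : omul x (iter n osucc ozero) = iter n (oadd^~ x) ozero.
Proof. by elim: n => [|n IH] /=; rewrite ?omul0// omulS IH. Qed.

Lemma omul_homol y : {homo omul^~ y : x z / x <= z}.
Proof.
move=> x z xz; apply: orec_le => // u v uv.
exact: le_trans (oadd_homo u xz) (oadd_homol z uv).
Qed.

Lemma omul_homo x : {homo omul x : y z / y <= z}.
Proof. by apply: orec_homo. Qed.

Lemma omul_omega_ge x : x <= omul x oomega.
Proof.
by have := orec_gt ozero (oadd^~ x) (iter_osucc_lt 0); rewrite orec0 oadd0r.
Qed.

Lemma oexp0 x : oexp x ozero = oone. Proof. exact: orec0. Qed.

Definition wexp (y : omega1) := oexp oomega y.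

Lemma wexpS y : wexp (osucc y) = omul (wexp y) oomega.
Proof.
by rewrite /wexp /oexp orecS//; [exact: omul_omega_ge|exact: omul_homol].
Qed.

Lemma wexp_homo : {homo wexp : x y / x <= y}.
Proof. exact: orec_homo. Qed.

Lemma wexp_gt0 y : ozero < wexp y.
Proof. by apply: lt_le_trans (osucc_gt0 ozero) _; exact: orec_ge. Qed.

Lemma lt_wexp_limit a x : is_limit a -> x < wexp a -> exists2 b : omega1, b < a & x < wexp b.
Proof.
move=> la; rewrite /wexp /oexp (orec_limit oone omul_omega_ge (@omul_homol oomega) la).
by move=> /lt_osup[_ [b ba <-] xb]; exists b.
Qed.

Lemma lt_omul_omega x y : y < omul x oomega -> exists n, y < iter n (oadd^~ x) ozero.
Proof.
move=> /lt_orec[|[c]]; first by rewrite lt_ozero.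
move=> /lt_osup[_ [n _ <-] cn] yc; exists n.+1 => /=; rewrite -omul_iter.
apply: lt_le_trans yc _; apply: oadd_homol; apply: omul_homo; exact: ltW.
Qed.

Lemma iter_oaddA x y n : oadd x (iter n (oadd^~ y) ozero) = iter n (oadd^~ y) x.
Proof. by elim: n => [|n IH] /=; rewrite ?oaddr0// oaddA IH. Qed.

(** Since [w^(g+1) = w^g * w] is the supremum of the finite multiples of [w^g], finitely many steps
    of length [w^g] from [x] pass [y]. *)
Lemma lt_oadd_wexpS x y g : y < oadd x (wexp (osucc g)) ->
  exists n, y < iter n (oadd^~ (wexp g)) x.
Proof.
rewrite wexpS => /lt_oadd[yx|[c /lt_omul_omega[n cn] yc]]; first by exists 0%N.
by exists n; apply: le_lt_trans yc _; rewrite -iter_oaddA; exact: oadd_lt.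
Qed.

Lemma lt_oadd_wexp_limit x y a : is_limit a -> y < oadd x (wexp a) ->
  exists2 b : omega1, b < a & y < oadd x (wexp b).
Proof.
move=> la /lt_oadd[yx|[c /(lt_wexp_limit la)[b ba cb] yc]].
  by exists ozero; [exact: is_limit_gt0|exact: lt_le_trans yx (oadd_ge _ _)].
by exists b => //; apply: le_lt_trans yc _; exact: oadd_lt.
Qed.

Definition oinf (A : set omega1) : omega1 := xget ozero [set a | A a /\ lbound A a].

Lemma oinfP (A : set omega1) : A !=set0 -> A (oinf A) /\ lbound A (oinf A).
Proof.
move=> A0; have [z Az zm] := omega1_min A0.
by rewrite /oinf; case: xgetP => [y _ []//|/(_ z)]; case; split.
Qed.

(* The Cantor-Bendixson rank of [t], for the order topology. *)
Definition rk : omega1 -> omega1 :=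
  Fix omega1_wf (fun _ => omega1) (fun t rec =>
    oinf [set p | exists2 a : omega1, a < t & forall s (h : s < t), a < s -> rec s h < p]).

Lemma rkE t :
  rk t = oinf [set p | exists2 a : omega1, a < t & forall s, a < s -> s < t -> rk s < p].
Proof.
rewrite /rk Fix_eq -/rk; last first.
  move=> x f g fg; congr oinf; apply/seteqP; split => p [a ax h].
    by exists a => // s sx ax'; rewrite -fg; exact: h.
  by exists a => // s sx ax'; rewrite fg; exact: h.
by congr oinf; apply/seteqP; split => p [a ax h]; exists a => // s ? ?; exact: h.
Qed.

Lemma rkP t : ozero < t ->
  (exists2 a : omega1, a < t & forall s, a < s -> s < t -> rk s < rk t) /\
  forall a p, a < t -> (forall s, a < s -> s < t -> rk s < p) -> rk t <= p.
Proof.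
move=> t0; rewrite [rk t]rkE.
set A := [set p | _].
have [] : A (oinf A) /\ lbound A (oinf A).
  (* Any strict bound of all the ranks below [t] shows that the defining set is not empty. *)
  apply: oinfP; exists (osup [set osucc (rk s) | s in [set s | s < t]]).
  exists ozero => // s _ st; rewrite -osucc_le; apply: osup_ub; last by exists s.
  exact: (sub_countable (card_image_le _ _) (countable_lt t)).
by move=> h1 h2; split => // a p at' h; apply: h2; exists a.
Qed.

(** Induction on [g]; the interval []x, x+1[] is empty. For [g = b+1] the interval is cut into steps
    of length [w^b]: interior points of a step have rank below [b], and the end of a step has rank
    at most [b], because the step on its left is a neighbourhood of points of rank below [b]. *)
Lemma rk_lt g x s : x < s -> s < oadd x (wexp g) -> rk s < g.
Proof.
elim/omega1_ind : g x s => g IH x s xs.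
have [->|[b gb]|lg] := ordinal_cases g.
- rewrite /wexp oexp0 /oone oaddrS oaddr0 ltosucc => sx.
  by move: xs; rewrite ltNge sx.
- rewrite gb => /lt_oadd_wexpS sn.
  have bg : b < g by rewrite gb osucc_gt.
  case: (ex_minnP sn) => -[|n]; first by rewrite /= ltNge (ltW xs).
  rewrite iterS => sn1 nmin; rewrite ltosucc.
  have ns : iter n (oadd^~ (wexp b)) x <= s.
    by rewrite leNgt; apply/negP => /nmin; rewrite ltnn.
  move: ns; rewrite le_eqVlt => /predU1P[sE|ns]; last exact/ltW/(IH _ bg _ _ ns).
  case: n sE sn1 nmin => [sE|n sE _ _]; first by rewrite -sE ltxx in xs.
  have [_ h] := rkP (le_lt_trans (ozero_le x) xs).
  apply: (h (iter n (oadd^~ (wexp b)) x)).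
    by rewrite -sE iterS -[X in X < _]oaddr0; apply/oadd_lt/wexp_gt0.
  by move=> u xu us; apply: IH xu _ => //; have -> : oadd (iter n (oadd^~ (wexp b)) x) (wexp b) = s by rewrite -sE.
- by move=> /(lt_oadd_wexp_limit lg)[b bg sb]; apply: (lt_trans _ bg); exact: (IH _ bg _ _ xs sb).
Qed.

End ordinals.

(** * Cofinality of the associated sequences *)

Section associated.
Local Open Scope order_scope.
Variables (s : omega1 -> nat -> omega1) (hs : associated_sequences s).

(** The ray above [b] is a neighbourhood of [a], and [b < osucc c] amounts to [b <= c]. *)
Lemma assoc_cofinal a b : is_limit a -> b < a ->
  exists n0, forall n, (n0 <= n)%N -> b <= s a n.
Proof.
move=> la ba; have [_ cv] := hs.2 _ la.
have : nbhs (a : order_topology omega1) (`]b, +oo[%classic : set omega1).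
  rewrite itv_nbhsE /=; exists `]b, +oo[%O => //.
  by split => //; rewrite in_itv /= andbT.
move=> /cv[n0 _ h]; exists n0 => n /h /=.
by rewrite in_itv /= andbT ltosucc.
Qed.

(** If a term exceeded [a], convergence would put late terms below it, against strict growth. *)
Lemma assoc_lt a n : is_limit a -> (0 < n)%N -> s a n < a.
Proof.
move=> la n0; have [inc cv] := hs.2 _ la.
rewrite -osucc_le leNgt; apply/negP => h.
have : nbhs (a : order_topology omega1) (`]-oo, osucc (s a n)[%classic : set omega1).
  rewrite itv_nbhsE /=; by exists `]-oo, osucc (s a n)[%O.
move=> /cv[m0 _ /(_ (maxn m0 n.+1) (leq_maxl _ _))] /=.
rewrite in_itv /= => h2; have := inc n (maxn m0 n.+1).
by rewrite n0 leq_maxr => /(_ isT); rewrite ltNge (ltW h2).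
Qed.

End associated.

(** * Compactness, and closed sets classified by their ranks *)

Section rank_classes.
Local Open Scope order_scope.
Variable kap : omega1.
Implicit Types (F : set omega1) (t s p a g : omega1).

(** Closedness relative to []0, kap]]: the intervals []a, t]] form a base of neighbourhoods of [t],
    being equal to []a, t+1[]. *)
Definition oclosed F := forall t, ozero < t -> t <= kap -> ~ F t ->
  exists2 a : omega1, a < t & forall s, a < s -> s <= t -> ~ F s.

Definition points F := forall t, F t -> ozero < t /\ t <= kap.

(** Compactness of []0, kap]]: the point [k] takes care of []nb k, k]], and the process goes on with
    [nb k < k]; it stops by well-foundedness. *)
Lemma interval_cover (nb : omega1 -> omega1) :
  (forall t, ozero < t -> t <= kap -> nb t < t) ->
  exists P : seq omega1, (forall p, p \in P -> ozero < p /\ p <= kap) /\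
    forall t, ozero < t -> t <= kap -> exists2 p, p \in P & nb p < t /\ t <= p.
Proof.
move=> nbP; suff h : forall k : omega1, k <= kap ->
    exists P : seq omega1, (forall p, p \in P -> ozero < p /\ p <= kap) /\
    forall t, ozero < t -> t <= k -> exists2 p, p \in P & nb p < t /\ t <= p.
  exact: h.
elim/omega1_ind => k IH kk.
have [->|k0] := eqVneq k ozero.
  by exists [::]; split => // t t0; rewrite leNgt t0.
have {}k0 : ozero < k by rewrite lt_neqAle eq_sym k0 ozero_le.
have nk := nbP _ k0 kk.
have [P [P1 P2]] := IH _ nk (ltW (lt_le_trans nk kk)).
exists (k :: P); split => [p|t t0 tk].
  by rewrite inE => /predU1P[->//|/P1].
have [tn|nt] := leP t (nb k).
  by have [p pP pt] := P2 _ t0 tn; exists p => //; rewrite inE pP orbT.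
by exists k; rewrite ?inE ?eqxx.
Qed.

Lemma closed_cover F (nb : omega1 -> omega1) : oclosed F -> points F ->
  (forall t, F t -> nb t < t) ->
  exists P : seq omega1, (forall p, p \in P -> F p) /\
    forall t, F t -> exists2 p, p \in P & nb p < t /\ t <= p.
Proof.
move=> cF pF nbF.
have /choice[f fP] t : exists a : omega1, ozero < t -> t <= kap ->
    a < t /\ if pselect (F t) is left _ then a = nb t else
    forall s, a < s -> s <= t -> ~ F s.
  have [[t0 tk]|n] := pselect (ozero < t /\ t <= kap); last first.
    by exists t => t0 tk; exfalso; apply: n.
  case: (pselect (F t)) => [Ft|nFt]; first by exists (nb t) => _ _; split=> //; exact: nbF.
  by have [a at' h] := cF _ t0 tk nFt; exists a.
have [P [P1 P2]] : exists P : seq omega1, (forall p, p \in P -> ozero < p /\ p <= kap) /\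
    forall t, ozero < t -> t <= kap -> exists2 p, p \in P & f p < t /\ t <= p.
  by apply: interval_cover => t t0 tk; have [] := fP t t0 tk.
exists [seq p <- P | `[< F p >]]; split => [p|t Ft].
  by rewrite mem_filter => /andP[/asboolP].
have [t0 tk] := pF _ Ft.
have [p pP [ft tp]] := P2 _ t0 tk; have [p0 pk] := P1 _ pP.
have [_] := fP p p0 pk; case: pselect => [Fp fE|nFp /(_ t ft tp)//].
by exists p; rewrite -?fE// mem_filter pP andbT; apply/asboolP.
Qed.

Lemma rk_nbhs : exists nb : omega1 -> omega1, forall t, ozero < t ->
  nb t < t /\ forall s, nb t < s -> s < t -> rk s < rk t.
Proof.
have /choice[nb nbP] t : exists a : omega1, ozero < t ->
    a < t /\ forall s, a < s -> s < t -> rk s < rk t.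
  have [t0|_] := ltP ozero t; last by exists t.
  by have [[a at' h] _] := rkP t0; exists a.
by exists nb.
Qed.

(** Every point has a neighbourhood in which its rank is the largest; in a finite cover by such
    neighbourhoods, a centre of maximal rank will do. *)
Lemma closed_rk_max F : oclosed F -> points F -> F !=set0 ->
  exists2 t, F t & forall s, F s -> rk s <= rk t.
Proof.
move=> cF pF [x Fx]; have [nb nbP] := rk_nbhs.
have [|P [PF FP]] := @closed_cover F nb cF pF; first by move=> t /pF[/nbP[]].
have hmax (Q : seq omega1) : Q != [::] ->
    exists2 q, q \in Q & forall p, p \in Q -> rk p <= rk q.
  elim: Q => // q Q IH _; have [->|/IH[r rQ rmax]] := eqVneq Q [::].
    by exists q; rewrite ?inE// => p; rewrite inE => /eqP->.
  have [qr|rq] := leP (rk q) (rk r).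
    exists r; first by rewrite inE rQ orbT.
    by move=> p; rewrite inE => /predU1P[->|/rmax].
  exists q; first by rewrite inE eqxx.
  by move=> p; rewrite inE => /predU1P[->//|/rmax/le_trans]; apply; exact: ltW.
have [|q qP qmax] := hmax P.
  by have [p pP _] := FP _ Fx; apply/eqP => P0; rewrite P0 in pP.
exists q; first exact: PF.
move=> s /FP[p pP [ps sp]]; apply: le_trans (qmax _ pP).
move: sp; rewrite le_eqVlt => /predU1P[->//|sp].
by apply: ltW; have [p0 _] := pF _ (PF _ pP); exact: (nbP _ p0).2.
Qed.

(* The closed sets whose ranks lie in an interval of length [w^g]; these play
   the role of the closed sets of Cantor-Bendixson index below [w^g]. *)
Definition rank_class g F := [/\ oclosed F, points F &
  exists th, forall t, F t -> th <= rk t /\ rk t < oadd th (wexp g)].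

Lemma rank_class_le g g' F : g <= g' -> rank_class g F -> rank_class g' F.
Proof.
move=> gg [cF pF [th h]]; split => //; exists th => t /h[? h2]; split=> //.
exact: lt_le_trans h2 (oadd_homo _ (wexp_homo gg)).
Qed.

(** The largest rank is attained, so it already lies below [th + w^g] for some [g < l]. *)
Lemma rank_class_limit l F : is_limit l -> rank_class l F ->
  exists2 g : omega1, g < l & rank_class g F.
Proof.
move=> ll [cF pF [th h]]; have [F0|/set0P F0] := eqVneq F set0.
  exists ozero; first exact: is_limit_gt0.
  by split=> //; exists ozero => t; rewrite F0.
have [t Ft tmax] := closed_rk_max cF pF F0.
have [_ /(lt_oadd_wexp_limit ll)[g gl tg]] := h _ Ft.
exists g => //; split=> //; exists th => s Fs; split; first exact: (h _ Fs).1.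
exact: le_lt_trans (tmax _ Fs) tg.
Qed.

Lemma rank_class_succ g F : rank_class (osucc g) F ->
  exists th m, forall t, F t ->
    th <= rk t /\ rk t < iter m (oadd^~ (wexp g)) th.
Proof.
move=> [cF pF [th h]]; have [F0|/set0P F0] := eqVneq F set0.
  by exists ozero, 0%N => t; rewrite F0.
have [t Ft tmax] := closed_rk_max cF pF F0.
have [_ /lt_oadd_wexpS[m tm]] := h _ Ft.
exists th, m => s Fs; split; first exact: (h _ Fs).1.
exact: le_lt_trans (tmax _ Fs) tm.
Qed.

Lemma rk_usc t th : ozero < t -> rk t < th ->
  exists2 a : omega1, a < t & forall s, a < s -> s <= t -> rk s < th.
Proof.
move=> t0 tth; have [[a at' h] _] := rkP t0; exists a => // s sa.
rewrite le_eqVlt => /predU1P[->//|st]; exact: lt_trans (h _ sa st) tth.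
Qed.

Lemma oclosedI F F' : oclosed F -> oclosed F' -> oclosed (F `&` F').
Proof.
move=> cF cF' t t0 tk nF.
have [Ft|nFt] := pselect (F t).
  have [|a at' h] := cF' t t0 tk; first by move=> F't; apply: nF.
  by exists a => // s sa st [_]; exact: h.
by have [a at' h] := cF t t0 tk nFt; exists a => // s sa st [Fs _]; exact: h Fs.
Qed.

Lemma oclosed_rk_ge th : oclosed [set t | th <= rk t].
Proof.
move=> t t0 tk /= /negP; rewrite -ltNge => tth.
have [a at' h] := rk_usc t0 tth; exists a => // s sa st /=.
by apply/negP; rewrite -ltNge; exact: h.
Qed.

Lemma oclosed_itv a b : oclosed [set t | a < t /\ t <= b].
Proof.
move=> t t0 tk /= nt; have [tb|bt] := leP t b.
  exists ozero => // s s0 st [sa _]; apply: nt; split => //.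
  exact: lt_le_trans sa st.
by exists b => // s sb _ [_]; rewrite leNgt sb.
Qed.

(** An interval of length [w^0 = 1] contains one rank only, and each point is the only one of its
    rank in a suitable neighbourhood; the centres of a finite cover are then all the points of
    [F]. *)
Lemma rank_class0 F : rank_class ozero F ->
  exists P : seq omega1, forall t, F t -> t \in P.
Proof.
move=> [cF pF [th h]]; have [nb nbP] := rk_nbhs.
have [|P [PF FP]] := @closed_cover F nb cF pF; first by move=> t /pF[/nbP[]].
exists P => t Ft; have [p pP [pt]] := FP _ Ft.
rewrite le_eqVlt => /predU1P[->//|tp].
have [p0 _] := pF _ (PF _ pP).
have := (nbP _ p0).2 _ pt tp; rewrite ltNge => /negP; case.
have [ht _] := h _ Ft; apply: le_trans ht.
have [_] := h _ (PF _ pP).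
by rewrite /wexp oexp0 /oone oaddrS oaddr0 ltosucc.
Qed.

(** This countable family allows one sequence of averages to be eventually small on every set of
    class [g]. Its members consist of the points of rank at least [th] in a neighbourhood of [p]
    where no rank exceeds [rk p], with [rk p < th + w^g]; compactness reduces each set of class [g]
    to finitely many of them. *)
Lemma rank_class_family g : exists C : nat -> set omega1,
  (forall k, rank_class g (C k)) /\
  forall F, rank_class g F -> exists n, forall t, F t -> exists2 k, (k < n)%N & C k t.
Proof.
have [nb nbP] := rk_nbhs.
(* A common bound for the points and for their ranks, so that a single enumeration [e] serves for
   [p] and for [th]. *)
pose B : omega1 := Order.max kap (osup [set rk t | t in [set t | t <= kap]]).
have [e eP] : exists e : nat -> omega1, forall b, b <= B -> exists n, e n = b.
  have /countable_injP[f fi] := countable_below B.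
  exists (fun n => xget B [set b | b <= B /\ f b = n]) => b bB; exists (f b).
  case: xgetP => [y -> [yB fyb]|/(_ b)]; last by case; split.
  by apply: fi => //; rewrite inE.
(* The last factor is a condition on [p] and [th] alone; it empties [D p th] for unsuitable
   pairs. *)
pose D p th := [set t | ozero < t /\ t <= kap] `&` [set t | th <= rk t] `&`
  [set t | nb p < t /\ t <= p] `&` [set t | rk p < oadd th (wexp g) /\ ozero < p].
pose C k := if unpickle k is Some ij then D (e ij.1) (e ij.2 : omega1) else set0.
have D_class p th : rank_class g (D p th).
  split; last first.
  - exists th => t [[[_ /= tht] [pt tp]] [pth p0]]; split => //.
    move: tp; rewrite le_eqVlt => /predU1P[->//|tp].
    by apply: lt_trans pth; exact: (nbP _ p0).2.
  - by move=> t [[[h _] _] _]; exact: h.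
  - apply: oclosedI; last first.
      move=> t t0 tk /= n; exists ozero => // s _ _; exact: n.
    apply: oclosedI; last exact: oclosed_itv.
    apply: oclosedI; [exact: oclosed_itv|exact: oclosed_rk_ge].
exists C; split => [k|F [cF pF [th h]]].
  rewrite /C; case: unpickle => [ij|]; first exact: D_class.
  split; last by exists ozero => t [].
    by move=> t t0 tk _; exists ozero => // s _ _ [].
  by move=> t [].
have [F0|/set0P[x Fx]] := eqVneq F set0; first by exists 0%N => t; rewrite F0.
have [|P [PF FP]] := @closed_cover F nb cF pF; first by move=> t /pF[/nbP[]].
have rB t : t <= kap -> rk t <= B.
  move=> tk; rewrite /B le_max; apply/orP; right; apply: osup_ub; last by exists t.
  exact: (sub_countable (card_image_le _ _) (countable_below kap)).
have [j ej] : exists j, e j = th.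
  by apply: eP; have [h1 _] := h _ Fx; apply: le_trans h1 _; apply: rB; have [] := pF _ Fx.
have /choice[i iP] p : exists i, p \in P -> e i = p.
  have [/PF/pF[_ pk]|] := boolP (p \in P); last by exists 0%N.
  by have [|i <-] := eP p; [rewrite /B le_max pk|exists i].
exists (\max_(p <- P) (pickle (i p, j))).+1 => t Ft.
have [p pP tp] := FP _ Ft; exists (pickle (i p, j)).
  by rewrite ltnS; apply: (@leq_bigmax_seq _ P xpredT (fun p => pickle (i p, j))).
rewrite /C pickleK /= iP// ej; have [t0 tk] := pF _ Ft.
have Fp := PF _ pP; have [p0 _] := pF _ Fp.
have [tht _] := h _ Ft; have [_ pth] := h _ Fp.
by split; [split; [split|]|].
Qed.

End rank_classes.

(** * Subsequences and an infinite Ramsey theorem *)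

Section subsequences.
Local Open Scope nat_scope.
Implicit Types (x y M N : nat -> nat).

Definition incr x := forall i, x i < x i.+1.

Definition subseqn x N := incr x /\ forall i, exists k, x i = N k.

Definition tail n x : nat -> nat := fun i => x (n + i).

Lemma incr_lt x i j : incr x -> i < j -> x i < x j.
Proof. by move=> ix; apply: (homo_ltn ltn_trans ix). Qed.

Lemma incr_le x i j : incr x -> i <= j -> x i <= x j.
Proof. by move=> ix; rewrite leq_eqVlt => /predU1P[->//|/(incr_lt ix)/ltnW]. Qed.

Lemma incr_ltE x i j : incr x -> (x i < x j) = (i < j).
Proof.
move=> ix; apply/idP/idP; last exact: incr_lt.
by apply: contraTT; rewrite -!leqNgt; exact: incr_le.
Qed.

Lemma incr_ge x i : incr x -> i <= x i.
Proof. by move=> ix; elim: i => // i IH; exact: leq_ltn_trans IH (ix i). Qed.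

Lemma incr_tail n x : incr x -> incr (tail n x).
Proof. by move=> ix i; rewrite /tail addnS. Qed.

Lemma tail_tail m n x : tail m (tail n x) = tail (n + m) x.
Proof. by apply/funext => i; rewrite /tail addnA. Qed.

Lemma tail0 x : tail 0 x = x.
Proof. by []. Qed.

Lemma subseqn_refl N : incr N -> subseqn N N.
Proof. by split => // i; exists i. Qed.

Lemma subseqn_trans y x z : subseqn x y -> subseqn y z -> subseqn x z.
Proof. by move=> [ix xy] [_ yz]; split => // i; have [k ->] := xy i. Qed.

Lemma subseqn_tail n x N : subseqn x N -> subseqn (tail n x) N.
Proof. by move=> [ix xN]; split => [|i]; [exact: incr_tail|exact: xN]. Qed.

Lemma subseqn_taill n x N : subseqn x (tail n N) -> subseqn x N.
Proof. by move=> [ix xN]; split => // i; have [k ->] := xN i; exists (n + k). Qed.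

Lemma subseqn_after k x N : incr N -> subseqn x N -> N k < x 0 ->
  subseqn x (tail k.+1 N).
Proof.
move=> iN [ix xN] kx; split => // i; have [j xj] := xN i.
have kj : k < j by rewrite -(incr_ltE _ _ iN) -xj (leq_trans kx)// incr_le.
by exists (j - k.+1); rewrite /tail subnKC.
Qed.

Lemma infinite_enum (P : nat -> Prop) : (forall n, exists2 m, n <= m & P m) ->
  exists2 g, incr g & forall k, P (g k).
Proof.
move=> h.
have /choice[f fP] n : exists m, n <= m /\ P m by have [m ? ?] := h n; exists m.
pose g := fix g k := if k is k'.+1 then f (g k').+1 else f 0.
have fP2 n : P (f n) by have [] := fP n.
exists g; first by move=> i; have [] := fP (g i).+1.
by case=> [|k]; exact: fP2.
Qed.

(** Diagonalization: [T k.+1] is chosen inside the tail of [T k] so as to satisfy [Q] for the head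
    of [T k]. The heads form [M], and [Q] is inherited by subsequences. *)
Lemma fusion (Q : nat -> (nat -> nat) -> Prop) N : incr N ->
  (forall i M M', Q i M -> subseqn M' M -> Q i M') ->
  (forall i M, subseqn M N -> exists2 M', subseqn M' M & Q i M') ->
  exists2 M, subseqn M N & forall j, Q (M j) (tail j.+1 M).
Proof.
move=> iN hQ dQ.
have /choice[f fP] (iM : nat * (nat -> nat)) : exists M, subseqn iM.2 N ->
    subseqn M iM.2 /\ Q iM.1 M.
  have [iM2|n] := pselect (subseqn iM.2 N); last by exists N.
  by have [M ? ?] := dQ iM.1 _ iM2; exists M.
pose T := fix T k := if k is k'.+1 then f (T k' 0, tail 1 (T k')) else N.
have TN k : subseqn (T k) N.
  elim: k => [|k IH] /=; first exact: subseqn_refl.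
  have T1 := subseqn_tail 1 IH; have [h _] := fP (T k 0, tail 1 (T k)) T1.
  exact: subseqn_trans h T1.
have iT k : incr (T k) := (TN k).1.
have TP k : subseqn (T k.+1) (tail 1 (T k)) /\ Q (T k 0) (T k.+1).
  exact: (fP (T k 0, tail 1 (T k)) (subseqn_tail 1 (TN k))).
have TD k j : subseqn (T (k + j)) (T k).
  elim: j => [|j IH]; first by rewrite addn0; exact: subseqn_refl.
  by rewrite addnS; apply: subseqn_trans IH; exact: subseqn_taill (TP _).1.
have iM : incr (fun k => T k 0).
  move=> k; have [[_ /(_ 0)[i ->]] _] := TP k.
  by rewrite /tail incr_ltE.
exists (fun k => T k 0).
  by split => // k; have [_ /(_ 0)] := TD 0 k.
move=> j; apply: (hQ _ _ _ (TP j).2); split; first exact: (incr_tail j.+1 iM).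
by move=> i; have [_ /(_ 0)] := TD j.+1 i.
Qed.

Definition scat (s : seq nat) x : nat -> nat :=
  fun i => if i < size s then nth 0 s i else x (i - size s).

Lemma scat_rcons s x : scat s x = scat (rcons s (x 0)) (tail 1 x).
Proof.
apply/funext => i; rewrite /scat size_rcons nth_rcons ltnS.
case: ltngtP => [//|si|->]; last by rewrite subnn.
by rewrite /tail; congr x; lia.
Qed.

Lemma scat0 x : scat [::] x = x.
Proof. by apply/funext => i; rewrite /scat /= subn0. Qed.

End subsequences.

Section ramsey.
Variable R : realType.

Lemma bounded_subsequence (B : R) (r : nat -> R) (e : R) : 0 < e ->
  (forall n, 0 <= r n <= B) ->
  exists2 l, 0 <= l <= B & exists2 g, incr g & forall k, `|r (g k) - l| <= e.
Proof.
move=> e0 rB.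
have [] := @segment_compact R 0 B (r @ \oo).
  by exists 0%N => // n _ /=; rewrite in_itv /= rB.
move=> l [/= ]; rewrite in_itv /= => lB cl; exists l => //.
have [|g ig gP] := @infinite_enum (fun m => `|r m - l| <= e); last by exists g.
move=> n; have [||y [[m nm <-] /=]] := cl [set r m | m in [set m | (n <= m)%N]] (ball l e).
- by exists n => // m /= nm; exists m.
- exact: nbhsx_ballx.
- by rewrite /ball /= distrC => /ltW ml; exists m.
Qed.

(** Local constancy on the Baire space. It is asked at all sequences, increasing or not, because the
    branch followed in the bar induction is arbitrary. *)
Definition finite_dep (T : Type) (phi : (nat -> nat) -> T) := forall x, exists n, forall y,
  (forall i, (i < n)%N -> y i = x i) -> phi y = phi x.

(* Bar induction: a sequence [s] such that [phi] is nearly constant on a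
   subsequence, when restricted to the extensions of [s], is found below every
   branch because [phi] is determined by finite initial segments. *)
Lemma ramsey (B : R) (phi : (nat -> nat) -> R) :
  (forall x, 0 <= phi x <= B) -> finite_dep phi ->
  forall N, incr N -> forall e, 0 < e -> exists2 M, subseqn M N &
  exists2 l, 0 <= l <= B & forall x, subseqn x M -> `|phi x - l| <= e.
Proof.
move=> phiB fphi.
pose good s := forall N, incr N -> forall e, 0 < e -> exists2 M, subseqn M N &
  exists2 l, 0 <= l <= B & forall x, subseqn x M -> `|phi (scat s x) - l| <= e.
suff : good [::].
  move=> h N iN e e0; have [M MN [l lB Ml]] := h N iN e e0.
  by exists M => //; exists l => // x /Ml; rewrite scat0.
(* Fusion makes [phi] nearly constant once the first term [M j] is known, and the constants [r j]
   nearly agree along a subsequence [g]; each approximation takes half of [e]. *)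
have step s : (forall n, good (rcons s n)) -> good s.
  move=> gs N iN e e0; have e2 : 0 < e / 2 by lra.
  have [||M MN MP] := @fusion (fun i M => exists2 l, 0 <= l <= B & forall x,
    subseqn x M -> `|phi (scat (rcons s i) x) - l| <= e / 2) N iN.
  - move=> i M M' [l lB lP] M'M; exists l => // x xM'.
    by apply: lP; exact: subseqn_trans M'M.
  - by move=> i M' M'N; apply: gs => //; exact: M'N.1.
  have /choice[r rP] j : exists l, 0 <= l <= B /\ forall x,
      subseqn x (tail j.+1 M) -> `|phi (scat (rcons s (M j)) x) - l| <= e / 2.
    by have [l ? ?] := MP j; exists l.
  have [|l lB [g ig gl]] := @bounded_subsequence B r (e / 2) e2.
    by move=> n; have [] := rP n.
  have iM := MN.1.
  exists (fun k => M (g k)).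
    by split => [i|i]; [rewrite incr_ltE|exact: MN.2].
  exists l => // x [ix xM]; rewrite scat_rcons; have [k xk] := xM 0%N.
  have xM2 : subseqn (tail 1 x) (tail (g k).+1 M).
    apply: subseqn_after => //; last by rewrite -xk; exact: ix.
    split; first exact: incr_tail.
    by move=> i; have [j xj] := xM (1 + i)%N; exists (g j); rewrite -xj.
  have h1 := (rP (g k)).2 _ xM2; have h2 := gl k; rewrite -xk in h1.
  have -> : phi (scat (rcons s (x 0%N)) (tail 1 x)) - l =
    (phi (scat (rcons s (x 0%N)) (tail 1 x)) - r (g k)) + (r (g k) - l) by ring.
  by apply: le_trans (ler_normD _ _) _; rewrite [e]splitr lerD.
apply: contrapT => n0.
have /choice[f fP] s : exists n, ~ good s -> ~ good (rcons s n).
  have [gs|ngs] := pselect (good s); first by exists 0%N.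
  apply: contrapT => h; apply: ngs; apply: step => n; apply: contrapT => h'.
  by apply: h; exists n.
(* A branch of sequences that are not good; since [phi] is constant on all extensions of some [S n],
   that one is good after all. *)
pose S := fix S k := if k is k'.+1 then rcons (S k') (f (S k')) else [::].
have sS k : size (S k) = k by elim: k => //= k IH; rewrite size_rcons IH.
have nS k : ~ good (S k) by elim: k => //= k IH; exact: fP.
pose x k := f (S k).
have Sx n : S n = mkseq x n.
  by elim: n => //= n IH; rewrite mkseqS -IH.
have [n xn] := fphi x; apply: (nS n) => N iN e e0.
exists N; first exact: subseqn_refl.
exists (phi x); first exact: phiB.
move=> y _; rewrite xn ?subrr ?normr0; first exact: ltW.
by move=> i ni; rewrite /scat sS ni Sx nth_mkseq.
Qed.

End ramsey.

(** * Averages as polynomials *)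

(* The vector [\sum_n p_n f_n] is encoded by the polynomial [p], so that ['X^n]
   stands for [f_n]; [G] is the index set of a basic subsequence. *)
Record block_norm (R : realType) (G : nat -> Prop) (nrm : {poly R} -> R) := BlockNorm {
  good_gt1 : forall n, G n -> (1 < n)%N;
  nrmZ : forall c (p : {poly R}), nrm (c *: p) = `|c| * nrm p;
  nrmD : forall p q : {poly R}, nrm (p + q) <= nrm p + nrm q;
  nrmX : forall n, G n -> nrm 'X^n = 1;
  nrm_proj : forall n (p : {poly R}), (forall i, p`_i != 0 -> G i) ->
    nrm (take_poly n p) <= 2 * nrm p }.

Arguments nrm_proj {R G nrm} _ n [p].

Section averages.
Variables (R : realType) (s : omega1 -> nat -> omega1).
Variables (G : nat -> Prop) (nrm : {poly R} -> R).
Implicit Types p u v w : {poly R}.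

Definition inb (a b : nat) (p : {poly R}) :=
  forall i, p`_i != 0 -> [/\ (a <= i)%N, (i < b)%N & G i].

(* [Avg g m q p]: [p] is a [g]-average with support in [G], the least and
   largest elements of its support being [m] and [q]. *)
Inductive Avg : omega1 -> nat -> nat -> {poly R} -> Prop :=
| Avg_zero n : G n -> Avg ozero n n 'X^n
| Avg_succ b k (m q : nat -> nat) (p : nat -> {poly R}) :
    (forall i, (i < k.+1)%N -> Avg b (m i) (q i) (p i)) ->
    (forall i, (i < k)%N -> (q i < m i.+1)%N) -> m 0%N = k.+1 ->
    Avg (osucc b) (m 0%N) (q k)
      ((nrm (\sum_(i < k.+1) p i))^-1 *: \sum_(i < k.+1) p i)
| Avg_limit a l m q p : is_limit a -> G l -> (l < m)%N -> Avg (s a l) m q p ->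
    Avg a l q ((nrm (l%:R^-1 *: 'X^l + p))^-1 *: (l%:R^-1 *: 'X^l + p)).

Definition blk m q (p : {poly R}) :=
  [/\ inb m q.+1 p, (forall i, 0 <= p`_i), p`_m != 0, p`_q != 0 & nrm p = 1].

Hypothesis HN : block_norm G nrm.

Lemma nrm0 : nrm 0 = 0.
Proof. by rewrite -(scale0r 0) (nrmZ HN) normr0 mul0r. Qed.

Lemma nrmN p : nrm (- p) = nrm p.
Proof. by rewrite -scaleN1r (nrmZ HN) normrN1 mul1r. Qed.

Lemma nrm_ge0 p : 0 <= nrm p.
Proof. by have := (nrmD HN) p (- p); rewrite subrr nrm0 nrmN; lra. Qed.

Lemma inbW a b a' b' p : (a' <= a)%N -> (b <= b')%N -> inb a b p -> inb a' b' p.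
Proof.
move=> aa bb h i /h[ai ib Gi]; split => //; first exact: leq_trans ai.
exact: leq_trans bb.
Qed.

Lemma inbD a b p q : inb a b p -> inb a b q -> inb a b (p + q).
Proof.
move=> hp hq i; rewrite coefD; have [p0|pn0 _] := eqVneq p`_i 0; last exact: hp.
by rewrite p0 add0r => /hq.
Qed.

Lemma inbZ a b c p : inb a b p -> inb a b (c *: p).
Proof. by move=> hp i; rewrite coefZ mulf_eq0 negb_or => /andP[_ /hp]. Qed.

Lemma inb0 a b : inb a b 0.
Proof. by move=> i; rewrite coef0 eqxx. Qed.

Lemma inbX n : G n -> inb n n.+1 'X^n.
Proof.
move=> Gn i; rewrite coefXn; case: (eqVneq i n) => [->|_]; last by rewrite eqxx.
by move=> _; split.
Qed.

Lemma inb_take a b n p : inb a b p -> (b <= n)%N -> take_poly n p = p.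
Proof.
move=> hp bn; apply/polyP => i; rewrite coef_take_poly; case: ltnP => // ni.
have [->//|/hp[_ ib _]] := eqVneq p`_i 0.
by have := leq_trans ib (leq_trans bn ni); rewrite ltnn.
Qed.

Lemma inb_take0 a b n p : inb a b p -> (n <= a)%N -> take_poly n p = 0.
Proof.
move=> hp na; apply/polyP => i; rewrite coef_take_poly coef0; case: ltnP => // ni.
have [->//|/hp[ai _ _]] := eqVneq p`_i 0.
by have := leq_trans ni (leq_trans na ai); rewrite ltnn.
Qed.

(** The middle part is the difference of the projections on the indices below [c] and below [b],
    each of norm at most 2. *)
Lemma nrm_mid a b c e u v w : inb a b u -> inb b c v -> inb c e w ->
  nrm v <= 4 * nrm (u + v + w).
Proof.
move=> hu hv hw.
have bcE p : inb b c p -> (c < b)%N -> p = 0.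
  move=> hp cb; apply/polyP => i; rewrite coef0; have [//|/hp[bi ic _]] := eqVneq p`_i 0.
  by have := leq_ltn_trans bi (ltn_trans ic cb); rewrite ltnn.
have [cb|bc] := ltnP c b; first by rewrite (bcE v) ?nrm0 ?mulr_ge0 ?nrm_ge0.
have hG : forall i, (u + v + w)`_i != 0 -> G i.
  move=> i; rewrite !coefD => h.
  have [u0|/hu[]//] := eqVneq u`_i 0; have [v0|/hv[]//] := eqVneq v`_i 0.
  by rewrite u0 v0 !add0r in h; have [] := hw i h.
have h1 := nrm_proj HN b hG; have h2 := nrm_proj HN c hG.
move: h1 h2; rewrite !take_polyD (inb_take hu (leqnn _)) (inb_take hu bc).
rewrite (inb_take hv (leqnn _)) (inb_take0 hv (leqnn _)) (inb_take0 hw bc).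
rewrite (inb_take0 hw (leqnn _)) !addr0 => h1 h2.
have := (nrmD HN) (u + v) (- u); rewrite nrmN addrAC subrr add0r; lra.
Qed.

Lemma blk_le m q p : blk m q p -> (m <= q)%N.
Proof. by move=> [h _ /h[_]]. Qed.

Lemma inb_sum k (m q : nat -> nat) (p : nat -> {poly R}) :
  (forall i, (i < k.+1)%N -> blk (m i) (q i) (p i)) ->
  (forall i, (i < k)%N -> (q i < m i.+1)%N) ->
  (forall i, (i < k.+1)%N -> (m 0 <= m i)%N /\ (q i <= q k)%N) /\
  inb (m 0%N) (q k).+1 (\sum_(i < k.+1) p i).
Proof.
elim: k => [|k IH] hp hq.
  by rewrite big_ord1; split; [case|have [] := hp 0%N isT].
have [|i ik|h1 h2] := IH; [by move=> i ik; apply: hp; exact: ltnW|exact/hq/ltnW|].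
have bk := hp k.+1 (ltnSn _); have mk := blk_le bk; have qk := hq k (ltnSn _).
have mk0 : (m 0 <= m k.+1)%N.
  have [mk' _] := h1 k (ltnSn _); have := blk_le (hp k (ltnW (ltnSn _))).
  by move: mk' qk mk; lia.
split.
  move=> i; rewrite ltnS leq_eqVlt => /predU1P[->//|ik].
  by have [? ?] := h1 i ik; split => //; lia.
rewrite big_ord_recr /=; apply: inbD.
  by apply: inbW h2 => //; lia.
by have [h _ _ _ _] := bk; apply: inbW h.
Qed.

(** The first block, of norm one, is an interval projection of the sum. Hence normalizing multiplies
    by at most 4. *)
Lemma nrm_sum_ge k (m q : nat -> nat) (p : nat -> {poly R}) :
  (forall i, (i < k.+1)%N -> blk (m i) (q i) (p i)) ->
  (forall i, (i < k)%N -> (q i < m i.+1)%N) ->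
  1 <= 4 * nrm (\sum_(i < k.+1) p i).
Proof.
move=> hp hq; rewrite big_ord_recl -[X in nrm (X + _)]add0r.
have [h _ _ _ h1'] := hp 0%N isT; rewrite -[X in X <= _]h1'.
case: k hp hq => [|k] hp hq.
  by rewrite big_ord0; apply: nrm_mid h (@inb0 _ (q 0%N).+1); exact: (@inb0 0%N).
have [||_ h3] := @inb_sum k (m \o S) (q \o S) (p \o S).
+ by move=> i ik; exact: hp.
+ by move=> i ik; exact: hq.
apply: (nrm_mid (@inb0 0%N _) h (inbW _ (leqnn _) h3)).
exact: hq.
Qed.

Lemma nrm_limit_ge l m q p : G l -> (l < m)%N -> blk m q p ->
  1 <= 4 * nrm (l%:R^-1 *: 'X^l + p).
Proof.
move=> Gl lm [h _ _ _ h1]; rewrite -[X in X <= _]h1.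
have hX : inb l l.+1 (l%:R^-1 *: 'X^l) by apply: inbZ; exact: inbX.
by have := nrm_mid (inbW (leqnn _) lm hX) h (@inb0 _ 0%N); rewrite addr0.
Qed.

(** Nonnegativity of the coefficients is carried through the induction to exclude cancellation: it
    keeps the extreme coefficients of a sum nonzero. *)
Lemma Avg_blk g m q p : Avg g m q p -> blk m q p.
Proof.
elim=> {g m q p} [n Gn|b k m q p _ IH hq mk|a l m q p la Gl lm _ IH].
- split; [exact: inbX| |by rewrite coefXn eqxx oner_eq0|by rewrite coefXn eqxx oner_eq0|exact: (nrmX HN)].
  by move=> i; rewrite coefXn ler0n.
- have [h1 h2] := inb_sum IH hq; set P := \sum_(i < k.+1) p i in h2 *.
  have P0 : 1 <= 4 * nrm P by exact: nrm_sum_ge IH hq.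
  have P1 : 0 < nrm P by lra.
  have cP i : P`_i = \sum_(j < k.+1) (p j)`_i by rewrite /P coef_sum.
  have ge i j : (j < k.+1)%N -> (p j)`_i <= P`_i.
    move=> jk; rewrite cP (bigD1 (Ordinal jk)) //= lerDl sumr_ge0// => j' _.
    by have [_ ->] := IH j' (ltn_ord j').
  have nz i j : (j < k.+1)%N -> (p j)`_i != 0 -> ((nrm P)^-1 *: P)`_i != 0.
    move=> jk pj; rewrite coefZ mulf_neq0 ?invr_neq0 ?gt_eqF//.
    apply: lt_le_trans (ge i j jk); rewrite lt_neqAle eq_sym pj.
    by have [_ ->] := IH j jk.
  split.
  + exact: inbZ.
  + move=> i; rewrite coefZ mulr_ge0// ?invr_ge0 ?(ltW P1)// cP sumr_ge0// => j _.
    by have [_ ->] := IH j (ltn_ord j).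
  + by apply: (nz _ 0%N) => //; have [] := IH 0%N isT.
  + by apply: (nz _ k) => //; have [] := IH k (ltnSn _).
  + by rewrite (nrmZ HN) gtr0_norm ?invr_gt0// mulVf// gt_eqF.
- have [h h0 hm hq h1] := IH; set P := _ + p.
  have l1 : (1 < l)%N := good_gt1 HN Gl.
  have l0 : 0 < l%:R^-1 :> R by rewrite invr_gt0 ltr0n; lia.
  have mq := blk_le IH.
  have hX : inb l l.+1 (l%:R^-1 *: 'X^l) by apply: inbZ; exact: inbX.
  have P0 : 1 <= 4 * nrm P by exact: nrm_limit_ge Gl lm IH.
  have P1 : 0 < nrm P by lra.
  have ge0 i : 0 <= P`_i.
    by rewrite coefD coefZ coefXn addr_ge0// mulr_ge0// ?ltW// ler0n.
  split.
  + apply: inbZ; apply: inbD; last by apply: inbW h => //; exact: ltnW.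
    by apply: inbW hX => //; lia.
  + by move=> i; rewrite coefZ mulr_ge0// ?invr_ge0 ?(ltW P1).
  + rewrite coefZ mulf_neq0 ?invr_neq0 ?gt_eqF// coefD coefZ coefXn eqxx mulr1.
    by rewrite ltr_wpDr.
  + rewrite coefZ mulf_neq0 ?invr_neq0 ?gt_eqF// coefD coefZ coefXn.
    by rewrite (gtn_eqF (leq_trans lm mq)) mulr0 add0r lt_neqAle eq_sym hq h0.
  + by rewrite (nrmZ HN) gtr0_norm ?invr_gt0// mulVf// gt_eqF.
Qed.

End averages.

(** * Averages over a base of [al]-averages, and stabilization of their coefficients *)

Section relative_averages.
Variables (R : realType) (s : omega1 -> nat -> omega1).
Variables (G : nat -> Prop) (nrm : {poly R} -> R).
Variables (al : omega1) (d q : nat -> nat) (w : nat -> {poly R}).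
Implicit Types (x y : nat -> nat) (l : seq (bool * R)).

(* An average built from the base [w] is encoded by a list [l] of pairs
   (flag, coefficient): the [j]-th pair refers to the base vector [w (x j)] when
   the flag is [false], and to the basis vector number [d (x j)], which enters
   through a limit step, when it is [true]. *)
Definition entry (c : bool) i : {poly R} := if c then 'X^(d i) else w i.

Fixpoint comb x l : {poly R} :=
  if l is e :: l' then e.2 *: entry e.1 (x 0%N) + comb (tail 1 x) l' else 0.

Definition rescale (c : R) l := [seq (e.1, c * e.2) | e <- l].

Definition unitize x l := rescale (nrm (comb x l))^-1 l.

Fixpoint blocks (g : (nat -> nat) -> seq (bool * R)) k x :=
  if k is k'.+1 then blocks g k' x ++ g (tail (size (blocks g k' x)) x) else [::].

Definition opred (g : omega1) : omega1 := xget ozero [set b | g = osucc b].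

(** Well-founded recursion needs a default, here the empty list, for orders not below [g]. It is not
    met when [g] exceeds [al], because the associated ordinals of [g] are smaller than [g]. *)
Definition av : omega1 -> (nat -> nat) -> seq (bool * R) :=
  Fix omega1_wf (fun _ => (nat -> nat) -> seq (bool * R)) (fun g rec x =>
    let rec' b := if pselect (b < g)%O is left h then rec b h else fun=> [::] in
    if g == al then [:: (false, 1)] else
    if pselect (is_limit g) is left _ then
      unitize x ((true, (d (x 0%N))%:R^-1) :: rec' (s g (d (x 0%N))) (tail 1 x))
    else unitize x (blocks (rec' (opred g)) (d (x 0%N)) x)).

Definition av_below (g b : omega1) : (nat -> nat) -> seq (bool * R) :=
  if pselect (b < g)%O is left _ then av b else fun=> [::].

Lemma avE g : av g = fun x =>
    if g == al then [:: (false, 1)] else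
    if pselect (is_limit g) is left _ then
      unitize x ((true, (d (x 0%N))%:R^-1) :: av_below g (s g (d (x 0%N))) (tail 1 x))
    else unitize x (blocks (av_below g (opred g)) (d (x 0%N)) x).
Proof.
rewrite {1}/av Fix_eq -/av; first by [].
move=> z f f' ff; suff -> : f = f' by [].
apply: functional_extensionality_dep => b.
by apply: functional_extensionality_dep => h; exact: ff.
Qed.

Lemma opredK b : opred (osucc b) = b.
Proof. by rewrite /opred; case: xgetP => [y _ /osucc_inj|/(_ b)/(_ erefl)]. Qed.

Lemma av_al x : av al x = [:: (false, 1)].
Proof. by rewrite avE /= eqxx. Qed.

Lemma av_succ b x : (al <= b)%O ->
  av (osucc b) x = unitize x (blocks (av b) (d (x 0%N)) x).
Proof.
move=> ab; rewrite avE /= gt_eqF ?ltosucc// opredK /av_below.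
by case: pselect => [/is_limit_osucc//|_]; case: pselect => // /negP; rewrite osucc_gt.
Qed.

Lemma av_limit g x : is_limit g -> (al < g)%O -> (s g (d (x 0%N)) < g)%O ->
  av g x = unitize x ((true, (d (x 0%N))%:R^-1) :: av (s g (d (x 0%N))) (tail 1 x)).
Proof.
move=> lg ag sg; rewrite avE /= gt_eqF// /av_below; case: pselect => // _.
by case: pselect.
Qed.

Lemma size_rescale c l : size (rescale c l) = size l.
Proof. by rewrite size_map. Qed.

Lemma size_unitize x l : size (unitize x l) = size l.
Proof. exact: size_rescale. Qed.

Lemma comb_cat x l l' : comb x (l ++ l') = comb x l + comb (tail (size l) x) l'.
Proof.
elim: l x => [|e l IH] x /=; first by rewrite add0r.
by rewrite IH addrA tail_tail.
Qed.

Lemma comb_rescale c x l : comb x (rescale c l) = c *: comb x l.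
Proof.
elim: l x => [|e l IH] x /=; first by rewrite scaler0.
by rewrite IH scalerDr scalerA.
Qed.

Lemma comb_eq x y l : (forall i, (i < size l)%N -> y i = x i) -> comb y l = comb x l.
Proof.
elim: l x y => [//|e l IH] x y h /=; rewrite (h 0%N)//; congr +%R.
by apply: IH => i il; apply: h.
Qed.

Lemma unitize_eq x y l : (forall i, (i < size l)%N -> y i = x i) ->
  unitize y l = unitize x l.
Proof. by move=> h; rewrite /unitize (comb_eq h). Qed.

(** No list looks at entries of [x] beyond those it consumes. This gives the finite dependence
    required by the Ramsey argument, and allows lists to be glued end to end. *)
Definition determined (g : (nat -> nat) -> seq (bool * R)) :=
  forall x y, (forall i, (i < size (g x))%N -> y i = x i) -> g y = g x.

Lemma determined_blocks g k : determined g -> determined (blocks g k).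
Proof.
move=> hg; elim: k => [//|k IH] x y /= h.
have e : blocks g k y = blocks g k x.
  by apply: IH => i il; apply: h; rewrite size_cat ltn_addr.
rewrite e; congr cat; apply: hg => i il; apply: h.
by rewrite size_cat ltn_add2l.
Qed.

Hypothesis d_gt0 : forall i, (0 < d i)%N.

Lemma determined_av g : determined (av g).
Proof.
elim/omega1_ind : g => g IH x y; rewrite avE /=.
have hr b : determined (av_below g b).
  by rewrite /av_below; case: pselect => // bg; exact: IH.
case: eqP => // _; case: pselect => lg.
  rewrite size_unitize /= => h.
  have -> : y 0%N = x 0%N by exact: h.
  have -> : av_below g (s g (d (x 0%N))) (tail 1 y) = av_below g (s g (d (x 0%N))) (tail 1 x).
    by apply: hr => i il; apply: h.
  exact: unitize_eq.
rewrite size_unitize => h.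
suff -> : blocks (av_below g (opred g)) (d (y 0%N)) y = blocks (av_below g (opred g)) (d (x 0%N)) x.
  exact: unitize_eq.
(* An empty list says nothing about [x 0], but then all lists of this order are empty. *)
have [b0|b0] := posnP (size (av_below g (opred g) x)).
  have r0 z : av_below g (opred g) z = [::].
    by rewrite (hr (opred g) x z) ?b0//; apply/size0nil.
  have B0 k z : blocks (av_below g (opred g)) k z = [::] by elim: k => //= k ->; rewrite r0.
  by rewrite !B0.
have -> : y 0%N = x 0%N.
  apply: h; have := d_gt0 (x 0%N); case: (d _) => // k _; move: b0.
  elim: k => [|k IHk] //= b0; rewrite size_cat; apply: ltn_addr; exact: IHk.
by apply: determined_blocks.
Qed.

Lemma blocks_add g k m x :
  blocks g (k + m) x = blocks g k x ++ blocks g m (tail (size (blocks g k x)) x).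
Proof.
elim: m => [|m IH]; first by rewrite addn0 cats0.
by rewrite addnS /= IH -catA tail_tail size_cat.
Qed.

Lemma comb_blocks g k x : comb x (blocks g k x) =
  \sum_(i < k) comb (tail (size (blocks g i x)) x) (g (tail (size (blocks g i x)) x)).
Proof.
by elim: k => [|k IH]; rewrite ?big_ord0// big_ord_recr /= comb_cat IH.
Qed.

Definition mass l : R := \sum_(e <- l | e.1) e.2.

Lemma mass_cat l l' : mass (l ++ l') = mass l + mass l'.
Proof. by rewrite /mass big_cat. Qed.

Lemma mass_rescale c l : mass (rescale c l) = c * mass l.
Proof. by rewrite /mass big_map mulr_sumr. Qed.

Hypothesis HN : block_norm G nrm.
Hypothesis hs : associated_sequences s.
Hypothesis wA : forall i, Avg s G nrm al (d i) (q i) (w i).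
Hypothesis qd : forall i, (q i < d i.+1)%N.
Hypothesis d4 : forall i, (4 ^ i <= d i)%N.

Lemma incr_d : incr d.
Proof. by move=> i; apply: leq_ltn_trans (qd i); exact: blk_le (Avg_blk HN (wA i)). Qed.

Lemma G_d i : G (d i).
Proof. by have [h _ dn _ _] := Avg_blk HN (wA i); have [] := h _ dn. Qed.

Lemma inb_entry c i : inb G (d i) (d i.+1) (entry c i).
Proof.
case: c; first exact: inbW (leqnn _) (incr_d i) (inbX (G_d i)).
by have [h _ _ _ _] := Avg_blk HN (wA i); exact: inbW (leqnn _) (qd i) h.
Qed.

Lemma nrm_entry c i : nrm (entry c i) = 1.
Proof. by case: c; [apply: (nrmX HN (G_d i))|have [] := Avg_blk HN (wA i)]. Qed.

Lemma inb_comb x l : incr x -> inb G (d (x 0%N)) (d (x (size l))) (comb x l).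
Proof.
elim: l x => [|e l IH] x ix; first exact: inb0.
apply: inbD; last first.
  apply: inbW (IH _ (incr_tail 1 ix)) => //.
  by apply: incr_le incr_d _; apply: incr_le ix _.
apply/inbZ/inbW/inb_entry => //; apply: incr_le incr_d _.
exact: incr_lt ix _.
Qed.

(** Each entry, multiplied by its coefficient, is an interval projection of the combination, and
    entries have norm one. *)
Lemma coef_le x l e : incr x -> e \in l -> `|e.2| <= 4 * nrm (comb x l).
Proof.
move=> ix /path.splitPr[l1 l2]; rewrite comb_cat /=.
set k := size l1.
have h1 := @inb_comb x l1 ix.
have h2 : inb G (d (x k)) (d (x k).+1) (e.2 *: entry e.1 (tail k x 0%N)).
  by rewrite /tail addn0; apply/inbZ/inb_entry.
have h3 := @inb_comb _ l2 (incr_tail 1 (incr_tail k ix)).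
rewrite addrA; have -> : `|e.2| = nrm (e.2 *: entry e.1 (tail k x 0%N)).
  by rewrite (nrmZ HN) nrm_entry mulr1.
apply: (nrm_mid HN h1 h2 (inbW _ (leqnn _) h3)).
rewrite /tail; apply: incr_le incr_d _.
by have := ix k; rewrite (_ : (k + (1 + 0) = k.+1)%N)// addn1.
Qed.

(* [a] is the approximate common value of the coefficients of the base vectors;
   the limit steps contribute the negligible [mass]. *)
Definition av_spec g x (a e : R) := [/\
  exists2 Q, (Q < d (x (size (av g x))))%N & Avg s G nrm g (d (x 0%N)) Q (comb x (av g x)),
  forall c, c \in av g x -> 0 <= c.2,
  forall c, c \in av g x -> ~~ c.1 -> `|c.2 - a| <= e &
  mass (av g x) <= e * 2^-1 ^+ x 0%N].

Lemma av_spec_size g x a e : av_spec g x a e -> (0 < size (av g x))%N.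
Proof.
move=> [[Q _ /(Avg_blk HN)[_ _ _ _ n1]] _ _ _]; move: n1.
by case: (av g x) => //=; rewrite (nrm0 HN) => /eqP; rewrite eq_sym oner_eq0.
Qed.

Lemma av_spec_le4 g x a e c : incr x -> av_spec g x a e -> c \in av g x -> 0 <= c.2 <= 4.
Proof.
move=> ix [[Q _ /(Avg_blk HN)[_ _ _ _ n1]] h _ _] cl; rewrite h//=.
by have := coef_le ix cl; rewrite n1 mulr1 ger0_norm ?h.
Qed.

(** The coefficients lie in [[0, 4]], so truncating their approximate value at 4 does not increase
    the error. This keeps the approximate values in a compact interval. *)
Lemma av_spec_clamp g x a e : incr x -> av_spec g x a e -> 0 <= a ->
  av_spec g x (Num.min 4 a) e.
Proof.
move=> ix h a0; have [h1 h2 h3 h4] := h; split => // c cl c1.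
have /andP[c0 c4] := av_spec_le4 ix h cl; have := h3 c cl c1.
rewrite minElt; case: ltP => // a4; rewrite !ler_norml; lra.
Qed.

Definition stable g := forall N, incr N -> forall e, 0 < e ->
  exists2 M, subseqn M N & exists2 a, 0 <= a <= 4 &
  forall x, subseqn x M -> av_spec g x a e.

Lemma nrm_comb_ge l l' x : incr x -> nrm (comb x l) = 1 -> 1 <= 4 * nrm (comb x (l ++ l')).
Proof.
move=> ix n1; rewrite comb_cat -[X in nrm (X + _)]add0r -[X in X <= _]n1.
have h1 := @inb_comb x l ix.
have h2 := @inb_comb _ l' (incr_tail (size l) ix).
by apply: (nrm_mid HN (@inb0 _ _ 0%N _) h1 (inbW _ (leqnn _) h2)); rewrite /tail addn0.
Qed.

Lemma sum_half_pow k : \sum_(i < k) 2^-1 ^+ i <= 2 :> R.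
Proof.
suff -> : \sum_(i < k) 2^-1 ^+ i = 2 - 2 * 2^-1 ^+ k :> R.
  by rewrite gerBl mulr_ge0// exprn_ge0// invr_ge0.
elim: k => [|k IH]; first by rewrite big_ord0 expr0; lra.
by rewrite big_ord_recr /= IH exprS; lra.
Qed.

Lemma mem_blocks g k x c : c \in blocks g k x ->
  exists2 i, (i < k)%N & c \in g (tail (size (blocks g i x)) x).
Proof.
elim: k => //= k IH; rewrite mem_cat => /orP[/IH[i ik ci]|ck]; last by exists k.
by exists i => //; exact: ltnW.
Qed.

Lemma mass_blocks g k x :
  mass (blocks g k x) = \sum_(i < k) mass (g (tail (size (blocks g i x)) x)).
Proof.
elim: k => [|k IH]; first by rewrite big_ord0 /mass big_nil.
by rewrite big_ord_recr /= mass_cat IH.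
Qed.

Lemma blocks_size M b a e k x : (forall x, subseqn x M -> av_spec b x a e) ->
  subseqn x M -> (k <= size (blocks (av b) k x))%N.
Proof.
move=> hM xM; elim: k => //= k IH; rewrite size_cat -addn1; apply: leq_add => //.
exact: av_spec_size (hM _ (subseqn_tail _ xM)).
Qed.

Lemma mem_rescale c l e : e \in rescale c l ->
  exists2 e', e' \in l & e = (e'.1, c * e'.2).
Proof. by move/mapP. Qed.

Lemma half_pow_ge0 n : 0 <= 2^-1 ^+ n :> R.
Proof. by rewrite exprn_ge0// invr_ge0. Qed.

Lemma half_pow_le m n : (m <= n)%N -> 2^-1 ^+ n <= 2^-1 ^+ m :> R.
Proof. by move=> mn; apply: ler_wiXn2l => //; lra. Qed.

(** Blocks are nonempty, so the [i]-th one starts at an index at least [x 0 + i], and the masses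
    decrease geometrically. *)
Lemma mass_blocks_le M b a e k x : (forall x, subseqn x M -> av_spec b x a e) ->
  0 < e -> subseqn x M -> mass (blocks (av b) k x) <= 2 * e * 2^-1 ^+ x 0%N.
Proof.
move=> hM e0 xM; rewrite mass_blocks.
apply: (@le_trans _ _ (\sum_(i < k) e * 2^-1 ^+ x 0%N * 2^-1 ^+ i)).
  apply: ler_sum => i _; have [_ _ _ h] := hM _ (subseqn_tail (size (blocks (av b) i x)) xM).
  apply: le_trans h _; rewrite -mulrA ler_wpM2l ?(ltW e0)// -exprD half_pow_le//.
  rewrite /tail addn0; apply: (@leq_trans (x 0 + size (blocks (av b) i x))%N).
    by rewrite leq_add2l; exact: blocks_size hM xM.
  by elim: (size _) => [|n IH]; rewrite ?addn0// addnS; exact: leq_ltn_trans IH (xM.1 n).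
rewrite -mulr_sumr; apply: (@le_trans _ _ (e * 2^-1 ^+ x 0%N * 2)).
  by rewrite ler_wpM2l ?sum_half_pow// mulr_ge0 ?half_pow_ge0 ?(ltW e0).
by rewrite mulrC mulrA.
Qed.

(** The coefficients are those of [b]-averages, close to a common [a], multiplied by one normalizing
    factor; this factor depends on finitely many terms of [x], and [ramsey] makes it nearly
    constant. *)
Lemma stable_succ b : (al <= b)%O -> stable b -> stable (osucc b).
Proof.
(* A product of two numbers of [[0, 4]], each known within [e'], is known within [8 e'], and the
   mass also grows to at most [8 e'] times the power of 1/2; 64 leaves room. *)
move=> ab sb N iN e e0; pose e' := e / 64; have e'0 : 0 < e' by rewrite /e'; lra.
have [M1 M1N [a /andP[a0 a4] h1]] := sb N iN e' e'0.
pose lx x := blocks (av b) (d (x 0%N)) x.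
(* The truncation provides a bound on all sequences; along subsequences of [M1] the factor is at
   most 4 anyway. *)
pose sg x := Num.min 4 (nrm (comb x (lx x)))^-1.
have sg04 x : 0 <= sg x <= 4.
  by rewrite /sg ge_min lexx orTb andbT le_min invr_ge0 (nrm_ge0 HN) andbT ler0n.
have fsg : finite_dep sg.
  move=> x; exists (size (lx x)).+1 => y xy; rewrite /sg /lx xy//.
  rewrite (determined_blocks (@determined_av b) (x := x)); last first.
    by move=> i il; apply: xy; rewrite ltnS ltnW.
  by rewrite (@comb_eq x y)// => i il; apply: xy; rewrite ltnS ltnW.
have [M MM1 [sl /andP[sl0 sl4] h2]] := ramsey sg04 fsg M1N.1 e'0.
exists M; first exact: subseqn_trans MM1 M1N.
exists (Num.min 4 (a * sl)); first by rewrite ge_min lexx orTb andbT le_min ler0n mulr_ge0.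
move=> x xM; have xM1 := subseqn_trans xM MM1; have ix := xM.1.
apply: (@av_spec_clamp (osucc b) x (a * sl) e) => //; last exact: mulr_ge0.
have lE : av (osucc b) x = unitize x (lx x) by rewrite av_succ.
have [k kE] : exists k, d (x 0%N) = k.+1.
  by exists (d (x 0%N)).-1; rewrite prednK.
have n4 : 1 <= 4 * nrm (comb x (lx x)).
  rewrite /lx kE -[k.+1]add1n blocks_add /= tail0; apply: nrm_comb_ge => //.
  by have [[Q _ /(Avg_blk HN)[]]] := h1 _ xM1.
have n0 : 0 < nrm (comb x (lx x)) by lra.
have sgE : (nrm (comb x (lx x)))^-1 = sg x.
  rewrite /sg; apply/esym/min_idPr.
  by rewrite -[leRHS]invrK lef_pV2 ?posrE ?invr_gt0//; lra.
split.
- have h3 i : exists Q, (Q < d (x (size (blocks (av b) i.+1 x))))%N /\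
      Avg s G nrm b (d (x (size (blocks (av b) i x)))) Q
      (comb (tail (size (blocks (av b) i x)) x) (av b (tail (size (blocks (av b) i x)) x))).
    have [[Q Q1 Q2] _ _ _] := h1 _ (subseqn_tail (size (blocks (av b) i x)) xM1).
    by exists Q; rewrite /= size_cat; split => //; move: Q2; rewrite /tail addn0.
  have /choice[Q hQ] := h3.
  exists (Q k); rewrite lE.
    by rewrite size_unitize /lx kE; exact: (hQ k).1.
  rewrite /unitize comb_rescale /lx comb_blocks kE -{1}kE.
  apply: (@Avg_succ _ _ _ _ b k (fun i => d (x (size (blocks (av b) i x)))) Q
    (fun i => comb (tail (size (blocks (av b) i x)) x) (av b (tail (size (blocks (av b) i x)) x)))).
  + by move=> i _; exact: (hQ i).2.
  + by move=> i _; exact: (hQ i).1.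
  + by [].
- move=> c; rewrite lE => /mem_rescale[c' c'l ->] /=; rewrite mulr_ge0 ?invr_ge0 ?(ltW n0)//.
  have [i _ ci] := mem_blocks c'l.
  by have [_ h _ _] := h1 _ (subseqn_tail (size (blocks (av b) i x)) xM1); exact: h.
- move=> c; rewrite lE => /mem_rescale[c' c'l ->] /= c'1.
  have [i _ ci] := mem_blocks c'l; have xiM := subseqn_tail (size (blocks (av b) i x)) xM1.
  have [_ _ h _] := h1 _ xiM; have {}h := h _ ci c'1; have h' := h2 _ xM.
  rewrite sgE; have /andP[s0 s4] := sg04 x; move: h h'; rewrite !ler_norml /e'.
  move: (sg x) s0 s4 => t; move: (c'.2) => c2; clear -a0 a4 sl0 sl4 e0.
  move=> t0 t4 /andP[h1 h2] /andP[h3 h4]; apply/andP; split; nra.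
- rewrite lE mass_rescale sgE; have /andP[s0 s4] := sg04 x.
  have := mass_blocks_le (d (x 0%N)) h1 e'0 xM1; rewrite -/(lx x) /e'.
  have := half_pow_ge0 (x 0%N); move: (mass _) (2^-1 ^+ _) (sg x) s0 s4 => ms p t.
  move=> t0 t4 p0 h; apply: (@le_trans _ _ (t * (2 * (e / 64) * p))).
    by rewrite ler_wpM2l.
  have : t * (2 * (e / 64) * p) <= 4 * (2 * (e / 64) * p).
    by rewrite ler_wpM2r// !mulr_ge0//; lra.
  by nra.
Qed.

(** The order used after the first index depends on this index. Fusion stabilizes all these orders
    at once, a subsequence makes their approximate values [r] agree, and the small leading
    coefficient keeps the normalizing factor close to 1. *)
Lemma stable_limit g : is_limit g -> (al < g)%O ->
  (forall b, (b < g)%O -> (al <= b)%O -> stable b) -> stable g.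
Proof.
move=> lg ag IH N iN e e0; pose e' := e / 64; have e'0 : 0 < e' by rewrite /e'; lra.
have [n0 n0P] := assoc_cofinal hs lg ag.
have [n1 n1P] : exists n1, 2^-1 ^+ n1 <= e'.
  have [n _ h] : \forall n \near \oo, (2^-1 : R) ^+ n < e'.
    have : ((fun n => 2^-1 ^+ n) : nat -> R) @ \oo --> (0 : R).
      by apply: cvg_expr; rewrite ger0_norm; lra.
    by move/cvgrPdist_lt => /(_ _ e'0); apply: filterS => n; rewrite sub0r normrN ger0_norm.
  by exists n; apply/ltW/h => /=.
pose N1 := tail (maxn n0 n1) N.
have iN1 : incr N1 by exact: incr_tail.
have N1ge i : (maxn n0 n1 <= N1 i)%N.
  apply: leq_trans (incr_ge _ iN); exact: leq_addr.
pose sgd i := s g (d i).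
have sgd_lt i : (sgd i < g)%O by apply: assoc_lt.
have [||M1 M1N M1P] := @fusion (fun i M => (al <= sgd i)%O -> exists2 a, 0 <= a <= 4 &
    forall x, subseqn x M -> av_spec (sgd i) x a e') N1 iN1.
- move=> i M M' h M'M ai; have [a a4 h'] := h ai; exists a => // x xM'.
  by apply: h'; exact: subseqn_trans M'M.
- move=> i N' [iN' _]; have [ai|ai] := boolP (al <= sgd i)%O; last first.
    by exists N'; [exact: subseqn_refl|].
  by have [M MN' h] := IH _ (sgd_lt i) ai N' iN' e' e'0; exists M.
have al_sgd i : (al <= sgd (M1 i))%O.
  apply: n0P; apply: leq_trans (incr_ge _ incr_d); have [k ->] := M1N.2 i.
  exact: leq_trans (leq_maxl _ _) (N1ge k).
have /choice[r rP] i : exists a, 0 <= a <= 4 /\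
    forall x, subseqn x (tail i.+1 M1) -> av_spec (sgd (M1 i)) x a e'.
  by have [a ? ?] := M1P i (al_sgd i); exists a.
have [|a a4 [h ih hr]] := @bounded_subsequence R 4 r e' e'0.
  by move=> n; have [] := rP n.
exists (M1 \o h).
  split => [i|i] /=; first by rewrite incr_ltE//; exact: M1N.1.
  by have [k ->] := M1N.2 (h i); exists (maxn n0 n1 + k)%N.
exists a => // x [ix xM]; have [k xk] := xM 0%N.
have yM : subseqn (tail 1 x) (tail (h k).+1 M1).
  apply: subseqn_after; first exact: M1N.1.
    split; first exact: incr_tail.
    by move=> i; have [j xj] := xM (1 + i)%N; exists (h j); exact: xj.
  by rewrite -[M1 _]/((M1 \o h) k) -xk; exact: ix.
have iy := yM.1.
have := (rP (h k)).2 _ yM; rewrite -[M1 (h k)]/((M1 \o h) k) -xk => sy.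
have [[Q Qlt QA] h2 h3 h4] := sy; set y := tail 1 x in sy Qlt QA h2 h3 h4 yM iy *.
have asg : (al <= sgd (x 0%N))%O by rewrite xk; exact: al_sgd.
have avgE : av g x = unitize x ((true, (d (x 0%N))%:R^-1) :: av (sgd (x 0%N)) y).
  by rewrite av_limit//; exact: sgd_lt.
set l0 := (true, _) :: _ in avgE.
have cE : comb x l0 = (d (x 0%N))%:R^-1 *: 'X^(d (x 0%N)) + comb y (av (sgd (x 0%N)) y) by [].
have dxy : (d (x 0%N) < d (y 0%N))%N by apply: incr_lt incr_d _; exact: ix.
have Gd := G_d (x 0%N).
have AP : Avg s G nrm g (d (x 0%N)) Q ((nrm (comb x l0))^-1 *: comb x l0).
  by rewrite cE; apply: Avg_limit QA.
have [_ _ _ _ nQ] := Avg_blk HN QA.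
(* By [4^i <= d i], the coefficient is at most a product of two powers of 1/2: one is below [e'],
   the other is the rate required of the mass. *)
have dp : (d (x 0%N))%:R^-1 <= e' * 2^-1 ^+ x 0%N.
  have x01 : (n1 <= x 0)%N.
    have [i xi] := M1N.2 (h k); apply: leq_trans (leq_maxr n0 n1) _.
    by rewrite xk /= xi; exact: N1ge.
  apply: (@le_trans _ _ ((2^-1 ^+ x 0%N) * 2^-1 ^+ x 0%N)); last first.
    by rewrite ler_wpM2r ?half_pow_ge0// (le_trans _ n1P)// half_pow_le.
  rewrite -exprMn -invfM -natrM exprVn -natrX lef_pV2 ?posrE ?ltr0n ?expn_gt0//.
  by rewrite ler_nat; exact: d4.
have p1 : 2^-1 ^+ x 0%N <= 1 :> R by rewrite -(expr0 2^-1); exact: half_pow_le.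
have p0 := half_pow_ge0 (x 0%N).
have nl0 : `|nrm (comb x l0) - 1| <= e' /\ 1 <= 4 * nrm (comb x l0).
  have di0 : 0 <= (d (x 0%N))%:R^-1 :> R by rewrite invr_ge0.
  have nX : nrm ((d (x 0%N))%:R^-1 *: 'X^(d (x 0%N))) = (d (x 0%N))%:R^-1.
    by rewrite (nrmZ HN) (nrmX HN Gd) mulr1 ger0_norm.
  split.
    have t1 := nrmD HN ((d (x 0%N))%:R^-1 *: 'X^(d (x 0%N))) (comb y (av (sgd (x 0%N)) y)).
    have t2 := nrmD HN (comb x l0) (- ((d (x 0%N))%:R^-1 *: 'X^(d (x 0%N)))).
    move: t1 t2; rewrite -cE cE (nrmN HN) nX nQ addrAC subrr add0r nQ -cE ler_norml => t1 t2.
    by apply/andP; split; nra.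
  rewrite cE -[X in X <= _]nQ.
  have hX : inb G 0 (d (y 0%N)) ((d (x 0%N))%:R^-1 *: 'X^(d (x 0%N)) : {poly R}).
    by apply: inbZ; exact: inbW (leq0n _) dxy (inbX Gd).
  by have := nrm_mid HN hX (@inb_comb y (av (sgd (x 0%N)) y) iy) (@inb0 _ _ _ 0%N); rewrite addr0.
move: nl0 => [nl1 nl4]; have nl0 : 0 < nrm (comb x l0) by lra.
pose t := (nrm (comb x l0))^-1.
have t0 : 0 <= t by rewrite invr_ge0 ltW.
have tn : t * nrm (comb x l0) = 1 by rewrite mulVf// gt_eqF.
have t4 : t <= 4 by nra.
have t1 : `|t - 1| <= 4 * e'.
  have -> : t - 1 = t * (1 - nrm (comb x l0)) by rewrite mulrBr mulr1 tn.
  by rewrite normrM distrC ger0_norm// ler_pM.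
split.
- exists Q; last by rewrite avgE comb_rescale.
  by rewrite avgE size_unitize.
- move=> c; rewrite avgE => /mem_rescale[c' c'l ->] /=; rewrite mulr_ge0//.
  move: c'l; rewrite inE => /predU1P[->/=|/h2//]; by rewrite invr_ge0.
- move=> c; rewrite avgE => /mem_rescale[c' c'l ->] /= c'1.
  move: c'l; rewrite inE => /predU1P[c'E|c'l]; first by rewrite c'E in c'1.
  have := h3 _ c'l c'1; have := hr k; have /andP[c0 c4] := av_spec_le4 iy sy c'l.
  rewrite -/t; move: t1; rewrite !ler_norml /e'; move: (r (h k)) (c'.2) c0 c4 => rh c2 c0 c4.
  clear -t0 t4 e0 c0 c4 => /andP[h1 h2] /andP[h3 h4] /andP[h5 h6].
  have : c2 * (t - 1) <= c2 * (4 * (e / 64)) by rewrite ler_wpM2l.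
  have : c2 * (- (4 * (e / 64))) <= c2 * (t - 1) by rewrite ler_wpM2l.
  by move=> k1 k2; apply/andP; split; nra.
- rewrite avgE mass_rescale -/t /l0 /mass big_cons /= -/(mass _).
  have h5 : mass (av (sgd (x 0%N)) y) <= e' * 2^-1 ^+ x 0%N.
    apply: le_trans h4 _; rewrite ler_wpM2l ?(ltW e'0)// half_pow_le//.
    exact/ltnW/ix.
  apply: (@le_trans _ _ (4 * (2 * (e' * 2^-1 ^+ x 0%N)))).
    apply: ler_pM => //; last by lra.
    apply: addr_ge0; first by rewrite invr_ge0.
    by rewrite /mass big_seq_cond sumr_ge0// => c /andP[/h2].
  by rewrite /e'; nra.
Qed.

Lemma stable_al : stable al.
Proof.
move=> N iN e e0; exists N; first exact: subseqn_refl.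
exists 1; first by rewrite ler01 /=; lra.
move=> x [ix _]; rewrite /av_spec av_al /=; split.
- exists (q (x 0%N)); last by rewrite scale1r addr0.
  by apply: leq_trans (qd _) _; apply: incr_le incr_d _; exact: ix.
- by move=> c; rewrite inE => /eqP ->.
- by move=> c; rewrite inE => /eqP -> _; rewrite subrr normr0 ltW.
- by rewrite /mass big_cons /= big_nil mulr_ge0 ?half_pow_ge0// ltW.
Qed.

Lemma stableP g : (al <= g)%O -> stable g.
Proof.
elim/omega1_ind : g => g IH; rewrite le_eqVlt => /predU1P[<-|ag]; first exact: stable_al.
have [g0|[b gb]|lg] := ordinal_cases g.
- by rewrite g0 lt_ozero in ag.
- by rewrite gb in ag IH *; rewrite ltosucc in ag; apply: stable_succ (IH _ (osucc_gt b) ag).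
- by apply: stable_limit => // b bg; exact: IH.
Qed.

End relative_averages.

(** * Covering initial segments by averages *)

Section covers.
Variables (R : realType) (s : omega1 -> nat -> omega1).
Variables (nrm : {poly R} -> R).
Variables (al : omega1) (d : nat -> nat) (w : nat -> {poly R}).
Hypothesis hs : associated_sequences s.
Hypothesis incd : incr d.
Hypothesis d_gt0 : forall i, (0 < d i)%N.
Local Notation av := (av s nrm al d w).
Local Notation unitize := (unitize nrm d w).
Implicit Types (x y z N M H : nat -> nat) (l : seq (bool * R)) (A : set nat)
  (AA : set (set nat)) (g : omega1).

Let dav g : determined (av g).
Proof. exact: determined_av. Qed.

Fixpoint base_indices x l : seq nat := if l is e :: l' then
  (if e.1 then [::] else [:: x 0%N]) ++ base_indices (tail 1 x) l' else [::].

Lemma base_indices_cat x l l' : base_indices x (l ++ l') =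
  base_indices x l ++ base_indices (tail (size l) x) l'.
Proof.
by elim: l x => [|e l IH] x //=; rewrite IH catA tail_tail.
Qed.

Lemma base_indices_rescale x c l : base_indices x (rescale c l) = base_indices x l.
Proof. by elim: l x => [|e l IH] x //=; rewrite IH. Qed.

Lemma base_indices_eq x y l : (forall i, (i < size l)%N -> y i = x i) ->
  base_indices y l = base_indices x l.
Proof.
elim: l x y => [//|e l IH] x y h /=; rewrite (h 0%N)//; congr cat.
by apply: IH => i il; apply: h.
Qed.

(** The base indices are exactly the first [n] terms of [H], whereas flagged indices may lie outside
    [H]. The last clause prevents these from passing the part of [H] already consumed, so that
    another run can follow. *)
Definition run g p N H n x := [/\ subseqn x N,
  base_indices x (blocks (av g) p x) = mkseq H n &
  forall i, (i < size (blocks (av g) p x))%N -> exists2 i', (i' < n)%N & (x i <= H i')%N].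

(** Limit steps may force [x] to start below [H 0]; the last clause keeps it above every term of [M]
    below [H 0], hence above all earlier terms when [H] is a tail. The covering may go past the [j]
    given terms, since averages cannot be cut. *)
Definition covers g p N M A := forall H, subseqn H M ->
  forall j, (forall i, (i < j)%N -> A (H i)) ->
  exists p0 n x, [/\ (p0 <= p)%N, (j <= n)%N, run g p0 N H n x &
    forall k, (M k < H 0)%N -> (M k < x 0)%N].

(* Any initial segment of [H] lying in a member of [AA] is covered by at most [p]
   consecutive [g]-averages; the indices which are not in [H], used by the limit
   steps, are taken from the gaps between the elements of [M]. *)
Definition coverable g p AA := forall N, incr N ->
  exists2 M, subseqn M N & forall A, AA A -> covers g p N M A.

(** Covering these by one average only says that some average has a nonempty initial segment of [H]
    as its base indices. *)
Definition singletons : set (set nat) := [set [set a] | a in [set: nat]].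

Lemma incr_after N v : incr N -> (v < tail v.+1 N 0)%N.
Proof. by move=> iN; rewrite /tail addn0; exact: incr_ge. Qed.

Lemma run0 g N H : incr N -> run g 0 N H 0 (tail (H 0%N).+1 N).
Proof. by move=> iN; split => //; apply: subseqn_tail; exact: subseqn_refl. Qed.

Lemma run0_gap N M H k : incr N -> (M k < H 0)%N -> (M k < tail (H 0%N).+1 N 0)%N.
Proof. by move=> iN Mk; apply: ltn_trans Mk _; exact: incr_after. Qed.

Lemma covers_le g p p' N N' M M' A A' : covers g p N M A -> (p <= p')%N ->
  subseqn M' M -> (forall x, subseqn x N -> subseqn x N') -> A' `<=` A ->
  covers g p' N' M' A'.
Proof.
move=> h pp M'M NN AA H HM' j Aj.
have [p0 [n [x [p0p jn [xN bx ex] gap]]]] := h H (subseqn_trans HM' M'M) j (fun i ij => AA _ (Aj i ij)).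
exists p0, n, x; split => //; first exact: leq_trans pp.
  by split => //; exact: NN.
by move=> k; have [k' ->] := M'M.2 k; exact: gap.
Qed.

Lemma coverable_sub g p AA AA' : coverable g p AA -> AA' `<=` AA -> coverable g p AA'.
Proof.
by move=> h AAA N iN; have [M MN hM] := h N iN; exists M => // A /AAA /hM.
Qed.

(** The part of [x] consumed by the first run is continued by [y]; lists being determined by the
    entries they consume, both runs are unchanged. *)
Lemma run_cat g p q N H n m x y : incr H -> run g p N H n x ->
  run g q N (tail n H) m y -> (forall i, (i < n)%N -> (H i < y 0)%N) ->
  exists z, [/\ run g (p + q) N H (n + m) z,
    (forall v, (v < x 0)%N -> (v < y 0)%N -> (v < z 0)%N) &
    (0 < n)%N -> z 0%N = x 0%N].
Proof.
move=> iH [[ix xN] bx ex] [[iy yN] by_ ey] Hy.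
set lx := blocks (av g) p x in bx ex; set ly := blocks (av g) q y in by_ ey.
pose z := scat (mkseq x (size lx)) y.
have zx i : (i < size lx)%N -> z i = x i.
  by move=> il; rewrite /z /scat size_mkseq il nth_mkseq.
have zy i : z (size lx + i)%N = y i.
  by rewrite /z /scat size_mkseq ltnNge leq_addr /= addKn.
have ty : tail (size lx) z = y by apply/funext => i; exact: zy.
have lz : blocks (av g) (p + q) z = lx ++ ly.
  have e : blocks (av g) p z = lx.
    exact: (determined_blocks (k := p) (@dav g) (x := x)).
  by rewrite blocks_add e ty.
have xy i : (i < size lx)%N -> (x i < y 0)%N.
  by move=> /ex[i' i'n xi]; apply: leq_ltn_trans xi (Hy _ i'n).
have xn : (0 < n)%N -> (0 < size lx)%N.
  move=> n0; rewrite lt0n; apply/eqP => /size0nil l0; move: bx; rewrite l0.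
  by case: (n) n0.
exists z; split.
- split.
  + split => i; last first.
      have [il|il] := ltnP i (size lx); first by rewrite zx.
      by rewrite -(subnKC il) zy.
    have [il|il] := ltnP i.+1 (size lx).
      by rewrite (zx _ il) (zx _ (ltnW il)); exact: ix.
    rewrite leq_eqVlt in il; case/predU1P : il => [il|il].
      rewrite zx ?il// (_ : z i.+1 = y 0%N); first by apply: xy; rewrite il.
      by rewrite -zy il addn0.
    by have := iy (i - size lx)%N; rewrite -!zy subnKC// addnS subnKC.
  + rewrite lz base_indices_cat ty by_ (base_indices_eq (x := x))// bx.
    rewrite /mkseq iotaD map_cat; congr cat; rewrite add0n -[n in RHS]addn0 iotaDl -map_comp.
    by apply: eq_map => i.
  + move=> i; rewrite lz size_cat => il; have [ix'|ix'] := ltnP i (size lx).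
      by have [i' i'n xi] := ex _ ix'; exists i'; rewrite ?zx// ltn_addr.
    rewrite -(subnKC ix') zy.
    have [|i' i'm yi] := ey (i - size lx)%N; first by rewrite ltn_subLR.
    by exists (n + i')%N => //; rewrite ltn_add2l.
- move=> v vx vy; have [l0|l0] := posnP (size lx); last by rewrite zx.
  by have := zy 0%N; rewrite l0 => ->.
- by move=> n0; rewrite zx//; exact: xn.
Qed.

(** Once [M] starts at [n0], the segments to be covered are empty and no average is used. *)
Lemma coverable_avoid g AA n0 : (forall A i, AA A -> A i -> (i < n0)%N) ->
  coverable g 0 AA.
Proof.
move=> h N iN; exists (tail n0 N); first exact/subseqn_tail/subseqn_refl.
move=> A AAA H HM [_|j Aj]; last first.
  have := h A _ AAA (Aj 0%N isT); have [k ->] := HM.2 0%N.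
  by rewrite ltnNge /tail (leq_trans _ (incr_ge _ iN))// leq_addr.
exists 0%N, 0%N, (tail (H 0%N).+1 N); split => //; first exact: run0.
by move=> k; exact: (@run0_gap N (tail n0 N)).
Qed.

Lemma coverable_al_singletons : coverable al 1 singletons.
Proof.
move=> N iN; exists N; first exact: subseqn_refl.
move=> _ [a _ <-] H HM j Aj; exists 1%N, 1%N, H; split => //.
- case: j Aj => [//|[//|j]] Aj; have := Aj 0%N isT; have := Aj 1%N isT => /= <- h.
  by have := HM.1 0%N; rewrite h ltnn.
- split => //; first by rewrite /= av_al.
  by rewrite /= av_al => -[|//] _; exists 0%N.
Qed.

(* The averages crossing from a neighbourhood of the points described by [AA'] to
   its complement are covered by one additional average. *)
Lemma coverable_step g p q AA AA' : coverable g p AA' -> coverable g 1 singletons ->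
  (forall i, coverable g q [set A | AA A /\
     ~ exists2 A', AA' A' & forall k, (k <= i)%N -> A k -> A' k]) ->
  coverable g (p + 1 + q) AA.
Proof.
move=> cp c1 cq N iN.
have [M0 M0N hp] := cp N iN; have [M1 M1M0 h1] := c1 M0 M0N.1.
pose BB i := [set A | AA A /\ ~ exists2 A', AA' A' & forall k, (k <= i)%N -> A k -> A' k].
have M1N := subseqn_trans M1M0 M0N.
(* The averages covering members of [BB i] are taken in [N'], beyond [i], so that they start after
   every term of [M] up to [i]. *)
have [||M MM1 MP] := @fusion (fun i M => exists N', [/\ subseqn N' N,
    (i < N' 0)%N & forall A, BB i A -> covers g q N' M A]) M1 M1N.1.
- move=> i M M' [N' [N'N iN' h]] M'M; exists N'; split => // A BA.
  exact: covers_le (h A BA) (leqnn _) M'M _ _.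
- move=> i N1 N1M1; have iN1 := N1M1.1.
  have [M MN1 hM] := cq i _ (incr_tail i.+1 iN1).
  exists M; first exact: subseqn_taill MN1.
  exists (tail i.+1 N1); split => //; last exact: incr_after.
  exact: subseqn_tail (subseqn_trans N1M1 M1N).
have iM := MM1.1; have MN := subseqn_trans MM1 M1N.
exists M => // A AAA H HM j Aj; have iH := HM.1.
have cover_p A' j' : AA' A' -> (forall i, (i < j')%N -> A' (H i)) ->
    exists p0 n x, [/\ (p0 <= p)%N, (j' <= n)%N, run g p0 N H n x &
    forall k, (M k < H 0)%N -> (M k < x 0)%N].
  move=> A'A'; have cv := @covers_le g p p N N M0 M A' A' (hp _ A'A') (leqnn _)
    (subseqn_trans MM1 M1M0) (fun _ => id) (@subset_refl _ _).
  exact: cv.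
have [[A' A'A' A'j]|nA'] := pselect (exists2 A', AA' A' & forall i, (i < j)%N -> A' (H i)).
  have [p0 [n [x [p0p jn rx gx]]]] := cover_p A' j A'A' A'j.
  by exists p0, n, x; split => //; rewrite -addnA; exact: leq_trans (leq_addr _ _).
(* [M k] is where [A] first escapes from [AA']: the terms of [H] below [M k] are covered by [p]
   averages through a member of [AA'], one average takes the next term, possibly [M k] itself, and
   the terms left, beyond [M k], are covered by [q] averages. *)
have [k /asboolP BBk kmin] : exists2 k, `[< BB (M k) A >] & forall i, `[< BB (M i) A >] -> (k <= i)%N.
  suff e : exists k, `[< BB (M k) A >] by case: (ex_minnP e) => k; exists k.
  have [k Hk] := HM.2 j; exists k; apply/asboolP; split => // -[A' A'A' A'k].
  apply: nA'; exists A' => // i ij; apply: A'k; last exact: Aj.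
  by rewrite -Hk; exact/ltnW/incr_lt.
have [j1 [j1j j1lo j1hi]] : exists j1, [/\ (j1 <= j)%N, forall i, (i < j1)%N -> (H i < M k)%N &
    (j1 < j)%N -> (M k <= H j1)%N].
  have e : exists i, (j <= i)%N || (M k <= H i)%N by exists j; rewrite leqnn.
  case: (ex_minnP e) => j1 /orP j1P j1min; exists j1; split.
  - by apply: j1min; rewrite leqnn.
  - move=> i ij; rewrite ltnNge; apply/negP => Mk; have := j1min i.
    by rewrite Mk orbT leqNgt ij => /(_ isT).
  - by case: j1P => [|//]; rewrite leqNgt => /negP.
have [p1 [n1 [x1 [p1p jn1 r1 g1]]]] : exists p0 n x, [/\ (p0 <= p)%N, (j1 <= n)%N,
    run g p0 N H n x & forall k, (M k < H 0)%N -> (M k < x 0)%N].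
  case: k BBk kmin j1lo j1hi => [|k] BBk kmin j1lo j1hi.
    exists 0%N, 0%N, (tail (H 0%N).+1 N); split => //; last 2 first.
    - exact: run0.
    - by move=> k; exact: run0_gap.
      case: j1 j1lo {j1j j1hi} => // j1 /(_ 0%N isT); have [i ->] := HM.2 0%N.
      by rewrite incr_ltE.
  have /asboolPn nB : ~~ `[< BB (M k) A >] by apply/negP => /kmin; rewrite ltnn.
  have [A' A'A' A'k] : exists2 A', AA' A' & forall i, (i <= M k)%N -> A i -> A' i.
    by apply: contrapT => nn; apply: nB.
  apply: (cover_p A') => // i ij1; apply: A'k; last by apply: Aj; exact: leq_trans j1j.
  have := j1lo i ij1; have [i' ->] := HM.2 i.
  by rewrite incr_ltE// ltnS => /(incr_le iM).
have [jn1'|n1j] := leqP j n1.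
  by exists p1, n1, x1; split => //; rewrite -addnA; exact: leq_trans (leq_addr _ _).
have Mkn1 : (M k <= H n1)%N.
  by apply: leq_trans (j1hi (leq_ltn_trans jn1 n1j)) _; exact: incr_le.
have HM1 := subseqn_tail n1 HM.
have [p2 [n2 [x2 [p21 n21 r2 g2]]]] : exists p0 n x, [/\ (p0 <= 1)%N, (1 <= n)%N,
    run g p0 N (tail n1 H) n x & forall k, (M k < tail n1 H 0)%N -> (M k < x 0)%N].
  have h1' := h1 [set tail n1 H 0%N] (ex_intro2 _ _ _ I erefl).
  have [|p0 [n [x [h2 h3 [xM h4 h5] h6]]]] := h1' _ (subseqn_trans HM1 MM1) 1%N; first by case.
  exists p0, n, x; split => //; first by split => //; exact: subseqn_trans xM M0N.
  by move=> k'; have [k'' ->] := MM1.2 k'; exact: h6.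
have [N' [N'N kN' hN']] := MP k.
have HM2 : subseqn (tail (n1 + n2) H) (tail k.+1 M).
  apply: subseqn_after => //; first exact: subseqn_tail.
  by apply: leq_ltn_trans Mkn1 _; rewrite /tail addn0 incr_ltE// -{1}(addn0 n1) ltn_add2l.
have [|p3 [n3 [x3 [p3q jn3 [x3N' b3 e3] g3]]]] := hN' A BBk _ HM2 (j - (n1 + n2))%N.
  by move=> i ij; apply: Aj; rewrite -ltn_subRL.
have r3 : run g p3 N (tail n2 (tail n1 H)) n3 x3.
  by rewrite tail_tail; split => //; exact: subseqn_trans x3N' N'N.
have g3' k' : (M k' < H (n1 + n2))%N -> (M k' < x3 0)%N.
  move=> Mk'; have [k'k|kk'] := leqP k' k.
    apply: leq_ltn_trans (incr_le iM k'k) (leq_trans kN' _).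
    by have [i ->] := x3N'.2 0%N; exact: incr_le N'N.1 _.
  have := g3 (k' - k.+1)%N; rewrite {1 3}/tail subnKC// /tail addn0.
  exact.
have gapH n x : (forall k', (M k' < H n)%N -> (M k' < x 0)%N) -> forall i, (i < n)%N -> (H i < x 0)%N.
  by move=> hx i il; have [k' Hk'] := HM.2 i; rewrite Hk'; apply: hx; rewrite -Hk'; exact: incr_lt.
have [|y [ry gy zy]] := run_cat (incr_tail n1 iH) r2 r3.
  move=> i il; rewrite /tail; apply: (gapH (n1 + n2)%N) => //.
  by rewrite ltn_add2l.
have g2' k' : (M k' < H n1)%N -> (M k' < x2 0)%N by move=> h; apply: g2; rewrite /tail addn0.
have gy' k' : (M k' < H n1)%N -> (M k' < y 0)%N.
  move=> Mk'; apply: gy; first exact: g2'.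
  by apply: g3'; apply: leq_trans Mk' _; apply: incr_le => //; exact: leq_addr.
have [|z [rz gz _]] := run_cat iH r1 ry; first exact: gapH.
exists (p1 + (p2 + p3))%N, (n1 + (n2 + n3))%N, z; split => //.
- by rewrite -addnA; apply: leq_add => //; apply: leq_add.
- by rewrite addnA -leq_subLR.
- move=> k' Mk'; apply: gz; first exact: g1.
  by apply: gy'; apply: leq_trans Mk' _; exact: incr_le.
Qed.

Lemma run_succ g N H n x : (al <= g)%O -> run g (d (x 0%N)) N H n x ->
  run (osucc g) 1 N H n x.
Proof.
move=> ag [xN bx ex]; split => //=; rewrite tail0 av_succ//.
  by rewrite base_indices_rescale.
by move=> i; rewrite size_unitize; exact: ex.
Qed.

Lemma one_block g N M : (forall A, singletons A -> covers g 1 N M A) ->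
  forall H, subseqn H M -> exists n x, [/\ (0 < n)%N, run g 1 N H n x &
    forall k, (M k < H 0)%N -> (M k < x 0)%N].
Proof.
move=> h H HM; have sH : singletons [set H 0%N] by exists (H 0%N).
have [|p0 [n [x [p01 n0 rx gx]]]] := h _ sH H HM 1%N; first by case.
case: p0 p01 rx => [|[|//]] _ rx.
- by have [_ /(congr1 size)] := rx; rewrite size_mkseq => n00; rewrite -n00 in n0.
- by exists n, x.
Qed.

(** A successor average consists of exactly [d (x 0)] averages of the lower order, so shorter runs
    must be prolonged without changing their start. *)
Lemma run_pad g r p N M H n x : (forall A, singletons A -> covers g 1 N M A) ->
  subseqn H M -> (0 < n)%N -> run g p N H n x ->
  exists n' x', [/\ (n <= n')%N, run g (p + r) N H n' x' & x' 0%N = x 0%N].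
Proof.
move=> h HM n0 rx; elim: r => [|r [n' [x' [nn' rx' x'0]]]].
  by exists n, x; rewrite addn0.
have [m [y [m0 ry gy]]] := one_block h (subseqn_tail n' HM).
have [|z [rz _ zx]] := run_cat HM.1 rx' ry.
  move=> i il; have [k Hk] := HM.2 i; rewrite Hk; apply: gy.
  by rewrite -Hk /tail addn0 incr_ltE//; exact: HM.1.
exists (n' + m)%N, z; split; first exact: leq_trans nn' (leq_addr _ _).
  by rewrite -addn1 addnA.
by rewrite zx// (leq_trans n0).
Qed.

(** Discarding the first [p + 1] terms of [N] makes [d (x 0)] exceed [p], so that the [p] averages
    fit into one of the next order; the extra unit allows an empty run to be replaced by one
    average. *)
Lemma coverable_succ g p AA : (al <= g)%O -> coverable g p AA ->
  coverable g 1 singletons -> coverable (osucc g) 1 AA.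
Proof.
move=> ag cp c1 N iN.
have [M0 M0N hp] := cp _ (incr_tail p.+1 iN); have [M MM0 h1] := c1 M0 M0N.1.
exists M; first exact: subseqn_taill (subseqn_trans MM0 M0N).
move=> A AAA H HM j Aj.
have [p0 [n [x [p0p jn [xN bx ex] gx]]]] := hp A AAA H (subseqn_trans HM MM0) j Aj.
have [p1 [n1 [x1 [p1p jn1 r1 [gx1 n10]]]]] : exists p1 n1 x1, [/\ (p1 <= p.+1)%N, (j <= n1)%N,
    run g p1 (tail p.+1 N) H n1 x1 &
    (forall k, (M k < H 0)%N -> (M k < x1 0)%N) /\ (0 < n1)%N].
  have [n0|n0] := posnP n; last first.
    exists p0, n, x; split => //; first exact: leqW.
    by split => // k; have [k' ->] := MM0.2 k; exact: gx.
  have [m [y [m0 [yM b e] gy]]] := one_block h1 HM.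
  exists 1%N, m, y; split => //; first by move: jn; rewrite n0 leqn0 => /eqP ->.
  by split => //; exact: subseqn_trans yM M0N.
have p1d : (p1 <= d (x1 0%N))%N.
  apply: leq_trans p1p (leq_trans _ (incr_ge _ incd)).
  have [[_ /(_ 0%N)[i ->]] _ _] := r1.
  by apply: leq_trans (leq_addr i _) (incr_ge _ iN).
have h1' A' : singletons A' -> covers g 1 (tail p.+1 N) M A'.
  move=> sA'; apply: (covers_le (h1 _ sA')) => //; last by move=> y yM; exact: subseqn_trans yM M0N.
  by apply: subseqn_refl; exact: MM0.1.
have [n2 [x2 [n12 r2 x20]]] := run_pad (d (x1 0%N) - p1) h1' HM n10 r1.
rewrite subnKC// -x20 in r2.
exists 1%N, n2, x2; split => //.
- exact: leq_trans jn1 n12.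
- have [x2N b2 e2] := run_succ ag r2; split => //; exact: subseqn_taill x2N.
- by rewrite x20.
Qed.

(** Thinning [M] to its odd places leaves [M (2 k0)] free just before [H 0 = M (2 k0 + 1)]. This
    term serves as the index of the limit step, and fusion has prepared coverings of the order that
    it prescribes. *)
Lemma coverable_limit g b0 AA : is_limit g -> (al <= b0)%O -> (b0 < g)%O ->
  (forall b, (b0 <= b)%O -> (b < g)%O -> coverable b 1 AA) -> coverable g 1 AA.
Proof.
move=> lg ab b0g IH N iN; have [n0 n0P] := assoc_cofinal hs lg b0g.
pose sgd i := s g (d i).
have sgd_lt i : (sgd i < g)%O by apply: assoc_lt.
have b0sgd i : (n0 <= i)%N -> (b0 <= sgd i)%O.
  by move=> ni; apply: n0P; apply: leq_trans ni (incr_ge _ incd).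
pose N1 := tail n0 N; have N1N : subseqn N1 N by exact/subseqn_tail/subseqn_refl.
have N1ge i : (n0 <= N1 i)%N by apply: leq_trans (leq_addr i _) (incr_ge _ iN).
have [||M MN1 MP] := @fusion (fun i M => (n0 <= i)%N -> exists N', [/\ subseqn N' N,
    (i < N' 0)%N & forall A, AA A -> covers (sgd i) 1 N' M A]) N1 N1N.1.
- move=> i M M' h M'M /h[N' [N'N iN' hN']]; exists N'; split => // A AAA.
  exact: covers_le (hN' A AAA) (leqnn _) M'M _ _.
- move=> i M MN1; have [ni|ni] := leqP n0 i; last first.
    by exists M => //; apply: subseqn_refl; exact: MN1.1.
  have [M' M'M hM'] := IH _ (b0sgd i ni) (sgd_lt i) _ (incr_tail i.+1 MN1.1).
  exists M' => [|_]; first exact: subseqn_taill M'M.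
  exists (tail i.+1 M); split => //; first exact: subseqn_tail (subseqn_trans MN1 N1N).
  by apply: incr_after; exact: MN1.1.
have iM := MN1.1.
have Mge i : (n0 <= M i)%N by have [k ->] := MN1.2 i; exact: N1ge.
pose M2 i := M (i.*2.+1).
have M2M : subseqn M2 M.
  split => i; last by exists i.*2.+1.
  by rewrite /M2 incr_ltE// ltnS doubleS ltnS.
exists M2; first exact: subseqn_trans M2M (subseqn_trans MN1 N1N).
move=> A AAA H HM2 j Aj; have [k0 Hk0] := HM2.2 0%N.
have HM : subseqn H (tail k0.*2.+1 M).
  apply: subseqn_after => //; first exact: subseqn_trans HM2 M2M.
  by rewrite Hk0 incr_ltE.
have [N' [N'N kN' hN']] := MP k0.*2 (Mge _).
have [p0 [n [x [p01 jn [xN' bx ex] _]]]] := hN' A AAA H HM j Aj.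
have [n00|npos] := posnP n.
  exists 0%N, 0%N, (tail (H 0%N).+1 N); split => //.
  - by rewrite -n00.
  - exact: run0.
  - by move=> k; exact: run0_gap.
case: p0 p01 bx ex => [|[|//]] _ bx ex.
  by move: bx => /(congr1 size); rewrite size_mkseq => n00; rewrite -n00 in npos.
set i0 := M k0.*2 in kN' hN' bx ex.
have i0x : (i0 < x 0)%N.
  by apply: leq_trans kN' _; have [i ->] := xN'.2 0%N; exact: incr_le N'N.1 _.
pose z := scat [:: i0] x.
have zS i : z i.+1 = x i by rewrite /z /scat /= subn1.
have z1 : tail 1 z = x by apply/funext => i; rewrite /tail add1n zS.
have agE : (al < g)%O by exact: le_lt_trans ab b0g.
have avz : av g z = unitize z ((true, (d i0)%:R^-1) :: av (sgd i0) x).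
  by rewrite av_limit ?z1//; exact: sgd_lt.
exists 1%N, n, z; split => //.
- split.
  + split => [[|i]|[|i]].
    * by rewrite zS.
    * by rewrite !zS; exact: xN'.1.
    * exact: (subseqn_trans MN1 N1N).2.
    * by rewrite zS; exact: (subseqn_trans xN' N'N).2.
  + by rewrite /= tail0 avz base_indices_rescale /= z1 -bx /= tail0.
  + move=> i; rewrite /= tail0 avz size_unitize /= ltnS; case: i => [_|i il].
      exists 0%N => //; rewrite Hk0; exact/ltnW/iM.
    by have [|i' i'n xi] := ex i; [rewrite /= tail0|exists i' => //; rewrite zS].
- move=> k; rewrite Hk0 /M2 (incr_ltE _ _ iM) ltnS ltn_double => kk.
  by rewrite /z /scat /= /i0 (incr_ltE _ _ iM) -doubleS leq_double.
Qed.

Lemma coverable_singletons g : (al <= g)%O -> coverable g 1 singletons.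
Proof.
elim/omega1_ind : g => g IH; rewrite le_eqVlt => /predU1P[<-|ag].
  exact: coverable_al_singletons.
have [g0|[b gb]|lg] := ordinal_cases g.
- by rewrite g0 lt_ozero in ag.
- rewrite gb in ag IH *; rewrite ltosucc in ag.
  by have h := IH _ (osucc_gt b) ag; exact: (coverable_succ ag h h).
- by apply: (@coverable_limit g al) => // b ab bg; exact: IH.
Qed.

End covers.

(** * Averages small at many points *)

Section evaluations.
Variables (R : realType) (s : omega1 -> nat -> omega1) (kap : omega1).
Variables (G : nat -> Prop) (nrm : {poly R} -> R).
Variable ev : bool -> omega1 -> {poly R} -> R.
Hypothesis hs : associated_sequences s.
Hypothesis HN : block_norm G nrm.
Hypothesis Ginf : forall n, exists2 m, (n <= m)%N & G m.
Hypothesis evZ : forall b t c (p : {poly R}), ev b t (c *: p) = c * ev b t p.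
Hypothesis evD : forall b t (p q : {poly R}), ev b t (p + q) = ev b t p + ev b t q.
Hypothesis ev_le : forall b t (p : {poly R}), (ozero < t)%O -> (t <= kap)%O ->
  `|ev b t p| <= nrm p.
Hypothesis ev_cont : forall b t (p : {poly R}) e, (ozero < t)%O -> (t <= kap)%O -> 0 < e ->
  exists2 a : omega1, (a < t)%O &
  forall u : omega1, (a < u)%O -> (u <= t)%O -> `|ev b u p - ev b t p| < e.
Hypothesis ev_null : forall b t e, (ozero < t)%O -> (t <= kap)%O -> 0 < e ->
  exists n0, forall n, (n0 <= n)%N -> G n -> `|ev b t 'X^n| <= e.
Local Notation Avg := (Avg s G nrm).
Local Notation rank_class := (rank_class kap).

Lemma ev0 b t : ev b t 0 = 0.
Proof. by rewrite -(scale0r 0) evZ mul0r. Qed.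

Lemma ev_sum b t k (p : nat -> {poly R}) :
  ev b t (\sum_(i < k) p i) = \sum_(i < k) ev b t (p i).
Proof. by elim: k => [|k IH]; rewrite ?big_ord0 ?ev0// !big_ord_recr /= evD IH. Qed.

Definition null_on g (F : set omega1) := forall n e, 0 < e -> exists m q p,
  [/\ Avg g m q p, (n < m)%N & forall b t, F t -> `|ev b t p| <= e].

(* The largest strong ordinal is the order of the averages sought. *)
Definition strong g := forall n (F : nat -> set omega1),
  (forall i, (i < n)%N -> rank_class g (F i)) ->
  null_on g [set t | exists2 i, (i < n)%N & F i t].

(** Summands of size [e' 2^-i] add up to at most [2 e'] whatever their number, and normalizing
    multiplies by at most 4; hence [e / 8]. *)
Lemma null_on_succ b F : points kap F -> null_on b F -> null_on (osucc b) F.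
Proof.
move=> pF nb n e e0; pose e' := e / 8; have e'0 : 0 < e' by rewrite /e'; lra.
have /choice[f fP] (iv : nat * nat) : exists u : nat * nat * {poly R},
    [/\ Avg b u.1.1 u.1.2 u.2, (iv.2 < u.1.1)%N &
    forall c t, F t -> `|ev c t u.2| <= e' * 2^-1 ^+ iv.1].
  have [|m [q [p [h1 h2 h3]]]] := nb iv.2 (e' * 2^-1 ^+ iv.1).
    by rewrite mulr_gt0// exprn_gt0// invr_gt0.
  by exists (m, q, p).
pose S := fix S k := f (k, if k is k'.+1 then (S k').1.2 else n).
have SA k : Avg b (S k).1.1 (S k).1.2 (S k).2.
  by case: k => [|k]; [have [] := fP (0%N, n)|have [] := fP (k.+1, (S k).1.2)].
have Se k c t : F t -> `|ev c t (S k).2| <= e' * 2^-1 ^+ k.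
  move=> Ft; case: k => [|k]; first by have [_ _] := fP (0%N, n); exact.
  by have [_ _] := fP (k.+1, (S k).1.2); exact.
have Sq k : ((S k).1.2 < (S k.+1).1.1)%N by have [] := fP (k.+1, (S k).1.2).
have Sn : (n < (S 0%N).1.1)%N by have [] := fP (0%N, n).
have [k kE] : exists k, (S 0%N).1.1 = k.+1 by exists (S 0%N).1.1.-1; rewrite prednK// (leq_trans _ Sn).
have h1 : forall i, (i < k.+1)%N -> blk G nrm (S i).1.1 (S i).1.2 (S i).2.
  by move=> i _; exact: (Avg_blk HN (SA i)).
have h2 : forall i, (i < k)%N -> ((S i).1.2 < (S i.+1).1.1)%N by [].
have n4 := nrm_sum_ge HN h1 h2.
exists (S 0%N).1.1, (S k).1.2, ((nrm (\sum_(i < k.+1) (S i).2))^-1 *: \sum_(i < k.+1) (S i).2).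
split => //.
  by apply: (@Avg_succ _ _ _ _ b k (fun i => (S i).1.1) (fun i => (S i).1.2) (fun i => (S i).2)).
move=> c t Ft; rewrite evZ (ev_sum c t k.+1 (fun i => (S i).2)) normrM.
set N := nrm _ in n4 *; have N0 : 0 < N by lra.
have h3 : `|\sum_(i < k.+1) ev c t (S i).2| <= 2 * e'.
  apply: le_trans (ler_norm_sum _ _ _) _.
  apply: (@le_trans _ _ (\sum_(i < k.+1) e' * 2^-1 ^+ i)).
    by apply: ler_sum => i _; exact: Se.
  by rewrite -mulr_sumr mulrC ler_wpM2r ?(ltW e'0)// sum_half_pow.
rewrite ger0_norm ?invr_ge0 ?(ltW N0)//.
have -> : e = 4 * (2 * e') by rewrite /e'; lra.
apply: ler_pM => //; first by rewrite invr_ge0 ltW.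
by rewrite -[leRHS]invrK lef_pV2 ?posrE ?invr_gt0//; lra.
Qed.

Lemma inv_nat_small (e : R) : 0 < e -> exists n0, forall n, (n0 <= n)%N -> n%:R^-1 <= e.
Proof.
move=> e0; have e1 : 0 <= e^-1 by rewrite invr_ge0 ltW.
exists (Num.bound e^-1).+1 => n nn; have := archi_boundP e1 => h.
rewrite -[leRHS]invrK lef_pV2 ?posrE ?invr_gt0 ?ltr0n//; last exact: leq_ltn_trans nn.
by apply: ltW; apply: lt_le_trans h _; rewrite ler_nat; exact: ltnW.
Qed.

(** Far out, [1/l] is small and the order [s g l] is at least [al]; two terms of size [e'] and a
    normalizing factor at most 4 give [8 e' = e]. *)
Lemma null_on_limit al g F : points kap F -> is_limit g -> (al < g)%O ->
  (forall b, (al <= b)%O -> (b < g)%O -> null_on b F) -> null_on g F.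
Proof.
move=> pF lg ag IH n e e0; pose e' := e / 8; have e'0 : 0 < e' by rewrite /e'; lra.
have [n0 n0P] := assoc_cofinal hs lg ag; have [n1 n1P] := inv_nat_small e'0.
have [l ln Gl] := Ginf (n.+1 + n0 + n1).
have l1 := good_gt1 HN Gl.
have [||m [q [p [pA lm pe]]]] := IH (s g l) _ _ l e' e'0.
- by apply: n0P; lia.
- by apply: assoc_lt => //; lia.
exists l, q, ((nrm (l%:R^-1 *: 'X^l + p))^-1 *: (l%:R^-1 *: 'X^l + p)); split.
- exact: Avg_limit pA.
- by lia.
move=> b t Ft; have [t0 tk] := pF _ Ft; have n4 := nrm_limit_ge HN Gl lm (Avg_blk HN pA).
set N := nrm _ in n4 *; have N0 : 0 < N by lra.
rewrite evZ evD evZ normrM ger0_norm ?invr_ge0 ?(ltW N0)//.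
have -> : e = 4 * (e' + e') by rewrite /e'; lra.
apply: ler_pM => //; first by rewrite invr_ge0 ltW.
  by rewrite -[leRHS]invrK lef_pV2 ?posrE ?invr_gt0//; lra.
apply: le_trans (ler_normD _ _) _; apply: lerD; last exact: pe.
rewrite normrM ger0_norm ?invr_ge0//.
apply: (@le_trans _ _ (l%:R^-1 * 1)); last by rewrite mulr1 n1P//; lia.
by rewrite ler_wpM2l ?invr_ge0// -(nrmX HN Gl) ev_le.
Qed.

Lemma null_on_le al g F : points kap F -> (al <= g)%O -> null_on al F -> null_on g F.
Proof.
move=> pF + nal; elim/omega1_ind : g => g IH; rewrite le_eqVlt => /predU1P[<-//|ag].
have [g0|[b gb]|lg] := ordinal_cases g.
- by rewrite g0 lt_ozero in ag.
- rewrite gb in ag IH *; rewrite ltosucc in ag.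
  exact: null_on_succ pF (IH _ (osucc_gt b) ag).
- by apply: (@null_on_limit al g) => // b ab bg; exact: IH.
Qed.

Lemma union_points g n (F : nat -> set omega1) :
  (forall i, (i < n)%N -> rank_class g (F i)) ->
  points kap [set t | exists2 i, (i < n)%N & F i t].
Proof. by move=> h t [i /h[_ pF _] /pF]. Qed.

(** Sets of class 0 are finite, so pointwise convergence to 0 is uniform on them. *)
Lemma strong0 : strong ozero.
Proof.
move=> n F hF.
have [P PF] : exists P : seq omega1, forall i t, (i < n)%N -> F i t -> t \in P.
  elim: n F hF => [|n IH] F hF; first by exists [::].
  have [P hP] := IH F (fun i h => hF i (ltnW h)).
  have [Q hQ] := rank_class0 (hF n (ltnSn n)).
  exists (P ++ Q) => i t; rewrite ltnS leq_eqVlt mem_cat.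
  by move=> /predU1P[-> /hQ ->|i_n /(hP _ _ i_n) ->]; rewrite ?orbT.
move=> v e e0.
have /choice[n0 n0P] t : exists n0, (ozero < t)%O -> (t <= kap)%O ->
    forall m b, (n0 <= m)%N -> G m -> `|ev b t 'X^m| <= e.
  have [[t0 tk]|nt] := pselect ((ozero < t)%O /\ (t <= kap)%O); last first.
    by exists 0%N => t0 tk; exfalso; apply: nt.
  have [n1 h1] := ev_null true t0 tk e0; have [n2 h2] := ev_null false t0 tk e0.
  exists (n1 + n2)%N => _ _ m [] nm Gm; [apply: h1|apply: h2] => //; lia.
have [m mn Gm] := Ginf (v.+1 + \max_(t <- P) n0 t).
exists m, m, 'X^m; split; [exact: Avg_zero|lia|].
move=> b t [i i_n Ft]; have [t0 tk] := union_points hF (ex_intro2 _ _ i i_n Ft).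
apply: n0P => //; apply: leq_trans (leq_trans (leq_addl _ _) mn).
by apply: (@leq_bigmax_seq _ P xpredT n0) => //; exact: PF Ft.
Qed.

(** Finitely many sets of a limit class share a smaller class, and smallness of averages passes to
    higher orders by [null_on_le]. *)
Lemma strong_limit g : is_limit g ->
  (forall b, (b < g)%O -> exists2 c : omega1, (b <= c)%O & (c < g)%O /\ strong c) -> strong g.
Proof.
move=> lg h n F hF.
have [b bg hb] : exists2 b : omega1, (b < g)%O & forall i, (i < n)%N -> rank_class b (F i).
  elim: n F hF => [|n IH] F hF; first by exists ozero => //; exact: is_limit_gt0.
  have [b bg hb] := IH F (fun i h => hF i (ltnW h)).
  have [c cg hc] := rank_class_limit lg (hF n (ltnSn n)).
  exists (Order.max b c); first by rewrite gt_max bg.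
  move=> i; rewrite ltnS leq_eqVlt => /predU1P[->|i_n].
    by apply: rank_class_le hc; rewrite le_max lexx orbT.
  by apply: rank_class_le (hb i i_n); rewrite le_max lexx.
have [c bc [cg sc]] := h b bg.
apply: (@null_on_le c) => //; [exact: union_points hF|exact: ltW|].
by apply: sc => i /hb; exact: rank_class_le.
Qed.

Lemma strong_max xi : exists al, [/\ (al <= xi)%O, strong al &
  forall b, (b <= xi)%O -> strong b -> (b <= al)%O].
Proof.
pose A := [set g : omega1 | (g <= xi)%O /\ strong g].
have cA : countable A.
  by apply: (sub_countable _ (countable_below xi)); apply: subset_card_le => a [].
have A0 : A ozero by split; [exact: ozero_le|exact: strong0].
have Axi : (osup A <= xi)%O by apply: osup_le => // a [].
exists (osup A); split => //; last by move=> b bx sb; apply: osup_ub.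
apply: contrapT => ns.
have lt_A a : A a -> (a < osup A)%O.
  move=> Aa; rewrite lt_neqAle osup_ub// andbT; apply/eqP => aE.
  by apply: ns; rewrite -aE; exact: Aa.2.
have lA : is_limit (osup A).
  have [A_0|[b ob]|//] := ordinal_cases (osup A).
    by have := lt_A _ A0; rewrite A_0 ltxx.
  have [|a Aa ba] := @lt_osup A b; first by rewrite ob osucc_gt.
  by have := lt_A _ Aa; rewrite ob ltosucc leNgt ba.
apply: ns; apply: strong_limit => // b bA.
have [a Aa ba] := lt_osup bA; exists a; first exact: ltW.
by split; [exact: lt_A|exact: Aa.2].
Qed.

Definition small_base (w : nat -> {poly R}) g := forall F, rank_class g F ->
  exists n0, forall n, (n0 <= n)%N -> forall b t, F t -> `|ev b t (w n)| < 2^-1 ^+ n.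

Lemma strong_base al : strong al -> exists d q w,
  [/\ forall i, Avg al (d i) (q i) (w i), forall i, (q i < d i.+1)%N,
      forall i, (4 ^ i <= d i)%N & small_base w al].
Proof.
move=> sal; have [C [hC CF]] := rank_class_family kap al.
(* The bound [2^-(n+1)] leaves room for the strict inequality of [small_base]; starting beyond
   [4^n + v] gives both the growth of [d] and successive supports. *)
have /choice[f fP] (nv : nat * nat) : exists u : nat * nat * {poly R},
    [/\ Avg al u.1.1 u.1.2 u.2, (4 ^ nv.1 + nv.2 < u.1.1)%N &
    forall c t, (exists2 i, (i < nv.1)%N & C i t) -> `|ev c t u.2| <= 2^-1 ^+ nv.1.+1].
  have [|m [q [p [h1 h2 h3]]]] := sal nv.1 C (fun i _ => hC i) (4 ^ nv.1 + nv.2)%N (2^-1 ^+ nv.1.+1).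
    by rewrite exprn_gt0// invr_gt0.
  by exists (m, q, p).
pose S := fix S k := f (k, if k is k'.+1 then (S k').1.2 else 0%N).
have SE k : exists v, S k = f (k, v) by case: k => [|k]; [exists 0%N|exists (S k).1.2].
exists (fun k => (S k).1.1), (fun k => (S k).1.2), (fun k => (S k).2); split => [k|k|k|F hF].
- by have [v ->] := SE k; have [] := fP (k, v).
- by have [_ h _] := fP (k.+1, (S k).1.2); move: h => /=; lia.
- by have [v ->] := SE k; have [_ h _] := fP (k, v); move: h => /=; lia.
have [n0 h0] := CF F hF; exists n0 => n n0n b t /h0[k kn Ct].
have [v ->] := SE n; have [_ _ h] := fP (n, v).
apply: le_lt_trans (h b t _) _; first by exists k => //=; exact: leq_trans n0n.
by rewrite /= exprS gtr_pMl ?exprn_gt0 ?invr_gt0//; lra.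
Qed.

End evaluations.

(** * Coverings of the sets of large values *)

Section core.
Variables (R : realType) (s : omega1 -> nat -> omega1) (kap : omega1).
Variables (G : nat -> Prop) (nrm : {poly R} -> R).
Variable ev : bool -> omega1 -> {poly R} -> R.
Hypothesis hs : associated_sequences s.
Hypothesis HN : block_norm G nrm.
Hypothesis Ginf : forall n, exists2 m, (n <= m)%N & G m.
Hypothesis evZ : forall b t c (p : {poly R}), ev b t (c *: p) = c * ev b t p.
Hypothesis evD : forall b t (p q : {poly R}), ev b t (p + q) = ev b t p + ev b t q.
Hypothesis ev_le : forall b t (p : {poly R}), (ozero < t)%O -> (t <= kap)%O ->
  `|ev b t p| <= nrm p.
Hypothesis ev_cont : forall b t (p : {poly R}) e, (ozero < t)%O -> (t <= kap)%O -> 0 < e ->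
  exists2 a : omega1, (a < t)%O &
  forall u : omega1, (a < u)%O -> (u <= t)%O -> `|ev b u p - ev b t p| < e.
Hypothesis ev_null : forall b t e, (ozero < t)%O -> (t <= kap)%O -> 0 < e ->
  exists n0, forall n, (n0 <= n)%N -> G n -> `|ev b t 'X^n| <= e.
Local Notation Avg := (Avg s G nrm).
Local Notation rank_class := (rank_class kap).

Section base.
Variables (al : omega1) (d q : nat -> nat) (w : nat -> {poly R}).
Hypothesis wA : forall i, Avg al (d i) (q i) (w i).
Hypothesis qd : forall i, (q i < d i.+1)%N.
Hypothesis d4 : forall i, (4 ^ i <= d i)%N.
Hypothesis sb : small_base kap ev w al.
Local Notation av := (av s nrm al d w).
Local Notation comb := (comb d w).
Implicit Types (t u : omega1) (sg eta e a : R) (l : seq (bool * R)) (F : set omega1).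
Local Notation coverable := (coverable s nrm al d w).
Local Notation av_spec := (av_spec s G nrm al d w).

Let incd : incr d := incr_d HN wA qd.

Let d_gt0 i : (0 < d i)%N.
Proof. by apply: leq_trans (d4 i); rewrite expn_gt0. Qed.

Definition large_at t : set nat := [set i | exists b, 2^-1 ^+ i <= `|ev b t (w i)|].

Definition large_family (F : set omega1) : set (set nat) := [set large_at t | t in F].

Lemma not_large t i b : ~ large_at t i -> `|ev b t (w i)| < 2^-1 ^+ i.
Proof. by move=> h; rewrite ltNge; apply/negP => h'; apply: h; exists b. Qed.

Lemma coverable_small g F : rank_class al F -> coverable g 0 (large_family F).
Proof.
move=> /sb[n0 h]; apply: (@coverable_avoid _ _ _ _ _ _ _ _ n0) => _ i [t Ft <-] [b hb].
by rewrite ltnNge; apply/negP => /h/(_ b t Ft); rewrite ltNge hb.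
Qed.

(** Upper semicontinuity: the strict inequalities expressing that [k] is not large at [t] persist on
    a neighbourhood. *)
Lemma large_nbhs1 t k : (ozero < t)%O -> (t <= kap)%O -> exists2 a : omega1, (a < t)%O &
  forall u : omega1, (a < u)%O -> (u <= t)%O -> large_at u k -> large_at t k.
Proof.
move=> t0 tk; have [tl|ntl] := pselect (large_at t k); first by exists ozero.
have h b : exists2 a : omega1, (a < t)%O & forall u : omega1, (a < u)%O -> (u <= t)%O ->
    `|ev b u (w k)| < 2^-1 ^+ k.
  have e0 : 0 < 2^-1 ^+ k - `|ev b t (w k)| by rewrite subr_gt0; exact: not_large.
  have [a at' ha] := ev_cont b (w k) t0 tk e0; exists a => // u au ut.
  have := ha u au ut; rewrite ltrBrDr; apply: le_lt_trans.
  by rewrite -[X in `|X| <= _](subrK (ev b t (w k))) ler_normD.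
have [a1 a1t h1] := h true; have [a2 a2t h2] := h false.
exists (Order.max a1 a2); first by rewrite gt_max a1t.
move=> u; rewrite gt_max => /andP[a1u a2u] ut [b]; rewrite leNgt => /negP[].
by case: b; [exact: h1|exact: h2].
Qed.

Lemma large_nbhs t i : (ozero < t)%O -> (t <= kap)%O -> exists2 a : omega1, (a < t)%O &
  forall u : omega1, (a < u)%O -> (u <= t)%O -> forall k, (k <= i)%N ->
  large_at u k -> large_at t k.
Proof.
move=> t0 tk; elim: i => [|i [a at' IH]].
  have [a at' h] := large_nbhs1 0%N t0 tk.
  by exists a => // u au ut k; rewrite leqn0 => /eqP ->; exact: h.
have [a' at'' h] := large_nbhs1 i.+1 t0 tk.
exists (Order.max a a'); first by rewrite gt_max at'.
move=> u; rewrite gt_max => /andP[au a'u] ut k.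
by rewrite leq_eqVlt => /predU1P[->|/IH]; [exact: h|exact].
Qed.

(** Near [t], an index up to [i] is large only if it is large at [t]; a point of [F'] that dominates
    [t] therefore dominates its neighbours too. *)
Lemma oclosed_away (F F' : set omega1) i : oclosed kap F -> F' `<=` F ->
  oclosed kap [set t | F t /\ ~ exists2 u, F' u & forall k, (k <= i)%N -> large_at t k -> large_at u k].
Proof.
move=> cF F'F t t0 tk /= nt.
have [Ft|nFt] := pselect (F t); last first.
  by have [a at' h] := cF t t0 tk nFt; exists a => // u au ut [/(h u au ut)].
have [v F'v hv] : exists2 u, F' u & forall k, (k <= i)%N -> large_at t k -> large_at u k.
  by apply: contrapT => h; apply: nt.
have [a at' ha] := large_nbhs i t0 tk; exists a => // u au ut [Fu]; apply.
by exists v => // k ki /(ha u au ut k ki); exact: hv.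
Qed.

(* The points of [F] outside a neighbourhood of [F'] form a closed set, to which
   the induction hypothesis applies. *)
Lemma coverable_closed_step g p p' (F F' : set omega1) : (al <= g)%O ->
  oclosed kap F -> F' `<=` F -> coverable g p (large_family F') ->
  (forall F2, oclosed kap F2 -> F2 `<=` F -> (forall t, F2 t -> ~ F' t) ->
    coverable g p' (large_family F2)) ->
  coverable g (p + 1 + p') (large_family F).
Proof.
move=> ag cF F'F cp cp'; apply: (coverable_step d_gt0 cp).
  exact: coverable_singletons.
move=> i; pose F2 := [set t | F t /\ ~ exists2 u, F' u &
    forall k, (k <= i)%N -> large_at t k -> large_at u k].
apply: (@coverable_sub _ _ _ _ _ _ _ _ (large_family F2)).
  apply: cp'; [exact: oclosed_away|by move=> t []|move=> t [_ nF' F't]].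
  by apply: nF'; exists t.
move=> _ [[t Ft <-] nA]; exists t => //; split => // -[u F'u hu].
by apply: nA; exists (large_at u) => //; exists u.
Qed.

(** The points with ranks in the highest interval form a closed set of class [g], covered by one
    average; one more crosses to the other points, whose ranks fill one interval less. This makes
    two averages per interval. *)
Lemma coverable_iter g m th (F : set omega1) : (al <= g)%O ->
  (forall F, rank_class g F -> coverable g 1 (large_family F)) ->
  oclosed kap F -> points kap F ->
  (forall t, F t -> (th <= rk t)%O /\ (rk t < iter m (oadd^~ (wexp g)) th)%O) ->
  coverable g (m * 2) (large_family F).
Proof.
move=> ag h; elim: m F => [|m IH] F cF pF hF.
  have F0 t : ~ F t by move=> /hF[h1 /= h2]; move: h1; rewrite leNgt h2.
  by apply: (@coverable_avoid _ _ _ _ _ _ _ _ 0%N) => A i [t /F0].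
pose F' := F `&` [set t | (iter m (oadd^~ (wexp g)) th <= rk t)%O].
rewrite mulSn (_ : 2 + m * 2 = 1 + 1 + m * 2)%N//.
apply: (@coverable_closed_step g _ _ F F') => //; first by move=> t [].
  apply: h; split.
  - by apply: oclosedI => //; exact: oclosed_rk_ge.
  - by move=> t [/pF].
  - by exists (iter m (oadd^~ (wexp g)) th) => t [/hF[_ ?] /= ?].
move=> F2 cF2 F2F F2F'; apply: IH => //; first by move=> t /F2F/pF.
move=> t F2t; have [h1 h2] := hF _ (F2F _ F2t); split => //.
by rewrite ltNge; apply/negP => h3; apply: (F2F' t F2t); split => //; exact: F2F.
Qed.

Lemma coverable_class g (F : set omega1) : (al <= g)%O -> rank_class g F ->
  coverable g 1 (large_family F).
Proof.
elim/omega1_ind : g F => g IH F; rewrite le_eqVlt => /predU1P[<-|ag] cF.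
  move=> N iN; have [M MN hM] := @coverable_small al F cF N iN; exists M => // A /hM hA.
  by apply: (covers_le hA) => //; apply: subseqn_refl; exact: MN.1.
have [g0|[b gb]|lg] := ordinal_cases g.
- by rewrite g0 lt_ozero in ag.
- rewrite gb in ag IH cF *; rewrite ltosucc in ag.
  have [th [m hF]] := rank_class_succ cF; have [c1 p1 _] := cF.
  apply: (coverable_succ incd d_gt0 ag (p := m * 2)); last exact: coverable_singletons.
  apply: (@coverable_iter b m th) => //.
  by move=> F'; apply: IH => //; exact: osucc_gt.
- have [b bg cb] := rank_class_limit lg cF.
  apply: (@coverable_limit _ _ _ _ _ _ hs incd d_gt0 g (Order.max al b)) => //.
  + by rewrite le_max lexx.
  + by rewrite gt_max ag.
  + move=> c; rewrite ge_max => /andP[ac bc] cg; apply: IH => //.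
    exact: rank_class_le cb.
Qed.

(** Compared with [coverable_class], the order drops strictly below the class, at the price of a
    larger number of averages. *)
Lemma coverable_below_class g (F : set omega1) : (al < g)%O -> rank_class g F ->
  exists b p, [/\ (al <= b)%O, (b < g)%O & coverable b p (large_family F)].
Proof.
move=> ag cF; have [g0|[b gb]|lg] := ordinal_cases g.
- by rewrite g0 lt_ozero in ag.
- rewrite gb in ag cF *; rewrite ltosucc in ag.
  have [th [m hF]] := rank_class_succ cF; have [c1 p1 _] := cF.
  exists b, (m * 2)%N; split; rewrite ?osucc_gt//.
  by apply: (@coverable_iter b m th) => // F'; exact: coverable_class.
- have [b bg cb] := rank_class_limit lg cF.
  exists (Order.max al b), 1%N; split; first by rewrite le_max lexx.
    by rewrite gt_max ag.
  apply: coverable_class; first by rewrite le_max lexx.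
  by apply: rank_class_le cb; rewrite le_max lexx orbT.
Qed.

(** Ranks below [kap] are smaller than [w^xi], so closed sets avoiding [kap] are of class [xi] and
    need one average. The point [kap] alone needs none, and the crossing needs one. *)
Lemma coverable_whole xi : kap = wexp (wexp xi) -> (al <= xi)%O ->
  coverable xi 2 (large_family [set t : omega1 | (ozero < t)%O /\ (t <= kap)%O]).
Proof.
move=> kE ax; have k0 : (ozero < kap)%O by rewrite kE wexp_gt0.
have c_itv : oclosed kap [set t : omega1 | (ozero < t)%O /\ (t <= kap)%O].
  exact: oclosed_itv.
have ck : rank_class al [set kap].
  split.
  - move=> t t0; rewrite le_eqVlt => /predU1P[->|tk _]; first by case.
    exists ozero => // u u0 ut uk.
    by move: (le_lt_trans ut tk); rewrite uk ltxx.
  - by move=> t ->.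
  - exists (rk kap) => t ->; split => //.
    rewrite -{1}(oaddr0 (rk kap)); apply: oadd_lt; exact: wexp_gt0.
apply: (@coverable_closed_step xi 0 1 _ [set kap]) => //.
- by move=> t ->.
- exact: coverable_small.
- move=> F2 cF2 F2F F2k; apply: coverable_class => //; split => //.
  exists ozero => t F2t; split; first exact: ozero_le.
  have [t0 tk] := F2F _ F2t; rewrite oadd0r.
  apply: (@rk_lt _ ozero) => //; rewrite oadd0r -kE lt_neqAle tk andbT.
  by apply/eqP => h; apply: F2k F2t h.
Qed.

(** * Bounds on sums of values from coverings *)

Lemma ev_entry_le b t c i : (ozero < t)%O -> (t <= kap)%O ->
  `|ev b t (entry d w c i)| <= 1.
Proof. by move=> t0 tk; rewrite -(nrm_entry HN wA c i) ev_le. Qed.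

(** With coefficients in [[eta, 4]], a positive value gains at least [eta] times itself and a
    negative one loses at most 4 times itself; basis vectors have values of modulus at most 1 and
    lose at most the mass. *)
Lemma ev_comb_lower b t sg x l eta : (ozero < t)%O -> (t <= kap)%O -> `|sg| = 1 ->
  0 <= eta -> (forall c, c \in l -> 0 <= c.2 <= 4) ->
  (forall c, c \in l -> ~~ c.1 -> eta <= c.2) ->
  \sum_(i <- base_indices x l) (eta * Num.max 0 (sg * ev b t (w i)) -
     4 * Num.max 0 (- (sg * ev b t (w i)))) - mass l <= sg * ev b t (comb x l).
Proof.
move=> t0 tk sg1 eta0; elim: l x => [|[c r] l IH] x h4 he.
  by rewrite /= big_nil /mass big_nil (ev0 evZ) mulr0 subrr.
have mb c' : c' \in l -> c' \in (c, r) :: l by rewrite inE orbC => ->.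
have := IH (tail 1 x) (fun c' cl => h4 c' (mb c' cl)) (fun c' cl => he c' (mb c' cl)).
have /andP[/= r0 r4] := h4 (c, r) (mem_head _ _).
rewrite /= evD evZ mulrDr.
move: (sg * ev b t (comb (tail 1 x) l)) => E.
case: c h4 he {mb} => h4 he /=; rewrite /mass big_cons /= => IHl.
  have : `|sg * (r * ev b t 'X^(d (x 0%N)))| <= r.
    rewrite normrM sg1 mul1r normrM (ger0_norm r0).
    by rewrite -[leRHS]mulr1 ler_wpM2l//; exact: (@ev_entry_le b t true (x 0%N)).
  by rewrite ler_norml => /andP[h _]; lra.
rewrite big_cons; have er := he (false, r) (mem_head _ _) isT; rewrite /= in er.
rewrite mulrCA; move: (sg * ev b t (w (x 0%N))) => v.
have : eta * Num.max 0 v - 4 * Num.max 0 (- v) <= r * v.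
  have [v0|v0] := leP 0 v.
    by rewrite max_l ?oppr_le0// mulr0 subr0 ler_wpM2r.
  rewrite max_r ?oppr_ge0 ?(ltW v0)//; nra.
by rewrite /=; lra.
Qed.

Lemma ev_comb_upper b t x l e : (ozero < t)%O -> (t <= kap)%O ->
  (forall c, c \in l -> 0 <= c.2) -> (forall c, c \in l -> ~~ c.1 -> c.2 <= e) ->
  `|ev b t (comb x l)| <= e * (\sum_(i <- base_indices x l) `|ev b t (w i)|) + mass l.
Proof.
move=> t0 tk; elim: l x => [|[c r] l IH] x h0 he.
  by rewrite /= big_nil /mass big_nil (ev0 evZ) normr0 mulr0 addr0.
have mb c' : c' \in l -> c' \in (c, r) :: l by rewrite inE orbC => ->.
have := IH (tail 1 x) (fun c' cl => h0 c' (mb c' cl)) (fun c' cl => he c' (mb c' cl)).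
have /= r0 := h0 (c, r) (mem_head _ _).
rewrite /= evD evZ; set E := ev b t (comb (tail 1 x) l).
have := ler_normD (r * ev b t (entry d w c (x 0%N))) E; rewrite normrM (ger0_norm r0).
case: c h0 he {mb} => h0 he /=; rewrite /mass big_cons /= => h1 IHl.
  have := @ev_entry_le b t true (x 0%N) t0 tk; rewrite /= => h2.
  have : r * `|ev b t 'X^(d (x 0%N))| <= r * 1 by rewrite ler_wpM2l.
  by lra.
rewrite big_cons mulrDr; have re := he (false, r) (mem_head _ _) isT; rewrite /= in re.
have : r * `|ev b t (w (x 0%N))| <= e * `|ev b t (w (x 0%N))| by rewrite ler_wpM2r.
by rewrite /=; lra.
Qed.

Lemma sum_base_indices_le (f : nat -> R) x (l : seq (bool * R)) : (forall i, 0 <= f i) ->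
  \sum_(i <- base_indices x l) f i <= \sum_(j < size l) f (x j).
Proof.
move=> f0; elim: l x => [|[c r] l IH] x; first by rewrite big_nil big_ord0.
rewrite big_ord_recl; have := IH (tail 1 x).
have -> : \sum_(j < size l) f (tail 1 x j) = \sum_(j < size l) f (x (lift ord0 j)).
  by apply: eq_bigr => i _; rewrite lift0.
by have := f0 (x 0%N); case: c => /=; rewrite ?big_cons; lra.
Qed.

Lemma sum_mono (f : nat -> R) m n : (forall i, 0 <= f i) -> (m <= n)%N ->
  \sum_(i < m) f i <= \sum_(i < n) f i.
Proof.
move=> f0 mn; rewrite -(subnKC mn) big_split_ord /= lerDl.
by rewrite sumr_ge0.
Qed.

Lemma sum_subseq_le (f : nat -> R) M x C : (forall i, 0 <= f i) -> incr M -> subseqn x M ->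
  (forall n, \sum_(i < n) f (M i) <= C) -> forall n, \sum_(i < n) f (x i) <= C.
Proof.
move=> f0 iM [ix xM] hC n; have /choice[h hh] := xM.
have ih : incr h by move=> i; rewrite -(incr_ltE _ _ iM) -!hh; exact: ix.
apply: le_trans (hC (h n)); elim: n => [|n IH]; first by rewrite big_ord0 sumr_ge0.
rewrite big_ord_recr /= hh; apply: (@le_trans _ _ (\sum_(i < (h n).+1) f (M i))).
  by rewrite big_ord_recr /= lerD2r.
by apply: (@sum_mono (f \o M)); [move=> i /=|exact: ih].
Qed.

Lemma rank_class_pt g t : (ozero < t)%O -> (t <= kap)%O -> rank_class g [set t].
Proof.
move=> t0 tk; split.
- move=> u u0 uk ut; have [tu|ut'] := ltP t u.
    by exists t => // v tv _ vt; rewrite vt ltxx in tv.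
  exists ozero => // v _ vu vt; apply: ut; apply/eqP.
  by rewrite eq_le ut' -vt.
- by move=> u ->.
- exists (rk t) => u ->; split => //.
  by rewrite -{1}(oaddr0 (rk t)); apply: oadd_lt; exact: wexp_gt0.
Qed.

Lemma ev_blocks_le b t g x p : (ozero < t)%O -> (t <= kap)%O ->
  (forall k, nrm (comb (tail k x) (av g (tail k x))) = 1) ->
  `|ev b t (comb x (blocks (av g) p x))| <= p%:R.
Proof.
move=> t0 tk h1; rewrite comb_blocks.
rewrite (ev_sum evZ evD b t p (fun i => comb (tail (size (blocks (av g) i x)) x)
  (av g (tail (size (blocks (av g) i x)) x)))).
apply: le_trans (ler_norm_sum _ _ _) _.
rewrite -[leRHS]mulr_natl mulr1 -[X in _ <= X%:R]card_ord -sumr_const.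
by apply: ler_sum => i _; rewrite -(h1 (size (blocks (av g) i x))) ev_le.
Qed.

(** For fixed [t] and sign, at most [p] averages cover the places [J] of large values of this sign.
    Their combination has value at most [p] at [t], while coefficients at least [eta] make it at
    least [eta] times the sum over [J], up to a bounded error. *)
Lemma sum_bound g p (F : set omega1) N a eta : points kap F ->
  coverable g p (large_family F) -> (forall x, subseqn x N -> av_spec g x a 1) ->
  (forall x c, subseqn x N -> c \in av g x -> ~~ c.1 -> eta <= c.2) ->
  0 < eta -> incr N -> exists2 M, subseqn M N & exists C, forall b t, F t ->
  forall n, \sum_(i < n) `|ev b t (w (M i))| <= C.
Proof.
move=> pF cov sN eN eta0 iN; have [M MN hM] := cov N iN.
(* Values that are not large cost the covering averages at most [4 * 2 = 8] and the mass costs at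
   most 2, whence 10; the final 2 bounds the sum of the thresholds. Each sign takes one [C]. *)
exists M => //; pose C := (p%:R + 10) / eta + 2; exists (C + C) => b t Ft n.
have [t0 tk] := pF _ Ft; have iM := MN.1.
suff h sg : `|sg| = 1 -> \sum_(i < n) Num.max 0 (sg * ev b t (w (M i))) <= C.
  have h1 := h 1 (normr1 _); have h2 := h (-1) (normrN1 _).
  apply: le_trans (lerD h1 h2); rewrite -big_split /=; apply: ler_sum => i _.
  rewrite mul1r mulN1r; set v := ev _ _ _.
  have v1 : v <= Num.max 0 v by rewrite le_max lexx orbT.
  have v2 : - v <= Num.max 0 (- v) by rewrite le_max lexx orbT.
  have v3 : 0 <= Num.max 0 v by rewrite le_max lexx.
  have v4 : 0 <= Num.max 0 (- v) by rewrite le_max lexx.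
  by rewrite ler_norml; apply/andP; split; lra.
move=> sg1; pose v i := sg * ev b t (w i).
have vE i : `|v i| = `|ev b t (w i)| by rewrite normrM sg1 mul1r.
pose inJ i := `[< large_at t (M i) >] && (0 <= v (M i)).
pose J := [seq i <- iota 0 n | inJ i].
(* A single point is of class [al], so its large places are bounded; the covering averages, which
   may go past [J], can be fed with places [gg] that are not large. *)
have [n0 n0P] := sb (rank_class_pt al t0 tk).
have [k|gg igg ggP] := @infinite_enum (fun i => (n <= i)%N /\ ~ large_at t (M i)).
  exists (k + n + n0)%N; first by lia.
  split; first by lia.
  move=> [b']; apply/negP; rewrite -ltNge; apply: n0P => //.
  by apply: leq_trans (incr_ge _ iM); lia.
pose K := scat J gg.
have JP i : (i < size J)%N -> inJ (nth 0%N J i) /\ (nth 0%N J i < n)%N.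
  by move=> /(mem_nth 0%N); rewrite mem_filter mem_iota add0n => /andP[-> /andP[]].
have KJ i : (i < size J)%N -> K i = nth 0%N J i by move=> il; rewrite /K /scat il.
have Kg i : K (size J + i)%N = gg i.
  by rewrite /K /scat ltnNge leq_addr /= addKn.
have iK : incr K.
  move=> i; have [il|il] := ltnP i.+1 (size J).
    rewrite !KJ//; last exact: ltnW.
    have sJ : sorted ltn J by apply: sorted_filter; [exact: ltn_trans|exact: iota_ltn_sorted].
    by have /(sortedP 0%N) := sJ; exact.
  rewrite leq_eqVlt in il; case/predU1P : il => [il|il].
    rewrite KJ ?il// -[i.+1]addn0 -il Kg.
    by have [|_ h] := JP i; [rewrite il|apply: leq_trans h (ggP 0%N).1].
  by have := igg (i - size J)%N; rewrite -!Kg addnS subnKC.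
pose H i := M (K i).
have HM : subseqn H M by split => i; [rewrite /H incr_ltE|exists (K i)].
have tF : large_family F (large_at t) by exists t.
have [|p0 [nn [x [p0p Jnn [xN bx ex] _]]]] := hM _ tF H HM (size J).
  by move=> i il; have [/andP[/asboolP h _] _] := JP i il; rewrite /H KJ.
set l := blocks (av g) p0 x in bx ex.
have xNk k : subseqn (tail k x) N by exact: subseqn_tail.
have lmem c : c \in l -> 0 <= c.2 <= 4 /\ (~~ c.1 -> eta <= c.2).
  move=> cl; have [i _ ci] := mem_blocks cl; split; last by move=> c1; exact: (eN _ _ (xNk _)) ci c1.
  by apply: (av_spec_le4 HN wA qd (xNk _).1 (sN _ (xNk _))) ci.
have lower := @ev_comb_lower b t sg x l eta t0 tk sg1 (ltW eta0)
  (fun c cl => (lmem c cl).1) (fun c cl => (lmem c cl).2).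
have upper : sg * ev b t (comb x l) <= p%:R.
  apply: le_trans (ler_norm _) _; rewrite normrM sg1 mul1r.
  apply: (@le_trans _ _ p0%:R); last by rewrite ler_nat.
  apply: ev_blocks_le => // k.
  by have [[Q _ /(Avg_blk HN)[]]] := sN _ (xNk k).
have ml : mass l <= 2.
  have := mass_blocks_le HN p0 sN ltr01 xN; rewrite -/l mulr1 => /le_trans; apply.
  by rewrite -[leRHS]mulr1 ler_wpM2l// -(expr0 2^-1); exact: half_pow_le.
pose phi i := eta * Num.max 0 (v i) - 4 * Num.max 0 (- v i).
have sphi : \sum_(i <- base_indices x l) phi i =
    \sum_(i < size J) phi (H i) + \sum_(i < nn - size J) phi (H (size J + i)%N).
  rewrite bx /mkseq big_map -{1}(subn0 nn) -/(index_iota 0 nn) -{1}(subnKC Jnn).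
  by rewrite big_mkord big_split_ord.
have s1 : \sum_(i < size J) phi (H i) = eta * \sum_(i < n | inJ i) v (M i).
  have -> : \sum_(i < n | inJ i) v (M i) = \sum_(i < size J) v (M (nth 0%N J i)).
    rewrite -(big_mkord inJ (fun i => v (M i))) -big_filter /index_iota subn0 -/J.
    by rewrite [in LHS](big_nth 0%N) big_mkord.
  rewrite mulr_sumr; apply: eq_bigr => i _; have [/andP[_ h] _] := JP i (ltn_ord i).
  by rewrite /phi /H KJ// max_r// max_l ?oppr_le0// mulr0 subr0.
have s2 : - 8 <= \sum_(i < nn - size J) phi (H (size J + i)%N).
  apply: (@le_trans _ _ (\sum_(i < nn - size J) (- 4 * 2^-1 ^+ i))).
    by rewrite -mulr_sumr; have := sum_half_pow R (nn - size J); lra.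
  apply: ler_sum => i _; rewrite /phi /H Kg.
  have /(@not_large _ _ b) := (ggP i).2; rewrite -vE => vs.
  have : 2^-1 ^+ M (gg i) <= 2^-1 ^+ i :> R.
    apply: half_pow_le; apply: leq_trans (incr_ge i igg) _; exact: incr_ge.
  have : 0 <= eta * Num.max 0 (v (M (gg i))) by rewrite mulr_ge0 ?(ltW eta0)// le_max lexx.
  have : Num.max 0 (- v (M (gg i))) <= `|v (M (gg i))|.
    by rewrite ge_max normr_ge0 /= -normrN ler_norm.
  by lra.
have sJ : \sum_(i < n | inJ i) v (M i) <= (p%:R + 10) / eta.
  rewrite ler_pdivlMr// mulrC -s1.
  have := lower; rewrite -[X in X - _ <= _]/(\sum_(i <- base_indices x l) phi i) sphi.
  by move: s2 upper ml; move: (\sum_(i < nn - size J) _) (\sum_(i < size J) _) => X Y; lra.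
rewrite /C; apply: le_trans (lerD sJ (sum_half_pow R n)).
rewrite [X in _ <= X + _]big_mkcond -big_split /=; apply: ler_sum => i _.
rewrite -/(v (M i)); have p0' := half_pow_ge0 R i.
case: ifPn => [/andP[_ vi]|]; first by rewrite max_r// lerDl.
rewrite negb_and add0r => /orP[/asboolPn/(@not_large _ _ b)|].
  rewrite -vE => h; rewrite ge_max p0' /=; apply: le_trans (ler_norm _) _.
  apply: le_trans (ltW h) _; apply: half_pow_le; exact: incr_ge.
by rewrite -ltNge => vi; rewrite max_l ?ltW.
Qed.

Lemma av_spec_le g x a e e' : e <= e' -> av_spec g x a e -> av_spec g x a e'.
Proof.
move=> ee [h1 h2 h3 h4]; split => //.
  by move=> c cl c1; apply: le_trans (h3 c cl c1) ee.
by apply: le_trans h4 _; rewrite ler_wpM2r// half_pow_ge0.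
Qed.

(** Quantifying over all subsequences [N'] allows small coefficients to be chosen after the bounds
    on sums have been arranged. *)
Definition vanishing g N := forall N', subseqn N' N -> forall e, 0 < e ->
  exists2 M, subseqn M N' &
  forall x c, subseqn x M -> c \in av g x -> ~~ c.1 -> c.2 <= e.

(** Near constancy turns a failure of smallness into a lower bound: with error [e / 3], one
    coefficient above [e] forces the common value to be at least [2 e / 3], hence all coefficients
    to be at least [e / 3]. *)
Lemma not_vanishing g : (al <= g)%O -> ~ (exists2 N, incr N & vanishing g N) ->
  forall N, incr N -> exists M a eta, [/\ subseqn M N, 0 < eta,
    forall x, subseqn x M -> av_spec g x a 1 &
    forall x c, subseqn x M -> c \in av g x -> ~~ c.1 -> eta <= c.2].
Proof.
move=> ag nv N iN; apply: contrapT => nM; apply: nv; exists N => // N' N'N e e0.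
apply: contrapT => ne; apply: nM.
pose e' := Num.min 1 (e / 3).
have e'0 : 0 < e' by rewrite lt_min ltr01 /=; lra.
have [M MN' [a a4 hM]] := stableP d_gt0 HN hs wA qd d4 ag N'N.1 e'0.
have [x [c [xM cx c1 ec]]] : exists x c, [/\ subseqn x M, c \in av g x, ~~ c.1 & e < c.2].
  apply: contrapT => h; apply: ne; exists M => // x c xM cx c1.
  by rewrite leNgt; apply/negP => ec; apply: h; exists x, c.
have e'e : e' <= e / 3 by rewrite ge_min lexx orbT.
exists M, a, (e / 3); split; first exact: subseqn_trans MN' N'N.
- by lra.
- by move=> y yM; apply: av_spec_le (hM y yM); rewrite ge_min lexx.
have ae : e - e / 3 <= a.
  have [_ _ h _] := hM x xM; have := h c cx c1; rewrite ler_norml => /andP[_ h'].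
  by lra.
move=> y c' yM c'y c'1; have [_ _ h _] := hM y yM; have := h c' c'y c'1.
by rewrite ler_norml => /andP[h' _]; lra.
Qed.

(** The sets [F i] are treated one after another on successive subsequences, since bounds on sums of
    moduli survive thinning. An average with small coefficients is then small on all of them. *)
Lemma strong_of_vanishing b N : (al < b)%O -> incr N -> vanishing b N ->
  (forall g, (al <= g)%O -> (g < b)%O -> ~ (exists2 N, incr N & vanishing g N)) ->
  strong s kap G nrm ev b.
Proof.
move=> ab iN vN nv n F hF v e e0.
have [M MN [C C0 hC]] : exists2 M, subseqn M N & exists2 C, 0 <= C &
    forall i, (i < n)%N -> forall b t, F i t -> forall k, \sum_(j < k) `|ev b t (w (M j))| <= C.
  elim: n F hF => [|n IH] F hF.
    by exists N; [exact: subseqn_refl|exists 0].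
  have [M MN [C C0 hC]] := IH F (fun i h => hF i (ltnW h)).
  have [g [p [ag gb cg]]] := coverable_below_class ab (hF n (ltnSn n)).
  have [M1 [a [eta [M1M eta0 h1 h2]]]] := not_vanishing ag (nv g ag gb) MN.1.
  have [_ pF _] := hF n (ltnSn n).
  have [M2 M2M1 [C' hC']] := sum_bound pF cg h1 h2 eta0 M1M.1.
  have M2M := subseqn_trans M2M1 M1M.
  exists M2; first exact: subseqn_trans M2M MN.
  exists (Num.max C C'); first by rewrite le_max C0.
  move=> i; rewrite ltnS leq_eqVlt => /predU1P[->|i_n] c t Ft k.
    by rewrite le_max (hC' c t Ft) orbT.
  rewrite le_max (@sum_subseq_le (fun m => `|ev c t (w m)|) M M2 C)//; first exact: MN.1.
  exact: (hC i i_n c t Ft).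
(* The base vectors contribute at most [e' C] and the mass at most [e']. *)
pose e' := e / (C + 1); have e'0 : 0 < e' by rewrite divr_gt0//; lra.
have [M3 M3M h3] := vN M MN e' e'0.
have [M4 M4M3 [a _ h4]] := stableP d_gt0 HN hs wA qd d4 (ltW ab) M3M.1 e'0.
have xM4 : subseqn (tail n.+1 (tail v M4)) M4.
  exact/subseqn_tail/subseqn_tail/subseqn_refl/M4M3.1.
set x := tail _ _ in xM4.
have [[Q _ QA] k0 _ km] := h4 x xM4.
exists (d (x 0%N)), Q, (comb x (av b x)); split => //.
  apply: leq_trans (incr_ge _ incd); apply: leq_trans (incr_ge _ M4M3.1).
  by rewrite addnCA -addnS leq_addr || (rewrite /=; lia).
move=> c t [i i_n Ft]; have [_ /(_ t Ft)[t0 tk] _] := hF i i_n.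
apply: le_trans (@ev_comb_upper c t x _ e' t0 tk k0 _) _.
  by move=> c' c'x c'1; apply: h3 c'x c'1; exact: subseqn_trans xM4 M4M3.
have m1 : mass (av b x) <= e'.
  apply: le_trans km _; rewrite -[leRHS]mulr1 ler_wpM2l ?(ltW e'0)//.
  by rewrite -(expr0 2^-1); exact: half_pow_le.
have s1 : \sum_(i <- base_indices x (av b x)) `|ev c t (w i)| <= C.
  apply: le_trans (@sum_base_indices_le (fun m => `|ev c t (w m)|) _ _ _) _ => //.
  apply: (@sum_subseq_le (fun m => `|ev c t (w m)|) M x) => //; first exact: MN.1.
    exact: subseqn_trans xM4 (subseqn_trans M4M3 M3M).
  exact: (hC i i_n c t Ft).
have -> : e = e' * C + e' by rewrite /e'; field; rewrite gt_eqF//; lra.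
by rewrite lerD// ler_wpM2l ?(ltW e'0).
Qed.

Lemma summable_base xi : kap = wexp (wexp xi) -> (al <= xi)%O ->
  (forall b, (al < b)%O -> (b <= xi)%O -> ~ strong s kap G nrm ev b) ->
  exists2 M, incr M & exists C, forall b t, (ozero < t)%O -> (t <= kap)%O ->
  forall n, \sum_(i < n) `|ev b t (w (M i))| <= C.
Proof.
move=> kE ax ns.
have nv : ~ (exists2 N, incr N & vanishing xi N).
  move=> vxi; pose V := [set b : omega1 | (al <= b)%O /\ exists2 N, incr N & vanishing b N].
  have [|b [ab [N iN vN]] bmin] := @omega1_min V; first by exists xi.
  have bxi : (b <= xi)%O by exact: bmin.
  move: ab; rewrite le_eqVlt => /predU1P[ab|ab].
    (* Order [al] is excluded: its only coefficient is 1, which is not at most 1/2. *)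
    have [M MN h] := vN N (subseqn_refl iN) 2^-1 ltac:(lra).
    have := h M (false, 1) (subseqn_refl MN.1); rewrite -ab av_al mem_head /=.
    by move=> /(_ isT isT); lra.
  apply: (ns b ab bxi); apply: strong_of_vanishing iN vN _ => // g ag gb vg.
  have := bmin g (conj ag vg); by rewrite leNgt gb.
have [|M1 [a [eta [M1M eta0 h1 h2]]]] := not_vanishing ax nv (N := fun i => i); first by [].
have [|M MM1 [C hC]] := sum_bound _ (coverable_whole kE ax) h1 h2 eta0 M1M.1; first by [].
exists M; first exact: MM1.1.
by exists C => b t t0 tk n; exact: hC.
Qed.

End base.

Theorem summable_averages xi : kap = wexp (wexp xi) ->
  exists al (d q : nat -> nat) (w : nat -> {poly R}),
  [/\ (al <= xi)%O, forall i, Avg al (d i) (q i) (w i), forall i, (q i < d i.+1)%N &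
  exists C, forall b t, (ozero < t)%O -> (t <= kap)%O ->
  forall n, \sum_(i < n) `|ev b t (w i)| <= C].
Proof.
move=> kE; have [al [ax sal amax]] := strong_max hs HN Ginf evZ evD ev_le ev_null xi.
have [d [q [w [wA qd d4 sb]]]] := strong_base sal.
have [|M iM [C hC]] := summable_base wA qd d4 sb kE ax.
  by move=> b ab bx /(amax b bx); rewrite leNgt ab.
exists al, (d \o M), (q \o M), (w \o M); split => //.
- by move=> i; exact: wA.
- move=> i /=; apply: leq_trans (qd _) _; apply: incr_le (incr_d HN wA qd) _; exact: iM.
- by exists C.
Qed.

End core.

(** * Real and complex scalars *)

(* A common interface to the fields [R] and [R[i]]; [part true] and [part false]
   are the real and the imaginary part. *)
Record scalars (R : realType) (K : numFieldType) := Scalars {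
  inr : {rmorphism R -> K};
  modulus : K -> R;
  part : bool -> K -> R;
  inr_le : forall x y, (inr x <= inr y) = (x <= y);
  normE : forall z, `|z| = inr (modulus z);
  partD : forall b y z, part b (y + z) = part b y + part b z;
  partZ : forall b c z, part b (inr c * z) = c * part b z;
  part_le : forall b z, `|part b z| <= modulus z;
  modulus_le : forall z, modulus z <= `|part true z| + `|part false z|;
  scalars_complete : forall u : nat -> K,
    (forall e, 0 < e -> exists n, forall i j, (n <= i)%N -> (n <= j)%N ->
      modulus (u i - u j) <= e) ->
    exists l, forall e, 0 < e -> exists n, forall i, (n <= i)%N -> modulus (u i - l) <= e }.

Lemma cauchy_limit (R : realType) (u : nat -> R) :
  (forall e, 0 < e -> exists n, forall i j, (n <= i)%N -> (n <= j)%N -> `|u i - u j| <= e) ->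
  exists l, forall e, 0 < e -> exists n, forall i, (n <= i)%N -> `|u i - l| <= e.
Proof.
move=> h; have : cvgn u.
  apply/cauchy_cvgP/cauchy_exP => e e0; have e2 : 0 < e / 2 by lra.
  have [n hn] := h _ e2; exists (u n), n => // i /= ni.
  by rewrite /ball /=; apply: le_lt_trans (hn _ _ (leqnn _) ni) _; lra.
move=> ul; exists (limn u) => e e0.
by have /cvgrPdist_le/(_ _ e0)[n _ hn] := ul; exists n => i /hn /=; rewrite distrC.
Qed.

Definition real_scalars (R : realType) : scalars R R.
Proof.
refine (@Scalars R R idfun (fun z => `|z|) (fun b z => if b then z else 0) _ _ _ _ _ _ _) => //.
- by case=> // y z; rewrite addr0.
- by case=> // c z; rewrite mulr0.
- by case=> // z; rewrite normr0.
- by move=> z; rewrite normr0 addr0.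
- exact: cauchy_limit.
Defined.

Definition complex_scalars (R : realType) : scalars R R[i].
Proof.
have sq_le (x y : R) : `|x| <= Num.sqrt (x ^+ 2 + y ^+ 2).
  by rewrite -sqrtr_sqr ler_wsqrtr// lerDl sqr_ge0.
have sq_ge (x y : R) : `|y| <= Num.sqrt (x ^+ 2 + y ^+ 2) by rewrite addrC.
have le_sq (x y : R) : Num.sqrt (x ^+ 2 + y ^+ 2) <= `|x| + `|y|.
  have h : 0 <= `|x| + `|y| by rewrite addr_ge0.
  rewrite -[leRHS]ger0_norm// -sqrtr_sqr ler_wsqrtr// sqrrD !real_normK ?num_real//.
  by rewrite -addrA [_ *+ 2 + _]addrC addrA lerDl mulrn_wge0// mulr_ge0.
refine (@Scalars R R[i] (real_complex R)
  (fun z => Num.sqrt (complex.Re z ^+ 2 + complex.Im z ^+ 2))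
  (fun b z => if b then complex.Re z else complex.Im z) _ _ _ _ _ _ _).
- by move=> x y; rewrite lecE /= eqxx.
- by move=> z; rewrite normc_def.
- by case=> -[y1 y2] [z1 z2].
- by case=> c [z1 z2] /=; rewrite mul0r ?subr0 ?addr0.
- by case=> z; [exact: sq_le|exact: sq_ge].
- by move=> z; exact: le_sq.
move=> u hu.
have [|l1 h1] := @cauchy_limit R (fun n => complex.Re (u n)).
  move=> e /hu[n hn]; exists n => i j ni nj; apply: le_trans (hn i j ni nj).
  by case: (u i) (u j) => [? ?] [? ?]; exact: sq_le.
have [|l2 h2] := @cauchy_limit R (fun n => complex.Im (u n)).
  move=> e /hu[n hn]; exists n => i j ni nj; apply: le_trans (hn i j ni nj).
  by case: (u i) (u j) => [? ?] [? ?]; exact: sq_ge.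
exists (Complex l1 l2) => e e0; have e2 : 0 < e / 2 by lra.
have [n1 hn1] := h1 _ e2; have [n2 hn2] := h2 _ e2.
exists (maxn n1 n2) => i; rewrite geq_max => /andP[/hn1 i1 /hn2 i2].
rewrite [e]splitr; apply: le_trans (le_sq _ _) _; apply: le_trans (lerD i1 i2).
by case: (u i).
Defined.

(** * From polynomials to averages in a normed space *)

Section scalars_theory.
Variables (R : realType) (K : numFieldType) (rs : scalars R K).
Implicit Types (c : R) (z y : K).
Local Notation md := (modulus rs).
Local Notation io := (inr rs).

Lemma inr_inj : injective io.
Proof. exact: fmorph_inj. Qed.

Lemma inr_ge0 c : (0 <= io c) = (0 <= c).
Proof. by rewrite -(inr_le rs) rmorph0. Qed.

Lemma inr_gt0 c : (0 < io c) = (0 < c).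
Proof. by rewrite !lt_def inr_ge0 fmorph_eq0. Qed.

Lemma norm_inr c : `|io c| = io `|c|.
Proof.
have [c0|c0] := leP 0 c; first by rewrite !ger0_norm ?inr_ge0.
by rewrite (ltr0_norm c0) rmorphN -normrN ger0_norm// -rmorphN inr_ge0 oppr_ge0 ltW.
Qed.

Lemma modulus_inr c : md (io c) = `|c|.
Proof. by apply: inr_inj; rewrite -normE norm_inr. Qed.

Lemma modulus_ge0 z : 0 <= md z.
Proof. by rewrite -inr_ge0 -normE. Qed.

Lemma modulusM z y : md (z * y) = md z * md y.
Proof. by apply: inr_inj; rewrite rmorphM -!normE normrM. Qed.

Lemma modulusD z y : md (z + y) <= md z + md y.
Proof. by rewrite -(inr_le rs) rmorphD -!normE ler_normD. Qed.

Lemma modulusN z : md (- z) = md z.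
Proof. by apply: inr_inj; rewrite -!normE normrN. Qed.

Lemma modulus0 : md 0 = 0.
Proof. by rewrite -(rmorph0 io) modulus_inr normr0. Qed.

Lemma modulus_eq0 z : md z = 0 -> z = 0.
Proof. by move=> z0; apply/eqP; rewrite -normr_eq0 (normE rs) z0 rmorph0. Qed.

Lemma modulus_norm z : md `|z| = md z.
Proof. by rewrite (normE rs) modulus_inr ger0_norm ?modulus_ge0. Qed.

Lemma modulus_sum n (F : nat -> K) : md (\sum_(i < n) F i) <= \sum_(i < n) md (F i).
Proof.
elim: n => [|n IH]; first by rewrite !big_ord0 modulus0.
by rewrite !big_ord_recr /=; apply: le_trans (modulusD _ _) _; rewrite lerD2r.
Qed.

Variable V : normedModType K.
Implicit Types u v : V.

(** Norms take their values in [K]; this is the same number seen in [R], where linear arithmetic is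
    available. *)
Definition rnorm v : R := md `|v|.

Lemma rnormE v : `|v| = io (rnorm v).
Proof. by rewrite /rnorm -normE normr_id. Qed.

Lemma rnorm_ge0 v : 0 <= rnorm v.
Proof. exact: modulus_ge0. Qed.

Lemma rnormZ z v : rnorm (z *: v) = md z * rnorm v.
Proof. by rewrite /rnorm normrZ modulusM modulus_norm. Qed.

Lemma rnormD u v : rnorm (u + v) <= rnorm u + rnorm v.
Proof. by rewrite -(inr_le rs) rmorphD -!rnormE ler_normD. Qed.

Lemma rnormN v : rnorm (- v) = rnorm v.
Proof. by rewrite /rnorm normrN. Qed.

Lemma rnormB u v : rnorm (u - v) <= rnorm u + rnorm v.
Proof. by rewrite -(rnormN v) rnormD. Qed.

Lemma rnorm0 : rnorm 0 = 0.
Proof. by rewrite /rnorm normr0 modulus0. Qed.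

Variable f : nat -> V.

Definition comb_of (p : {poly R}) : V := \sum_(i < size p) io p`_i *: f i.

Lemma comb_ofE n (p : {poly R}) : (size p <= n)%N ->
  comb_of p = \sum_(i < n) io p`_i *: f i.
Proof.
move=> pn; rewrite -(subnKC pn) big_split_ord /= -[LHS]addr0; congr +%R.
by rewrite big1// => i _; rewrite nth_default ?leq_addr// rmorph0 scale0r.
Qed.

Lemma comb_ofD p q : comb_of (p + q) = comb_of p + comb_of q.
Proof.
rewrite (@comb_ofE (maxn (size p) (size q)) (p + q)) ?size_polyD//.
rewrite (@comb_ofE (maxn (size p) (size q)) p) ?leq_maxl//.
rewrite (@comb_ofE (maxn (size p) (size q)) q) ?leq_maxr// -big_split /=.
by apply: eq_bigr => i _; rewrite coefD rmorphD scalerDl.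
Qed.

Lemma comb_ofZ c p : comb_of (c *: p) = io c *: comb_of p.
Proof.
rewrite (@comb_ofE (size p) (c *: p)) ?size_scale_leq// scaler_sumr.
by apply: eq_bigr => i _; rewrite coefZ rmorphM scalerA.
Qed.

Lemma comb_ofX n : comb_of 'X^n = f n.
Proof.
rewrite /comb_of size_polyXn big_ord_recr /= big1 ?add0r => [|i _].
  by rewrite coefXn eqxx rmorph1 scale1r.
by rewrite coefXn (ltn_eqF (ltn_ord i)) rmorph0 scale0r.
Qed.

Definition coefs (p : {poly R}) : nat -> K := fun i => io p`_i.

Lemma supp_coefs p : supp (coefs p) = [set i | p`_i != 0].
Proof. by apply/seteqP; split => i /=; rewrite /supp /coefs /= fmorph_eq0. Qed.

Lemma finite_supp_coefs p : finite_set (supp (coefs p)).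
Proof.
rewrite supp_coefs; apply: (sub_finite_set _ (finite_II (size p))) => i /=.
by apply: contraNT; rewrite -leqNgt => /(nth_default 0) ->.
Qed.

Lemma lincomb_coefs p : lincomb f (coefs p) = comb_of p.
Proof.
rewrite /lincomb (fsbig_widen _ `I_(size p)); last 2 first.
- rewrite supp_coefs => i /=.
  by apply: contraNT; rewrite -leqNgt => /(nth_default 0) ->.
- by move=> i [_ /=] /negP; rewrite negbK => /eqP ->; rewrite scale0r.
by rewrite -fsbig_ord.
Qed.

End scalars_theory.

Local Notation minset := Defs.minset.
Local Notation maxset := Defs.maxset.

Lemma minset_eq (A : set nat) m : A m -> (forall x, A x -> (m <= x)%N) -> minset A = m.
Proof.
move=> Am h; rewrite /Defs.minset /infimum; case: ifPn => [/eqP A0|_]; first by rewrite A0 in Am.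
have im : infimums A m by split => [x /h//|x]; apply.
by case: xgetP => [y _ /(is_subset1_infimums im)|/(_ _ im)].
Qed.

Lemma maxset_eq (A : set nat) m : A m -> (forall x, A x -> (x <= m)%N) -> maxset A = m.
Proof.
move=> Am h; rewrite /Defs.maxset /supremum; case: ifPn => [/eqP A0|_]; first by rewrite A0 in Am.
have im : supremums A m by split => [x /h//|x]; apply.
by case: xgetP => [y _ /(is_subset1_supremums im)|/(_ _ im)].
Qed.

Lemma elt_range (N : nat -> nat) : incr N -> elt (range N) = N.
Proof.
move=> iN; apply/funext; elim => [|n IH] /=.
  by apply: minset_eq; [exists 0%N|move=> _ [k _ <-]; exact: incr_le].
rewrite IH; apply: minset_eq; first by split; [exists n.+1|exact: iN].
by move=> _ [[k _ <-] /=]; rewrite incr_ltE// => nk; exact: incr_le.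
Qed.

(** A larger set has no larger a minimum, so it cannot be admissible with more elements than the
    minimum [m 0 = k + 1], which is already the number of elements here. *)
Lemma maximal_schreier1_imfset k (m : nat -> nat) :
  (forall i, (i < k)%N -> (m i < m i.+1)%N) -> m 0%N = k.+1 ->
  maximal_schreier1 [fset m i | i in iota 0 k.+1]%fset.
Proof.
move=> hm m0.
have mle i j : (i <= j)%N -> (j <= k)%N -> (m i <= m j)%N.
  move=> ij; elim: j ij => [|j IH]; first by rewrite leqn0 => /eqP ->.
  rewrite leq_eqVlt => /predU1P[->//|ij] jk.
  by apply: leq_trans (IH ij (ltnW jk)) (ltnW (hm _ jk)).
have mlt i j : (i < j)%N -> (j <= k)%N -> (m i < m j)%N.
  by move=> ij jk; apply: leq_trans (mle _ _ ij jk); apply: hm; exact: leq_trans jk.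
set F := [fset _ | _ in _]%fset.
have F0 : m 0%N \in F by apply/imfsetP; exists 0%N => //=; rewrite mem_iota.
have FP x : x \in F -> exists2 i, (i <= k)%N & x = m i.
  move=> /imfsetP[i ik ->]; exists i => //.
  by have : i \in iota 0 k.+1 := ik; rewrite mem_iota add0n ltnS.
have Fmin : minset [set` F] = m 0%N.
  by apply: minset_eq => // _ /FP[i ik ->]; exact: mle.
have cF : #|` F| = k.+1.
  rewrite card_in_imfset; last first.
    move=> i j ik jk mij; have {ik} : i \in iota 0 k.+1 := ik.
    have {jk} : j \in iota 0 k.+1 := jk; rewrite !mem_iota !add0n !leq0n !ltnS => jk ik.
    case: (ltngtP i j) => // ij; first by have := mlt _ _ ij jk; rewrite mij ltnn.
    by have := mlt _ _ ij ik; rewrite mij ltnn.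
  rewrite -[RHS](size_iota 0 k.+1); apply/perm_size/uniq_perm.
  - exact: enum_finmem_uniq.
  - exact: iota_uniq.
  - by move=> i; rewrite enum_finmemE.
split; first by right; rewrite cF Fmin m0.
move=> G [->|Gm] FG; first by have := fsubsetP FG _ F0; rewrite inE.
apply/esym/eqP; rewrite eqEfcard FG /= cF -m0; apply: leq_trans Gm _.
have := fsubsetP FG _ F0 => G0.
pose g := ex_minn (ex_intro (fun x => x \in G) _ G0).
have [gG gmin] : g \in G /\ forall x, x \in G -> (g <= x)%N by rewrite /g; case: ex_minnP.
by rewrite (@minset_eq _ g)//; exact: gmin.
Qed.

(** * Comparison with the inductive definition of averages *)

Section average_of_Avg.
Variables (R : realType) (K : numFieldType) (rs : scalars R K).
Variables (V : normedModType K) (f : nat -> V) (s : omega1 -> nat -> omega1).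
Variable G : nat -> Prop.
Local Notation nrm := (fun p => rnorm rs (comb_of rs f p)).
Hypothesis HN : block_norm G nrm.

Lemma normalize_coefs p : normalize f (coefs rs p) = coefs rs ((nrm p)^-1 *: p).
Proof.
by apply/funext => i; rewrite /normalize lincomb_coefs (rnormE rs) /coefs coefZ rmorphM fmorphV.
Qed.

Lemma coefs_sum k (p : nat -> {poly R}) :
  coefs rs (\sum_(i < k) p i) = \sum_(i < k) coefs rs (p i).
Proof.
apply/funext => j; rewrite /coefs coef_sum rmorph_sum.
by elim/big_rec2: _ => [//|i y x _ ->].
Qed.

Lemma coefsX n : coefs rs 'X^n = unit_seq K n.
Proof. by apply/funext => i; rewrite /coefs coefXn rmorph_nat. Qed.

Lemma supp_coefs_min m q p : blk G nrm m q p -> minset (supp (coefs rs p)) = m.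
Proof.
move=> [h _ pm _ _]; rewrite supp_coefs.
by apply: minset_eq => // i /h[].
Qed.

Lemma supp_coefs_max m q p : blk G nrm m q p -> maxset (supp (coefs rs p)) = q.
Proof.
move=> [h _ _ pq _]; rewrite supp_coefs.
by apply: maxset_eq => // i /h[_ ].
Qed.

Lemma Avg_ozero g m q p : Avg s G nrm g m q p -> g = ozero -> m = q /\ p = 'X^m.
Proof.
case=> //.
- by move=> b k m' q' p' _ _ _ e; have := osucc_gt0 b; rewrite e ltxx.
- by move=> a l m' q' p' [a0 _].
Qed.

(* The average of order [g] of the set [L] only depends on an initial segment of
   [L], namely its support. *)
Lemma Avg_average g m q p : Avg s G nrm g m q p ->
  forall L : set nat, (forall i, p`_i != 0 <-> L i /\ (i <= q)%N) ->
  average f s g L 0 (coefs rs p).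
Proof.
elim=> {g m q p} [n Gn|b k m q p pA IH hq mk|a l m q p la Gl lm pA IH] L hL.
- rewrite coefsX; have -> : n = elt L 0; last exact: average_zero.
  apply/esym/minset_eq; first by have [] := (hL n).1; rewrite // coefXn eqxx oner_eq0.
  move=> i Li; have [//|iln] := leqP n i.
  by have := (hL i).2 (conj Li (ltnW iln)); rewrite coefXn (ltn_eqF iln) eqxx.
- have bl i : (i < k.+1)%N -> blk G nrm (m i) (q i) (p i) by move=> /pA/(Avg_blk HN).
  have mq i : (i < k.+1)%N -> (m i <= q i)%N by move=> /bl/blk_le.
  have qle i j : (i <= j)%N -> (j <= k)%N -> (q i <= q j)%N.
    move=> ij; elim: j ij => [|j IHj]; first by rewrite leqn0 => /eqP ->.
    rewrite leq_eqVlt => /predU1P[->//|ij] jk.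
    by have := IHj ij (ltnW jk); have := hq _ jk; have := mq j.+1 jk; lia.
  have Lp j : L j /\ (j <= q k)%N <-> exists2 i, (i < k.+1)%N & (p i)`_j != 0.
    rewrite -hL coefZ mulf_eq0 negb_or invr_eq0.
    have n4 := nrm_sum_ge HN bl hq.
    rewrite gt_eqF ?coef_sum /=; last by lra.
    split => [h|[i ik pij]].
      apply: contrapT => nh; move/eqP: h; apply; rewrite big1// => i _; apply/eqP.
      by apply: contrapT => /negP ?; apply: nh; exists i.
    rewrite gt_eqF// (bigD1 (Ordinal ik)) //=.
    apply: ltr_wpDr; first by rewrite sumr_ge0// => i' _; have [_ ->] := bl i' (ltn_ord i').
    by rewrite lt_neqAle eq_sym pij; have [_ ->] := bl i ik.
  (* The support of the [i]-th summand is the part of [L] after [q (i-1)] and up to [q i], which is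
     the form that [average_next] calls for. *)
  have Li i j : (i < k.+1)%N -> (p i)`_j != 0 <->
      (L j /\ (i = 0%N \/ (q i.-1 < j)%N)) /\ (j <= q i)%N.
    move=> ik; split => [pij|[[Lj ij] jq]].
      have [h _ _ _ _] := bl i ik; have [mj jq _] := h j pij.
      have [Lj _] := (Lp j).2 (ex_intro2 _ _ i ik pij).
      split => //; split => //; case: i ik {pij h jq} mj => [|i] ik mj; [by left|right => /=].
      exact: leq_trans (hq i ik) mj.
    have [|i' i'k pj] := (Lp j).1; first by split => //; apply: leq_trans jq (qle _ _ _ _).
    have [h _ _ _ _] := bl i' i'k; have [mj jq' _] := h j pj.
    have [->//|] := eqVneq i i'; rewrite neq_ltn => /orP[ii'|i'i].
      have := hq i'.-1; rewrite prednK; last by lia.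
      move=> /(_ i'k) h1; have := qle i i'.-1; lia.
    case: ij => [i0|ij]; first by lia.
    by have := qle i' i.-1; lia.
  have avb i : (i < k.+1)%N -> average f s b L i (coefs rs (p i)).
    (* Order 0 is separate because [average_next] excludes it: the averages are then directly the
       elements of [L] in their enumeration. *)
    have [b0|/eqP b0] := eqVneq b ozero.
      move=> ik; have elE i' : (i' < k.+1)%N -> elt L i' = m i' /\ q i' = m i' /\ p i' = 'X^(m i').
        elim: i' => [|i' IHi] i'k; have [qm pm] := Avg_ozero (pA _ i'k) b0.
          split => //; apply: minset_eq.
            have [|[Lm _] _] := (Li 0%N (m 0%N) i'k).1; last by [].
            by rewrite pm coefXn eqxx oner_eq0.
          move=> j Lj; have [//|jm] := leqP (m 0%N) j.
          have := (Li 0%N j i'k).2; rewrite pm coefXn (ltn_eqF jm) eqxx -qm => /(_ _)/negP.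
          by case; split; [split; [|left]|exact: ltnW].
        split => //=; have [-> [qi _]] := IHi (ltnW i'k).
        apply: minset_eq.
          have [|[Lm [//|/= qm']] _] := (Li i'.+1 (m i'.+1) i'k).1; first by rewrite pm coefXn eqxx oner_eq0.
          by split => //=; rewrite -qi.
        move=> j [Lj /= ij]; have [//|jm] := leqP (m i'.+1) j.
        have := (Li i'.+1 j i'k).2; rewrite pm coefXn (ltn_eqF jm) eqxx -qm => /(_ _)/negP.
        by case; split; [split; [|right => /=; rewrite qi]|exact: ltnW].
      have [em [_ ->]] := elE i ik.
      by rewrite coefsX b0 -em; exact: average_zero.
    elim: i => [|i IHi] ik.
      apply: IH => // j; rewrite Li//; split => [[[? _] ?]//|[? ?]].
      by split => //; split => //; left.
    apply: (average_next b0 (IHi (ltnW ik))).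
    rewrite (supp_coefs_max (bl i (ltnW ik))).
    apply: IH => // j; rewrite Li//; split => [[[? [//|/= ?]] ?]//|[[? ?] ?]].
    by split => //; split => //; right.
  rewrite -normalize_coefs coefs_sum; apply: (@average_succ _ _ f s b L k.+1 (fun i => coefs rs (p i))); first exact: avb.
  have -> : [fset minset (supp (coefs rs (p i))) | i in iota 0 k.+1]%fset =
      [fset m i | i in iota 0 k.+1]%fset.
    apply: eq_in_imfset => // i ik; have {}ik : i \in iota 0 k.+1 := ik.
    by rewrite mem_iota add0n in ik; exact: supp_coefs_min (bl i ik).
  apply: maximal_schreier1_imfset => // i ik.
  by apply: leq_ltn_trans (hq i ik); exact/mq/ltnW.
- have bp := Avg_blk HN pA; have [h _ _ _ _] := bp; have mq := blk_le bp.
  have l0 : l%:R^-1 != 0 :> R by rewrite invr_eq0 pnatr_eq0; have := good_gt1 HN Gl; lia.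
  have n4 := nrm_limit_ge HN Gl lm bp.
  have Lp j : L j /\ (j <= q)%N <-> j = l \/ p`_j != 0.
    rewrite -hL coefZ mulf_eq0 negb_or invr_eq0 gt_eqF /=; last by lra.
    rewrite coefD coefZ coefXn; have [->|jl] := eqVneq j l.
      have -> : p`_l = 0; last by rewrite mulr1 addr0 l0; split => // _; left.
      apply/eqP; apply: contraT => /h[ml _ _]; by rewrite leqNgt lm in ml.
    by rewrite mulr0 add0r; split => [?|[/eqP|//]]; [right|rewrite (negbTE jl)].
  have Ll : minset L = l.
    apply: minset_eq; first by have [] := (Lp l).2 (or_introl erefl).
    move=> j Lj; have [//|jl] := leqP l j.
    have [|jE|/h[mj _ _]] := (Lp j).1; [by split => //; lia|by rewrite jE ltnn in jl|].
    by have := ltn_trans lm (leq_ltn_trans mj jl); rewrite ltnn.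
  rewrite -normalize_coefs.
  have -> : coefs rs (l%:R^-1 *: 'X^l + p) =
      (minset L)%:R^-1 *: unit_seq K (minset L) + coefs rs p.
    rewrite Ll -coefsX; apply/funext => j; rewrite /coefs coefD coefZ rmorphD rmorphM.
    by rewrite fmorphV rmorph_nat.
  apply: average_limit => //; first by rewrite Ll (good_gt1 HN).
  rewrite Ll; apply: IH => j; split => [pj|[[Lj /= jl] jq]].
    have [Lj jq] := (Lp j).2 (or_intror pj); split => //; split => //= jl.
    by have [mj _ _] := h j pj; rewrite jl leqNgt lm in mj.
  by have [|/jl|//] := (Lp j).1.
Qed.

End average_of_Avg.

(** * The space of continuous functions on an ordinal *)


Lemma contractive_continuous (K : numFieldType) (V : normedModType K)
  (phi : {linear V -> K^o}) : (forall v, `|phi v| <= `|v|) -> continuous phi.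
Proof.
move=> h v; apply/cvgrPdist_le => e e0.
near=> w; rewrite -linearB; apply: le_trans (h _) _.
by near: w; exact: cvgr_dist_le.
Unshelve. all: by end_near.
Qed.

Section evaluation.
Variables (K : numFieldType) (kap : omega1).
Local Notation V := (Cspace K kap).
Implicit Types (v : V) (t u : omega1).

(** Extended by 0 outside [[1, kap]], evaluation is a contractive linear functional at every
    ordinal. *)
Definition value_at t v : K :=
  if insub t is Some x then v (x : order_topology (ointerval kap)) else 0.

Lemma oone_le t : (oone <= t)%O = (ozero < t)%O.
Proof. by rewrite leNgt ltosucc -ltNge. Qed.

Lemma value_at_linear t : linear (value_at t : V -> K^o).
Proof.
by move=> a u v; rewrite /value_at; case: insubP => [x _ _//|_]; rewrite scaler0 addr0.
Qed.

HB.instance Definition _ t := GRing.isLinear.Build K V K^o _ (value_at t) (value_at_linear t).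

Lemma value_atD t v w : value_at t (v + w) = value_at t v + value_at t w.
Proof. exact: linearD. Qed.

Lemma value_atZ t (c : K) v : value_at t (c *: v) = c * value_at t v.
Proof. exact: linearZ. Qed.

Lemma value_at_sum t n (c : nat -> K) (f : nat -> V) :
  value_at t (\sum_(i < n) c i *: f i) = \sum_(i < n) c i * value_at t (f i).
Proof. by rewrite linear_sum; apply: eq_bigr => i _; rewrite linearZ. Qed.

Lemma value_at_le t v : `|value_at t v| <= `|v|.
Proof.
rewrite /value_at; case: insubP => [x _ _|_]; last by rewrite normr0.
have [h|h] := Cspace_good v; last by have := h x.
exact: (le_supnorm x h).
Qed.

Lemma norm_le_value_at v (c : K) : 0 <= c ->
  (forall t, (ozero < t)%O -> (t <= kap)%O -> `|value_at t v| <= c) -> `|v| <= c.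
Proof.
move=> c0 h; have [vs|vs] := Cspace_good v; last first.
  by rewrite /Num.norm /= /Cspace_norm supnorm_empty.
apply: (supnorm_le vs) => x; have /andP[x1 xk] := valP x.
have := h (val x); rewrite -oone_le => /(_ x1 xk).
by rewrite /value_at valK.
Qed.

Lemma value_at_continuous t : continuous (value_at t).
Proof.
exact: contractive_continuous (@value_at_le t).
Qed.

Lemma value_at_left_continuous t v (e : K) : (ozero < t)%O -> (t <= kap)%O -> 0 < e ->
  exists2 a, (a < t)%O & forall u, (a < u)%O -> (u <= t)%O -> `|value_at u v - value_at t v| < e.
Proof.
move=> t0 tk e0; have t1 : (oone <= t <= kap)%O by rewrite oone_le t0.
pose x : ointerval kap := exist _ t t1.
have vx : value_at t v = v (x : order_topology (ointerval kap)).
  by rewrite /value_at -[t]/(val x) valK.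
have /cvgrPdist_lt/(_ _ e0) := @cts_fun _ _ v x.
rewrite -nbhs_nearE (@itv_nbhsE _ (order_topology (ointerval kap))) => -[[l r] [oi xi] iB].
have [a at_ ha] : exists2 a, (a < t)%O & forall y : ointerval kap, (a < val y)%O ->
    (val y <= t)%O -> y \in Interval l r.
  case: l oi xi iB => [b y|b] oi xi iB.
    have bE := itv_open_ends_lside oi; rewrite bE in xi *.
    move: xi; rewrite itv_boundlr => /andP[yx xr].
    exists (val y) => // z yz zt; rewrite itv_boundlr; apply/andP; split => //.
    by apply: le_trans xr; rewrite bnd_simp.
  exists ozero => // z z0 zt; rewrite itv_boundlr (itv_open_ends_linfty oi) /=.
  by move: xi; rewrite itv_boundlr => /andP[_]; apply: le_trans; rewrite bnd_simp.
exists a => // u au ut; have u1 : (oone <= u <= kap)%O.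
  by rewrite oone_le (le_lt_trans (ozero_le a) au) (le_trans ut tk).
pose y : ointerval kap := exist _ u u1.
have -> : value_at u v = v (y : order_topology (ointerval kap)).
  by rewrite /value_at -[u]/(val y) valK.
rewrite vx distrC; exact: (iB _ (ha y au ut)).
Qed.

Lemma value_at_null (f : nat -> V) t (e : K) : weakly_null f -> 0 < e ->
  exists n, forall i, (n <= i)%N -> `|value_at t (f i)| <= e.
Proof.
move=> /(_ (value_at t) (@value_at_continuous t)) /cvgrPdist_le h /h[n _ hn].
by exists n => i /hn /=; rewrite sub0r normrN.
Qed.

End evaluation.

(** * A basic subsequence of a weakly null sequence *)

Section basic_subsequence.
Variables (R : realType) (K : numFieldType) (rs : scalars R K) (kap : omega1).
Local Notation V := (Cspace K kap).
Local Notation md := (modulus rs).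
Variable f : nat -> V.
Hypothesis hf1 : forall n : nat, (0 < n)%N -> `|f n| = 1.
Hypothesis hf0 : weakly_null f.
Implicit Types (e d : R) (t p : omega1).

Lemma modulus_value_at_le t (v : V) : md (value_at t v) <= rnorm rs v.
Proof. by rewrite -(inr_le rs) -normE -rnormE; exact: value_at_le. Qed.

Lemma rnorm_le (v : V) e : 0 <= e ->
  (forall t, (ozero < t)%O -> (t <= kap)%O -> md (value_at t v) <= e) -> rnorm rs v <= e.
Proof.
move=> e0 h; rewrite -(inr_le rs) -rnormE; apply: norm_le_value_at => [|t t0 tk].
  by rewrite inr_ge0.
by rewrite (normE rs) inr_le; exact: h.
Qed.

Lemma modulus_value_at_null t e : 0 < e ->
  exists n, forall i, (n <= i)%N -> md (value_at t (f i)) <= e.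
Proof.
rewrite -(inr_gt0 rs) => e0; have [n hn] := value_at_null t hf0 e0.
by exists n => i /hn; rewrite (normE rs) inr_le.
Qed.

Lemma value_at_null_seq (P : seq omega1) e : 0 < e ->
  exists n, forall i p, (n <= i)%N -> p \in P -> md (value_at p (f i)) <= e.
Proof.
move=> e0; elim: P => [|q P [n hn]]; first by exists 0%N.
have [n' hn'] := modulus_value_at_null q e0; exists (maxn n n') => i p.
by rewrite geq_max inE => /andP[ni n'i] /predU1P[->|]; [exact: hn'|exact: hn].
Qed.

(** By compactness: each point has a left neighbourhood on which finitely many functions vary by at
    most [e], and the net consists of the centres of a finite cover. *)
Lemma value_at_net m e : 0 < e -> exists P : seq omega1,
  forall t, (ozero < t)%O -> (t <= kap)%O -> exists2 p, p \in P &
    forall i, (i <= m)%N -> md (value_at t (f i) - value_at p (f i)) <= e.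
Proof.
move=> e0; have ie0 : 0 < inr rs e by rewrite inr_gt0.
have /choice[nb hnb] : forall t, exists a, (ozero < t)%O -> (t <= kap)%O -> (a < t)%O /\
    forall u i, (a < u)%O -> (u <= t)%O -> (i <= m)%N ->
      md (value_at u (f i) - value_at t (f i)) <= e.
  move=> t; have [[t0 tk]|nt] := pselect ((ozero < t)%O /\ (t <= kap)%O); last first.
    by exists ozero => t0 tk; case: nt.
  suff [a at_ ha] : exists2 a, (a < t)%O & forall u i, (a < u)%O -> (u <= t)%O ->
      (i < m.+1)%N -> md (value_at u (f i) - value_at t (f i)) <= e.
    by exists a => _ _; split.
  elim: m.+1 => [|k [a at_ ha]]; first by exists ozero.
  have [b bt hb] := value_at_left_continuous (f k) t0 tk ie0.
  exists (Order.max a b); first by rewrite gt_max at_.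
  move=> u i; rewrite gt_max => /andP[au bu] ut; rewrite ltnS leq_eqVlt => /predU1P[->|ik].
    by rewrite -(inr_le rs) -normE ltW// hb.
  exact: ha.
have [|Q [hQ1 hQ2]] := @interval_cover kap nb; first by move=> t t0 tk; have [] := hnb t t0 tk.
exists Q => t t0 tk; have [p pP [npt tp]] := hQ2 t t0 tk; exists p => // i im.
by have [p0 pk] := hQ1 _ pP; have [_ h] := hnb p p0 pk; exact: h.
Qed.

(** Each term is chosen tiny on finite nets adapted to the earlier ones. The value of a partial sum
    at [t] is nearly taken at a point [p] of a net, where later terms hardly change it; so its norm
    exceeds that of the whole sum by at most a fraction of the largest norm [S] of a partial sum. *)
Lemma basic_subsequence : exists N : nat -> nat, [/\ incr N, (1 < N 0)%N &
  forall (c : nat -> K) n m, (n <= m)%N ->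
    rnorm rs (\sum_(i < n) c i *: f (N i)) <= 2 * rnorm rs (\sum_(i < m) c i *: f (N i))].
Proof.
have pow_gt0 m : 0 < 2^-1 ^+ m :> R by rewrite exprn_gt0// invr_gt0.
have pow_le m n : (m <= n)%N -> 2^-1 ^+ n <= 2^-1 ^+ m :> R.
  by move=> mn; apply: ler_wiXn2l => //; lra.
(* Coefficients are at most [2 S]. With this precision at most [m + 1] terms produce an error
   [S / 8], and the values [2^-k / 32] chosen below produce another [S / 8] in total. *)
have /choice[P hP] : forall m, exists P : seq omega1,
    forall t, (ozero < t)%O -> (t <= kap)%O -> exists2 p, p \in P &
    forall i, (i <= m)%N -> md (value_at t (f i) - value_at p (f i)) <= 16^-1 / m.+1%:R.
  by move=> m; apply: value_at_net; rewrite divr_gt0// invr_gt0.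
have /choice[g hg] : forall m, exists n, forall i p, (n <= i)%N ->
    p \in flatten [seq P m' | m' <- iota 0 m.+1] -> md (value_at p (f i)) <= 2^-1 ^+ m / 32.
  by move=> m; apply: value_at_null_seq; rewrite divr_gt0.
(* Starting at 2 keeps 1 out of the index set, so that limit averages avoid the exceptional case
   [min L = 1]. *)
pose N := fix N k := if k is k'.+1 then maxn (N k').+1 (g (N k')) else 2%N.
have iN : incr N by move=> k /=; rewrite leq_max leqnn.
have N0 k : (0 < N k)%N by apply: leq_trans (incr_le iN (leq0n k)).
have small n k p : (n <= k)%N -> p \in P (N n) -> md (value_at p (f (N k.+1))) <= 2^-1 ^+ k / 32.
  move=> nk pP; apply: (@le_trans _ _ (2^-1 ^+ (N k) / 32)); last first.
    by rewrite ler_pM2r ?invr_gt0//; apply: pow_le; exact: incr_ge.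
  apply: hg; first by rewrite /= leq_max leqnn orbT.
  apply/flattenP; exists (P (N n)) => //; apply: map_f.
  by rewrite mem_iota add0n ltnS incr_le.
exists N; split => // c n m nm.
pose s n := \sum_(i < n) c i *: f (N i).
have sS k : s k.+1 = s k + c k *: f (N k) by rewrite /s big_ord_recr.
rewrite -/(s n) -/(s m).
pose S : R := \big[Num.max/0]_(i < m.+1) rnorm rs (s i).
have leS i : (i <= m)%N -> rnorm rs (s i) <= S.
  rewrite -ltnS => im; exact: (le_bigmax _ (fun i : 'I_m.+1 => rnorm rs (s i)) (Ordinal im)).
have S0 : 0 <= S by apply: le_trans (rnorm_ge0 _ _) (leS 0%N _).
have cS k : (k < m)%N -> md (c k) <= 2 * S.
  move=> km; have <- : rnorm rs (c k *: f (N k)) = md (c k).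
    by rewrite rnormZ /rnorm hf1// -(rmorph1 (inr rs)) modulus_inr normr1 mulr1.
  have -> : c k *: f (N k) = s k.+1 - s k by rewrite sS addrC addKr.
  by apply: le_trans (rnormB _ _ _) _; have := leS _ km; have := leS _ (ltnW km); lra.
(* Applied to the largest partial sum, this gives [S <= 2 * rnorm (s m)], whence the constant 2. *)
suff h k : (k <= m)%N -> rnorm rs (s k) <= rnorm rs (s m) + S / 2.
  suff : S <= rnorm rs (s m) + S / 2 by have := leS _ nm; lra.
  apply: bigmax_le => [|i _]; last by apply: h; rewrite -ltnS.
  by have := rnorm_ge0 rs (s m); lra.
case: k => [_|k km].
  by rewrite /s big_ord0 rnorm0; have := rnorm_ge0 rs (\sum_(i < m) c i *: f (N i)); lra.
apply: rnorm_le => [|t t0 tk]; first by have := rnorm_ge0 rs (s m); lra.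
have [p pP hp] := hP (N k) t t0 tk.
have h1 : md (value_at t (s k.+1) - value_at p (s k.+1)) <= S / 8.
  have -> : value_at t (s k.+1) - value_at p (s k.+1) =
      \sum_(i < k.+1) c i * (value_at t (f (N i)) - value_at p (f (N i))).
    rewrite /s !(value_at_sum _ _ c (fun i => f (N i))) -sumrB; apply: eq_bigr => i _.
    by rewrite mulrBr.
  apply: le_trans (modulus_sum rs _ (fun i => c i * (value_at t (f (N i)) - value_at p (f (N i))))) _.
  apply: (@le_trans _ _ (\sum_(i < k.+1) 2 * S * (16^-1 / (N k).+1%:R))).
    apply: ler_sum => i _; rewrite modulusM ler_pM ?modulus_ge0//.
      by apply: cS; exact: leq_trans km.
    by apply: hp; apply: incr_le => //; rewrite -ltnS.
  rewrite sumr_const card_ord -[_ *+ k.+1]mulr_natr.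
  have : k.+1%:R / (N k).+1%:R <= 1 :> R.
    by rewrite ler_pdivrMr// mul1r ler_nat ltnS incr_ge.
  move=> h; have := ler_wpM2l S0 h.
  move: (k.+1%:R : R) ((N k).+1%:R^-1 : R) => x y hS.
  have -> : 2 * S * (16^-1 * y) * x = S * (x * y) / 8 by field.
  by lra.
have h2 j : (k.+1 + j <= m)%N -> md (value_at p (s (k.+1 + j)%N) - value_at p (s k.+1)) <=
    S / 8 * (2^-1 ^+ k - 2^-1 ^+ (k + j)).
  elim: j => [|j IH] jm; first by rewrite !addn0 !subrr modulus0 mulr0.
  rewrite addnS sS value_atD value_atZ addrAC.
  apply: le_trans (modulusD _ _ _) _.
  apply: (@le_trans _ _ (S / 8 * (2^-1 ^+ k - 2^-1 ^+ (k + j)) + 2 * S * (2^-1 ^+ (k + j) / 32))).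
    apply: lerD; first by apply: IH; lia.
    rewrite modulusM ler_pM ?modulus_ge0//; first by apply: cS; lia.
    by rewrite addSn; apply: small pP; exact: leq_addr.
  by rewrite addnS exprS; have := mulr_ge0 S0 (ltW (pow_gt0 (k + j)%N)); lra.
have h3 := h2 (m - k.+1)%N; rewrite subnKC// in h3; have {}h3 := h3 (leqnn _).
have h4 : S / 8 * (2^-1 ^+ k - 2^-1 ^+ (k + (m - k.+1))) <= S / 8.
  have := pow_le 0%N k (leq0n k); rewrite expr0 => p1.
  rewrite -[leRHS]mulr1; apply: ler_wpM2l; [lra|have := pow_gt0 (k + (m - k.+1))%N; lra].
have h5 := modulus_value_at_le p (s m).
have -> : value_at t (s k.+1) = value_at p (s m) + (value_at t (s k.+1) - value_at p (s k.+1)) -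
    (value_at p (s m) - value_at p (s k.+1)) by ring.
apply: le_trans (modulusD _ _ _) _; rewrite modulusN.
by apply: le_trans (lerD (modulusD _ _ _) (lexx _)) _; lra.
Qed.

End basic_subsequence.

Lemma sum_subsequence (V : nmodType) (N : nat -> nat) (F : nat -> V) m : incr N ->
  (forall i, (i < N m)%N -> (forall k, i <> N k) -> F i = 0) ->
  \sum_(i < N m) F i = \sum_(k < m) F (N k).
Proof.
move=> iN; elim: m => [|m IH] h.
  rewrite big_ord0 big1// => i _; apply: h => [//|k iE].
  by have := incr_le iN (leq0n k); rewrite -iE leqNgt ltn_ord.
rewrite big_ord_recr /= -IH => [|i im]; last by apply: h; exact: ltn_trans im (iN m).
rewrite -(subnKC (iN m)) big_split_ord /= big_ord_recr /= -addrA; congr (_ + _).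
rewrite big1 ?addr0// => i _; apply: h => [|k iE].
  by rewrite -ltn_subRL ltn_ord.
have : (N m < N k)%N by rewrite -iE leq_addr.
rewrite incr_ltE// => /(incr_le iN); rewrite -iE.
by have := ltn_ord i; have := iN m; lia.
Qed.

(** * Basic sequences from bounded projections *)

Section basic_sequences.
Variables (R : realType) (K : numFieldType) (rs : scalars R K) (V : normedModType K).
Local Notation md := (modulus rs).
Local Notation io := (inr rs).
Local Notation rnorm := (rnorm rs).
Implicit Types x : nat -> V.

Definition projections_le2 x := forall (c : nat -> K) n m, (n <= m)%N ->
  rnorm (\sum_(i < n) c i *: x i) <= 2 * rnorm (\sum_(i < m) c i *: x i).

Lemma rnorm_eq1 (v : V) : `|v| = 1 -> rnorm v = 1.
Proof. by move=> v1; apply: (@inr_inj _ _ rs); rewrite -rnormE v1 rmorph1. Qed.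

Lemma coordinate_le x (c : nat -> K) k m : projections_le2 x ->
  (forall n, rnorm (x n) = 1) -> (k < m)%N ->
  md (c k) <= 4 * rnorm (\sum_(i < m) c i *: x i).
Proof.
move=> xB x1 km; have <- : rnorm (c k *: x k) = md (c k) by rewrite rnormZ x1 mulr1.
have -> : c k *: x k = \sum_(i < k.+1) c i *: x i - \sum_(i < k) c i *: x i.
  by rewrite big_ord_recr /= addrAC subrr add0r.
apply: le_trans (rnormB _ _ _) _.
by have := xB c _ _ km; have := xB c _ _ (ltnW km); lra.
Qed.

Lemma cvg_rnorm (u : nat -> V) v :
  u @ \oo --> v <-> forall e, 0 < e -> exists n, forall i, (n <= i)%N -> rnorm (v - u i) <= e.
Proof.
split=> [/cvgrPdist_le h e|h].
  rewrite -(inr_gt0 rs) => /h[n _ hn]; exists n => i /hn /=.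
  by rewrite (rnormE rs) inr_le.
apply/cvgrPdist_le => e e0; have eE : e = io (md e) by rewrite -normE gtr0_norm.
have := e0; rewrite eE inr_gt0 => /h[n hn]; exists n => // i /= /hn.
by rewrite (rnormE rs) inr_le.
Qed.

Lemma closure_rnorm (A : set V) v : closure A v ->
  forall e, 0 < e -> exists2 w, A w & rnorm (v - w) <= e.
Proof.
move=> Av e; rewrite -(inr_gt0 rs) => e0.
have [w [Aw]] := Av _ (nbhsx_ballx v _ e0); rewrite -ball_normE /= => vw.
by exists w => //; rewrite -(inr_le rs) -rnormE ltW.
Qed.

(** Finite combinations approaching [v] have Cauchy coefficients, because coordinates are bounded.
    Completeness of the scalars gives the coefficients of [v], and bounded coordinates also give
    uniqueness. *)
Lemma projections_le2_basic x : projections_le2 x -> (forall n, rnorm (x n) = 1) ->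
  basic_sequence x.
Proof.
move=> xB x1 v vx.
have pow_gt0 m : 0 < 2^-1 ^+ m :> R by rewrite exprn_gt0// invr_gt0.
have pow_le m n : (m <= n)%N -> 2^-1 ^+ n <= 2^-1 ^+ m :> R.
  by move=> mn; apply: ler_wiXn2l => //; lra.
have pow_small e : 0 < e -> exists m, 2^-1 ^+ m <= e :> R.
  move=> e0; have : (fun n => 2^-1 ^+ n : R) @ \oo --> (0 : R).
    by apply: cvg_expr; rewrite gtr0_norm ?invr_gt0//; lra.
  move/cvgrPdist_le/(_ _ e0) => [m _ /(_ m (leqnn _))] /=.
  by rewrite sub0r normrN gtr0_norm//; exists m.
(* Coefficients are cut to 0 beyond [n], so that every long partial sum is the approximating
   combination itself. *)
have /choice[a] : forall j, exists b : (nat -> K) * nat, forall m, (b.2 <= m)%N ->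
    rnorm (v - \sum_(i < m) b.1 i *: x i) <= 2^-1 ^+ j.
  move=> j; have [w [n [b ->]] vw] := closure_rnorm vx (pow_gt0 j).
  exists (fun i => if (i < n)%N then b i else 0, n) => m /= nm.
  rewrite -(subnKC nm) big_split_ord /= [X in _ - (_ + X)]big1 ?addr0; last first.
    by move=> i _; rewrite ltnNge leq_addr scale0r.
  by under eq_bigr => i _ do rewrite ltn_ord.
move=> ha; pose s j m := \sum_(i < m) (a j).1 i *: x i.
have hs j m : ((a j).2 <= m)%N -> rnorm (v - s j m) <= 2^-1 ^+ j by exact: ha.
have sB j l m : rnorm (s j m - s l m) <= 2 * (2^-1 ^+ j + 2^-1 ^+ l).
  pose M := maxn m (maxn (a j).2 (a l).2).
  have sBE m' : s j m' - s l m' = \sum_(i < m') ((a j).1 i - (a l).1 i) *: x i.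
    by rewrite -sumrB; apply: eq_bigr => i _; rewrite scalerBl.
  have := xB (fun i => (a j).1 i - (a l).1 i) m M; rewrite -!sBE leq_maxl => /(_ isT) h.
  apply: le_trans h _; rewrite ler_pM2l//.
  have -> : s j M - s l M = (v - s l M) - (v - s j M) by rewrite opprB [RHS]addrC addrA subrK.
  apply: le_trans (rnormB _ _ _) _; rewrite addrC lerD// hs//; rewrite /M; lia.
have aB k j l : md ((a j).1 k - (a l).1 k) <= 4 * (2^-1 ^+ j + 2^-1 ^+ l).
  have <- : rnorm (((a j).1 k - (a l).1 k) *: x k) = md ((a j).1 k - (a l).1 k).
    by rewrite rnormZ x1 mulr1.
  have -> : ((a j).1 k - (a l).1 k) *: x k = (s j k.+1 - s l k.+1) - (s j k - s l k).
    by rewrite /s !big_ord_recr /= opprD addrACA -scalerBl [RHS]addrAC subrr add0r.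
  apply: le_trans (rnormB _ _ _) _.
  by have := sB j l k; have := sB j l k.+1; lra.
have /choice[al hal] : forall k, exists l, forall e, 0 < e -> exists n, forall i, (n <= i)%N ->
    md ((a i).1 k - l) <= e.
  move=> k; apply: (scalars_complete (s := rs)) => e e0.
  have [|n hn] := pow_small (e / 8); first by lra.
  exists n => i j ni nj; apply: le_trans (aB k i j) _.
  by have := pow_le _ _ ni; have := pow_le _ _ nj; lra.
(* Obtained from [sB] by letting [l] tend to infinity; [e] absorbs the error at a finite stage. *)
have alB n j e : 0 < e -> rnorm (\sum_(i < n) al i *: x i - s j n) <= 4 * 2^-1 ^+ j + e.
  move=> e0; suff [l0 hl0] : exists l0, forall l, (l0 <= l)%N ->
      rnorm (\sum_(i < n) al i *: x i - s l n) <= e.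
    have -> : \sum_(i < n) al i *: x i - s j n =
        (\sum_(i < n) al i *: x i - s (maxn l0 j) n) + (s (maxn l0 j) n - s j n).
      by rewrite addrA subrK.
    apply: le_trans (rnormD _ _ _) _; have := hl0 _ (leq_maxl l0 j).
    by have := sB (maxn l0 j) j n; have := pow_le _ _ (leq_maxr l0 j); lra.
  elim: n e e0 => [|n IH] e e0.
    by exists 0%N => l _; rewrite /s !big_ord0 subrr rnorm0 ltW.
  have [|l1 h1] := IH (e / 2); first by lra.
  have [|l2 h2] := hal n (e / 2); first by lra.
  exists (maxn l1 l2) => l; rewrite geq_max => /andP[/h1 ll1 /h2 ll2].
  rewrite /s !big_ord_recr /= opprD addrACA -scalerBl.
  apply: le_trans (rnormD _ _ _) _; rewrite rnormZ x1 mulr1.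
  by move: ll2; rewrite -modulusN opprB /s in ll1 *; lra.
exists al; split.
  apply/cvg_rnorm => e e0.
  have [|j hj] := pow_small (e / 8); first by lra.
  exists (a j).2 => n nj; rewrite /series /= big_mkord.
  have := @alB n j (e / 8).
  have -> : v - \sum_(i < n) al i *: x i =
     (v - s j n) - (\sum_(i < n) al i *: x i - s j n).
    by rewrite opprB addrA subrK.
  move=> h; apply: le_trans (rnormB _ _ _) _; have := hs _ _ nj.
  by have := h _; lra.
move=> b /cvg_rnorm hb; apply/funext => k; apply/eqP; rewrite -subr_eq0; apply/eqP.
apply/(@modulus_eq0 _ _ rs)/eqP; rewrite eq_le modulus_ge0 andbT.
apply/ler_addgt0Pr => e e0; rewrite add0r.
have [|j hj] := pow_small (e / 64); first by lra.
have [|n hn] := hb (e / 16); first by lra.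
pose m := maxn n (maxn k.+1 (a j).2).
have km : (k < m)%N by rewrite /m; lia.
have := @coordinate_le x (fun i => al i - b i) k m xB x1 km.
have -> : \sum_(i < m) (al i - b i) *: x i = (\sum_(i < m) al i *: x i - s j m)
    - (v - s j m) + (v - \sum_(i < m) b i *: x i).
  rewrite opprB [X in _ = X + _]addrA subrK [RHS]addrA subrK -sumrB.
  by apply: eq_bigr => i _; rewrite scalerBl.
have h1 := @alB m j (e / 64).
have h2 := hs j m; have h3 := hn m; rewrite /series /= big_mkord in h3.
move=> h; apply: le_trans h _.
apply: (@le_trans _ _ (4 * (rnorm (\sum_(i < m) al i *: x i - s j m) + rnorm (v - s j m) + rnorm (v - \sum_(i < m) b i *: x i)))).
  rewrite ler_pM2l//; apply: le_trans (rnormD _ _ _) _; rewrite lerD2r; exact: rnormB.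
have {}h3 : rnorm (v - \sum_(i < m) b i *: x i) <= e / 16 by apply: h3; rewrite /m; lia.
have {}h2 : rnorm (v - s j m) <= 2^-1 ^+ j by apply: h2; rewrite /m; lia.
by have {}h1 := h1 _; lra.
Qed.

End basic_sequences.

Lemma infinite_range_incr (N : nat -> nat) : incr N -> infinite_set (range N).
Proof.
move=> iN; have NI : {in setT &, injective N}.
  move=> i j _ _ ij; case: (ltngtP i j) => // /(incr_lt iN); by rewrite ij ltnn.
rewrite (eq_finite_set (inj_card_eq NI)); exact: infinite_nat.
Qed.

(** * Averages as blocks of a basic subsequence *)

Section subsequence_blocks.
Variables (R : realType) (K : numFieldType) (rs : scalars R K) (V : normedModType K).
Local Notation md := (modulus rs).
Local Notation io := (inr rs).
Local Notation rnorm := (rnorm rs).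
Variables (f : nat -> V) (N : nat -> nat).
Hypothesis iN : incr N.
Hypothesis N0 : (1 < N 0)%N.
Hypothesis f1 : forall n, rnorm (f (N n)) = 1.
Hypothesis fB : projections_le2 rs (f \o N).
Implicit Types p : {poly R}.
Local Notation G := (range N).
Local Notation comb := (comb_of rs f).
Local Notation nrm := (fun p => rnorm (comb p)).

Lemma comb_of_subsequence p m : (forall i, p`_i != 0 -> G i) -> (size p <= N m)%N ->
  comb p = \sum_(k < m) io p`_(N k) *: f (N k).
Proof.
move=> pG pm; rewrite (comb_ofE rs f pm).
apply: (sum_subsequence (F := fun i => io p`_i *: f i)) => // i _ nN.
have [->|/pG[k _ kE]] := eqVneq p`_i 0; first by rewrite rmorph0 scale0r.
by have := nN k; rewrite kE.
Qed.

(** Truncating a polynomial at degree [n] amounts to a partial sum along [N], stopped at the first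
    [j] with [n <= N j]. *)
Lemma subsequence_block_norm : block_norm G nrm.
Proof.
split.
- by move=> _ [k _ <-]; apply: leq_trans N0 _; exact: incr_le.
- by move=> c p; rewrite comb_ofZ rnormZ modulus_inr.
- by move=> p q; rewrite comb_ofD rnormD.
- by move=> _ [k _ <-]; rewrite comb_ofX f1.
move=> n p pG.
have ex : exists k, (n <= N k)%N by exists n; exact: incr_ge.
case: (ex_minnP ex) => j nj jmin.
pose m := maxn j (size p).
rewrite (@comb_of_subsequence p m) => [||]; [|exact: pG|]; last first.
  by apply: leq_trans (incr_ge m iN); exact: leq_maxr.
rewrite (@comb_of_subsequence (take_poly n p) j); last 2 first.
- move=> i; rewrite coef_take_poly; case: ifP => // _; [exact: pG|by rewrite eqxx].
- exact: leq_trans (size_take_poly _ _) nj.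
rewrite (eq_bigr (fun k : 'I_j => io p`_(N k) *: f (N k))) => [|k _].
  by apply: (fB (fun k => io p`_(N k))); exact: leq_maxl.
rewrite coef_take_poly ltnNge; case: (boolP (n <= N k)%N) => // /jmin.
by rewrite leqNgt ltn_ord.
Qed.

Variables (d q : nat -> nat) (w : nat -> {poly R}).
Hypothesis wB : forall i, blk G nrm (d i) (q i) (w i).
Hypothesis qd : forall i, (q i < d i.+1)%N.

Let dq i : (d i <= q i)%N.
Proof. exact: blk_le (wB i). Qed.

Let d_le i j : (i <= j)%N -> (d i <= d j)%N.
Proof.
move=> ij; rewrite -(subnKC ij); elim: (j - i)%N => [|k IH]; first by rewrite addn0.
by rewrite addnS; apply: leq_trans IH (leq_trans (dq _) (ltnW (qd _))).
Qed.

Let q_lt i j : (i < j)%N -> (q i < d j)%N.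
Proof. by move=> ij; apply: leq_trans (qd i) (d_le ij). Qed.

Let wG i j : (w i)`_j != 0 -> [/\ (d i <= j)%N, (j <= q i)%N & G j].
Proof. by have [h _ _ _ _] := wB i => /h[]. Qed.

Let size_w i j : (i < j)%N -> (size (w i) <= d j)%N.
Proof.
move=> ij; apply/leq_sizeP => k jk; apply/eqP; apply: contraT => /wG[_ kq _].
by have := leq_trans (q_lt ij) jk; rewrite ltnNge kq.
Qed.

(** Expanded along [N], the first [j] blocks form the partial sum of the whole over the indices
    below [d j]. *)
Lemma blocks_projections_le2 : projections_le2 rs (fun i => comb (w i)).
Proof.
move=> a n m nm.
have /choice[kk hk] : forall i, exists k, N k = d i.
  by move=> i; have [_ _ wd _ _] := wB i; have [_ _ [k _ <-]] := wG wd; exists k.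
pose c k := \sum_(i < m) a i * io (w i)`_(N k).
have sumE j : (j <= m)%N -> \sum_(k < kk j) c k *: f (N k) = \sum_(i < j) a i *: comb (w i).
  move=> jm; have -> : \sum_(k < kk j) c k *: f (N k) =
      \sum_(i < m) a i *: \sum_(k < kk j) io (w i)`_(N k) *: f (N k).
    under eq_bigr => k _ do rewrite scaler_suml.
    rewrite exchange_big /=; apply: eq_bigr => i _; rewrite scaler_sumr.
    by apply: eq_bigr => k _; rewrite scalerA.
  rewrite -(subnKC jm) big_split_ord /= [X in _ + X]big1 ?addr0 => [|i _].
    apply: eq_bigr => i _; congr (_ *: _); rewrite (@comb_of_subsequence _ (kk j))//.
      by move=> i' /wG[].
    by rewrite hk size_w.
  rewrite big1 ?scaler0// => k _; have [->|/wG[dk _ _]] := eqVneq (w (j + i)%N)`_(N k) 0.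
    by rewrite rmorph0 scale0r.
  have := leq_trans (d_le (leq_addr i j)) dk; rewrite -hk leqNgt incr_ltE//.
  by rewrite ltn_ord.
rewrite -!sumE//; apply: fB.
rewrite leqNgt -(incr_ltE _ _ iN) !hk -leqNgt; exact: d_le.
Qed.

Lemma block_basis_coefs : block_basis G (fun i => coefs rs (w i)).
Proof.
split=> [i|i].
  have [_ _ wd _ _] := wB i; split; first exact: finite_supp_coefs.
    by exists (d i); rewrite supp_coefs.
  by rewrite supp_coefs => j /= /wG[].
by rewrite (supp_coefs_max (wB _)) (supp_coefs_min (wB _)).
Qed.

Lemma is_average_coefs (s : omega1 -> nat -> omega1) al m n p :
  Avg s G nrm al m n p -> is_average f s al G (coefs rs p).
Proof.
move=> pA; have HN := subsequence_block_norm.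
have [h _ _ _ _] := Avg_blk HN pA.
(* The average is determined by its support as an initial segment of the set; the rest of [G] is
   appended to make the set infinite. *)
exists (supp (coefs rs p) `|` (G `\` `I_n.+1)); split.
- apply: (@sub_infinite_set _ (G `\` `I_n.+1)); first exact: subsetUr.
  exact: infinite_setD (infinite_range_incr iN) (finite_II _).
- by rewrite supp_coefs => i [/= /h[]|[]].
- apply: (Avg_average HN pA) => i; rewrite supp_coefs; split.
    by move=> pi; have [_ ? _] := h i pi; split => //; left.
  by move=> [[//|[_ /= iq]] /= ni]; case: iq.
Qed.

End subsequence_blocks.

(** * Equivalence with the unit vector basis of [c0] *)

Section c0_equivalence.
Variables (R : realType) (K : numFieldType) (rs : scalars R K) (V : normedModType K).
Local Notation md := (modulus rs).

Lemma c0_combE n (a : nat -> K) j :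
  val (\sum_(i < n) a i *: c0_basis K i) j = if (j < n)%N then a j else 0.
Proof.
elim: n => [|n IH]; first by rewrite big_ord0.
rewrite big_ord_recr; set u := \sum_(i < n) _ in IH *.
change (val u j + a n * (j == n)%:R = if (j < n.+1)%N then a j else 0); rewrite IH.
case: ltngtP => [jn|jn|->]; first by rewrite mulr0 addr0 ltnW.
  by rewrite mulr0 addr0 ltnNge jn.
by rewrite mulr1 add0r leqnn.
Qed.

Lemma coef_le_c0_norm n (a : nat -> K) j : (j < n)%N ->
  `|a j| <= `|\sum_(i < n) a i *: c0_basis K i|.
Proof.
move=> jn; set z := \sum_(i < n) _.
have [zs|zs] := c0_good z; last by have := zs 0%N.
by apply: le_trans (le_supnorm j zs); rewrite /z c0_combE jn.
Qed.

Lemma c0_norm_le n (a : nat -> K) (b : K) : 0 <= b -> (forall j, (j < n)%N -> `|a j| <= b) ->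
  `|\sum_(i < n) a i *: c0_basis K i| <= b.
Proof.
move=> b0 ab; set z := \sum_(i < n) _.
have [zs|zs] := c0_good z; last by have := zs 0%N.
apply: (supnorm_le zs) => j; rewrite /z c0_combE.
by case: ifP => [/ab//|_]; rewrite normr0.
Qed.

(** The lower constant 1/4 comes from coordinates of norm at most 4; the maximum with 1 makes the
    upper constant positive. *)
Lemma equivalent_c0 (x : nat -> V) (C : R) : projections_le2 rs x ->
  (forall n, rnorm rs (x n) = 1) ->
  (forall n (a : nat -> K) b, 0 <= b -> (forall i, (i < n)%N -> md (a i) <= b) ->
    rnorm rs (\sum_(i < n) a i *: x i) <= C * b) ->
  equivalent x (c0_basis K).
Proof.
move=> xB x1 xC; exists (inr rs 4^-1), (inr rs (Num.max C 1)).
split=> [||n a]; try by rewrite inr_gt0 ?lt_max ?ltr01 ?orbT// invr_gt0.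
have [z zE] : exists z, `|\sum_(i < n) a i *: c0_basis K i| = inr rs z.
  by exists (rnorm rs (\sum_(i < n) a i *: c0_basis K i)); rewrite (rnormE rs).
have z0 : 0 <= z by rewrite -(inr_ge0 rs) -zE.
have az i : (i < n)%N -> md (a i) <= z.
  by move=> /coef_le_c0_norm h; rewrite -(inr_le rs) -normE -zE.
rewrite zE (rnormE rs) -!rmorphM !inr_le; apply/andP; split; last first.
  apply: le_trans (xC _ _ _ z0 az) _; apply: ler_wpM2r => //.
  by rewrite le_max lexx.
rewrite ler_pdivrMl//; rewrite -(inr_le rs) -zE; apply: c0_norm_le.
  by rewrite inr_ge0 mulr_ge0// rnorm_ge0.
move=> j jn; rewrite (normE rs) inr_le; exact: coordinate_le.
Qed.

End c0_equivalence.

(** * Application to weakly null sequences of continuous functions *)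

Section averages_in_Cspace.
Variables (R : realType) (K : numFieldType) (rs : scalars R K).
Variables (s : omega1 -> nat -> omega1) (xi : omega1).
Hypothesis hs : associated_sequences s.
Local Notation kap := (oexp oomega (oexp oomega xi)).
Variable f : nat -> Cspace K kap.
Hypothesis hf1 : forall n : nat, (0 < n)%N -> `|f n| = 1.
Hypothesis hf0 : weakly_null f.

Lemma averages_equivalent_c0 : exists M : set nat,
    [/\ infinite_set M, M `<=` posnats,
        basic_sequence (f \o elt M) &
        exists (alpha : omega1) (u : nat -> nat -> K),
          [/\ (alpha <= xi)%O,
              block_basis M u,
              forall n : nat, is_average f s alpha M (u n) &
              equivalent (fun n : nat => lincomb f (u n)) (c0_basis K)]].
Proof.
have [N [iN N0 fB0]] := basic_subsequence rs hf1 hf0.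
have fB : projections_le2 rs (f \o N) := fB0.
have f1 n : rnorm rs (f (N n)) = 1.
  apply/rnorm_eq1/hf1; apply: leq_trans (ltnW N0) _; exact: incr_le.
have HN := subsequence_block_norm iN N0 f1 fB.
pose ev b t p := part rs b (value_at t (comb_of rs f p)).
have evD b t p q : ev b t (p + q) = ev b t p + ev b t q.
  by rewrite /ev comb_ofD value_atD partD.
have evZ b t c p : ev b t (c *: p) = c * ev b t p.
  by rewrite /ev comb_ofZ value_atZ partZ.
have Ginf n : exists2 m, (n <= m)%N & range N m.
  by exists (N n); [exact: incr_ge|exists n].
have ev_le b t p : (ozero < t)%O -> (t <= kap)%O -> `|ev b t p| <= rnorm rs (comb_of rs f p).
  by move=> _ _; apply: le_trans (part_le _ _ _) _; exact: modulus_value_at_le.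
have ev_cont b (t : omega1) p (e : R) : (ozero < t)%O -> (t <= kap)%O -> 0 < e -> exists2 a, (a < t)%O &
    forall u, (a < u)%O -> (u <= t)%O -> `|ev b u p - ev b t p| < e.
  rewrite -(inr_gt0 rs) => t0 tk e0.
  have [a at_ ha] := value_at_left_continuous (comb_of rs f p) t0 tk e0.
  exists a => // u au ut; have := ha u au ut; rewrite (normE rs).
  rewrite lt_neqAle inr_le => /andP[ne le].
  rewrite -[- ev b t p]mulN1r -partZ rmorphN1 mulN1r -partD.
  apply: le_lt_trans (part_le _ _ _) _.
  by rewrite lt_neqAle le andbT; apply: contraNN ne => /eqP ->.
have ev_null b (t : omega1) (e : R) : (ozero < t)%O -> (t <= kap)%O -> 0 < e -> exists n0 : nat, forall n,
    (n0 <= n)%N -> range N n -> `|ev b t 'X^n| <= e.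
  move=> _ _ /(modulus_value_at_null rs hf0 t)[n hn]; exists n => i /hn ni _.
  by rewrite /ev comb_ofX; apply: le_trans (part_le _ _ _) ni.
have [al [d [q [w [alxi wA qd [C hC]]]]]] :=
  summable_averages hs HN Ginf evZ evD ev_le ev_cont ev_null (erefl kap).
have wB i := Avg_blk HN (wA i).
exists (range N); split.
- exact: infinite_range_incr.
- by move=> _ [k _ <-]; apply: leq_trans (ltnW N0) _; exact: incr_le.
- by rewrite elt_range//; apply: (projections_le2_basic (rs := rs)) => // n; exact: f1.
exists al, (fun i => coefs rs (w i)); split => //.
- exact: (block_basis_coefs wB qd).
- by move=> n; exact: (is_average_coefs iN N0 f1 fB (wA n)).
rewrite (_ : (fun n => _) = fun n => comb_of rs f (w n)); last first.
  by apply/funext => n; rewrite lincomb_coefs.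
have C0 : 0 <= Num.max C 0 by rewrite le_max lexx orbT.
(* The factor 2 accounts for the real and the imaginary part, each with its own bound [C] on
   sums. *)
apply: (equivalent_c0 (rs := rs) (C := 2 * Num.max C 0)).
- exact: (blocks_projections_le2 iN fB wB qd).
- by move=> n; have [] := wB n.
move=> n a b b0 ab; apply: rnorm_le => [|t t0 tk]; first by rewrite !mulr_ge0.
rewrite (value_at_sum _ _ a (fun i => comb_of rs f (w i))).
apply: le_trans (modulus_sum rs _ (fun i => a i * value_at t (comb_of rs f (w i)))) _.
apply: (@le_trans _ _ (\sum_(i < n) b * (`|ev true t (w i)| + `|ev false t (w i)|))).
  apply: ler_sum => i _; rewrite modulusM ler_pM ?modulus_ge0 ?ab//.
  exact: modulus_le.
rewrite -mulr_sumr [leRHS]mulrC; apply: ler_wpM2l => //.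
rewrite big_split /= mulr2n mulrDl !mul1r.
by apply: lerD; apply: le_trans (hC _ t t0 tk n) _; rewrite le_max lexx.
Qed.

End averages_in_Cspace.

Theorem corollary6p8 (R : realType) (K : numFieldType)
  (hK : K = R :> numFieldType \/ K = R[i] :> numFieldType)
  (s : omega1 -> nat -> omega1) (hs : associated_sequences s)
  (xi : omega1) (f : nat -> Cspace K (oexp oomega (oexp oomega xi)))
  (hf1 : forall n : nat, (0 < n)%N -> `|f n| = 1) (hf0 : weakly_null f) :
  exists M : set nat,
    [/\ infinite_set M, M `<=` posnats,
        basic_sequence (f \o elt M) &
        exists (alpha : omega1) (u : nat -> nat -> K),
          [/\ (alpha <= xi)%O,
              block_basis M u,
              forall n : nat, is_average f s alpha M (u n) &
              equivalent (fun n : nat => lincomb f (u n)) (c0_basis K)]].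
Proof.
case: hK => KE; subst K.
- exact: (averages_equivalent_c0 (real_scalars R) hs hf1 hf0).
- exact: (averages_equivalent_c0 (complex_scalars R) hs hf1 hf0).
Qed.
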